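(* There is a data structure that maintains a rooted binary tree on top of $n$ leaves numbered $1, \dots, n$ (starting from $n=0$), each leaf storing an item, such that each node of the tree stores a pointer to the minimum item in its subtree and every leaf $i$ has depth $O(d(i))$, and which supports the following operations: (i) $\texttt{addLeaf}(x)$: in amortized $O(1)$ time, increment $n$ and add a new leaf with index $n$, item $x$ and $s(n) = -\infty$; (ii) $\texttt{access}(i)$: in amortized $O(d(i))$ time (with $d(i)$ evaluated before the operation), set $s(i) = t$ and then increment $t$; the very first access operation runs in amortized $O(1)$ time; (iii) $\texttt{changeKey}(i, x)$: in $O(d(i))$ time, replace the item stored at leaf $i$ by $x$. The data structure may restructure the internal nodes arbitrarily, and the leaves need not be stored in index order.
   Context: Items come from a totally ordered universe. There is a time counter $t$, initially $0$. Every leaf $i$ has a last access time $s(i)$, which is either $-\infty$ (never accessed) or an integer with $s(i) < t$. Define $d(i) = 1 + \min_{1 \le j \le n} \big(\log(1 + |i-j|) + \log(1 + t - s(j))\big)$, with $\log$ base 2 and with the convention that the term for $j$ is $+\infty$ if $s(j) = -\infty$. *)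

(* Defs.v *)
From mathcomp Require Import all_boot all_order all_algebra.
From mathcomp Require Import reals ereal exp.

Set Implicit Arguments.
Unset Strict Implicit.
Unset Printing Implicit Defensive.

Import Order.TTheory GRing.Theory Num.Theory.

(* The cost model is the comparison-based word RAM. Besides the word memory
   there is an item memory, addressed by the same words, whose contents can only
   be copied and compared. Commands are first-order syntax, so a program is a
   fixed finite object that depends neither on n and t nor on the universe of
   items; each executed instruction and each evaluated test costs 1. *)

Inductive arith := Plus | Minus | Times | Quotient.

Inductive instr :=
  | Const of nat & nat                 (* reg x := c                          *)
  | Arith of arith & nat & nat & nat   (* reg x := reg y op reg z             *)
  | ReadWord of nat & nat              (* reg x := word at address reg y      *)
  | WriteWord of nat & nat             (* word at address reg x := reg y      *)
  | CopyItem of nat & nat.             (* item at reg x := item at reg y      *)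

Inductive test :=
  | TestEq of nat & nat                (* reg x = reg y                       *)
  | TestLt of nat & nat                (* reg x < reg y                       *)
  | TestItemLe of nat & nat.           (* item at reg x <= item at reg y      *)

Inductive cmd :=
  | Skip
  | Do of instr
  | Seq of cmd & cmd
  | If of test & cmd & cmd
  | While of test & cmd.

Definition upd (T : Type) (f : nat -> T) (a : nat) (v : T) : nat -> T :=
  fun b => if b == a then v else f b.

Definition eval_arith (o : arith) (x y : nat) : nat :=
  match o with
  | Plus => x + y
  | Minus => x - y
  | Times => x * y
  | Quotient => x %/ y
  end.

Section Machine.
Context {disp : Order.disp_t} {U : orderType disp}.

Record memory := Memory {
  word : nat -> nat;
  item : nat -> option U
}.

Record state := State {
  reg : nat -> nat;
  mem : memory
}.

Definition set_reg (s : state) (x v : nat) : state :=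
  State (upd (reg s) x v) (mem s).

(* W is the number of distinct machine words: an instruction producing a value
   >= W has no result, so a program that overflows does not terminate normally. *)
Definition do_instr (W : nat) (i : instr) (s : state) : option state :=
  match i with
  | Const x c => if c < W then Some (set_reg s x c) else None
  | Arith o x y z =>
      let v := eval_arith o (reg s y) (reg s z) in
      if v < W then Some (set_reg s x v) else None
  | ReadWord x y => Some (set_reg s x (word (mem s) (reg s y)))
  | WriteWord x y =>
      Some (State (reg s)
        (Memory (upd (word (mem s)) (reg s x) (reg s y)) (item (mem s))))
  | CopyItem x y =>
      Some (State (reg s)
        (Memory (word (mem s))
                (upd (item (mem s)) (reg s x) (item (mem s) (reg s y)))))
  end.

Definition eval_test (b : test) (s : state) : option bool :=
  match b with
  | TestEq x y => Some (reg s x == reg s y)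
  | TestLt x y => Some (reg s x < reg s y)
  | TestItemLe x y =>
      match item (mem s) (reg s x), item (mem s) (reg s y) with
      | Some u, Some v => Some (u <= v)%O
      | _, _ => None
      end
  end.

(* exec W c s k s' : started in s, the command c halts in s' after k steps.
   At most one rule applies to any (c, s), so k and s' are determined. *)
Inductive exec (W : nat) : cmd -> state -> nat -> state -> Prop :=
  | ExecSkip s : exec W Skip s 1 s
  | ExecDo i s s' :
      do_instr W i s = Some s' -> exec W (Do i) s 1 s'
  | ExecSeq c1 c2 s1 s2 s3 k1 k2 :
      exec W c1 s1 k1 s2 -> exec W c2 s2 k2 s3 ->
      exec W (Seq c1 c2) s1 (k1 + k2) s3
  | ExecIf b c1 c2 s s' v k :
      eval_test b s = Some v -> exec W (if v then c1 else c2) s k s' ->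
      exec W (If b c1 c2) s k.+1 s'
  | ExecWhileDone b c s :
      eval_test b s = Some false -> exec W (While b c) s 1 s
  | ExecWhileStep b c s1 s2 s3 k1 k2 :
      eval_test b s1 = Some true ->
      exec W c s1 k1 s2 -> exec W (While b c) s2 k2 s3 ->
      exec W (While b c) s1 (k1 + k2).+1 s3.

End Machine.

Arguments memory {disp} U.
Arguments state {disp} U.

Record data_structure := DataStructure {
  add_leaf_prog : cmd;
  access_prog : cmd;
  change_key_prog : cmd
}.

Section Specification.
Context {disp : Order.disp_t} {U : orderType disp}.

Inductive operation :=
  | AddLeaf of U
  | Access of nat
  | ChangeKey of nat & U.

(* Leaves are numbered 1, ..., num_leaves; last_access i = None encodes
   s(i) = -oo. *)
Record instance := Instance {
  num_leaves : nat;
  clock : nat;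
  key : nat -> option U;
  last_access : nat -> option nat
}.

Definition empty_instance : instance :=
  Instance 0 0 (fun=> None) (fun=> None).

Definition is_leaf (A : instance) (i : nat) : bool := 1 <= i <= num_leaves A.

Definition admissible (A : instance) (o : operation) : bool :=
  match o with
  | AddLeaf _ => true
  | Access i => is_leaf A i
  | ChangeKey i _ => is_leaf A i
  end.

Definition apply_op (A : instance) (o : operation) : instance :=
  match o with
  | AddLeaf x =>
      let n := (num_leaves A).+1 in
      Instance n (clock A) (upd (key A) n (Some x)) (upd (last_access A) n None)
  | Access i =>
      Instance (num_leaves A) (clock A).+1 (key A)
        (upd (last_access A) i (Some (clock A)))
  | ChangeKey i x =>
      Instance (num_leaves A) (clock A) (upd (key A) i (Some x)) (last_access A)
  end.

Section Distance.
Context {R : realType}.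

Definition log2 (x : R) : R := (ln x / ln 2)%R.

Definition dist_term (A : instance) (i j : nat) : \bar R :=
  match last_access A j with
  | None => +oo%E
  | Some sj => (log2 (1 + `|i%:R - j%:R|)
                + log2 (1 + (clock A)%:R - sj%:R))%R%:E
  end.

Definition dist (A : instance) (i : nat) : \bar R :=
  (1 + \big[mine/+oo]_(1 <= j < (num_leaves A).+1) dist_term A i j)%E.

(* Amortized cost, up to the constant factor. changeKey has a worst-case bound
   of its own, hence no amortized cost: see op_time. *)
Definition amortized_cost (A : instance) (o : operation) : \bar R :=
  match o with
  | AddLeaf _ => 1%E
  | Access i => if clock A == 0 then 1%E else dist A i
  | ChangeKey _ _ => 0%E
  end.

End Distance.

Definition op_time (o : operation) (k : nat) : nat :=
  if o is ChangeKey _ _ then 0 else k.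

(* An operation starts with its index argument in register 0, all other
   registers zero, and its item argument at address 0 of the item memory; only
   the memory survives between operations. *)
Definition load_op (o : operation) (m : memory U) : state U :=
  match o with
  | AddLeaf x =>
      State (fun=> 0) (Memory (word m) (upd (item m) 0 (Some x)))
  | Access i => State (upd (fun=> 0) 0 i) m
  | ChangeKey i x =>
      State (upd (fun=> 0) 0 i) (Memory (word m) (upd (item m) 0 (Some x)))
  end.

Definition op_prog (P : data_structure) (o : operation) : cmd :=
  match o with
  | AddLeaf _ => add_leaf_prog P
  | Access _ => access_prog P
  | ChangeKey _ _ => change_key_prog P
  end.

(* Words have at most w * log (n + t + 2) bits. *)
Definition word_bound (w : nat) (A : instance) : nat :=
  (num_leaves A + clock A + 2) ^ w.

Definition exec_op (P : data_structure) (w : nat) (A : instance)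
    (o : operation) (m : memory U) (k : nat) (m' : memory U) : Prop :=
  exists2 s', exec (word_bound w A) (op_prog P o) (load_op o m) k s'
            & mem s' = m'.

(* Address 0 is the null pointer, so a leaf is a Node with two Empty children. *)
Inductive tree := Empty | Node of nat & tree & tree.

(* A tree node at address a > 0 occupies the words
     a : left child, a + 1 : right child, a + 2 : minimum pointer,
     a + 3 : leaf index (for leaves only),
   and a leaf has its item at address a of the item memory. *)
Definition min_ptr (m : memory U) (a : nat) : nat := word m (a + 2).
Definition leaf_index (m : memory U) (a : nat) : nat := word m (a + 3).

Fixpoint tree_at (m : memory U) (p : nat) (T : tree) : Prop :=
  match T with
  | Empty => p = 0
  | Node a l r =>
      [/\ p = a, a != 0, tree_at m (word m a) l & tree_at m (word m (a + 1)) r]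
  end.

Fixpoint leaves_from (k : nat) (T : tree) : seq (nat * nat) :=
  match T with
  | Empty => [::]
  | Node a Empty Empty => [:: (a, k)]
  | Node _ l r => leaves_from k.+1 l ++ leaves_from k.+1 r
  end.

(* Pairs (address, depth), the root having depth 0. *)
Definition leaves_depth (T : tree) : seq (nat * nat) := leaves_from 0 T.

Definition leaves (T : tree) : seq nat := [seq x.1 | x <- leaves_depth T].

Fixpoint subtree (T' T : tree) : Prop :=
  T' = T \/ (if T is Node _ l r then subtree T' l \/ subtree T' r else False).

Definition item_le (x y : option U) : bool :=
  if x is Some u then if y is Some v then (u <= v)%O else false else false.

Definition min_pointers (m : memory U) (T : tree) : Prop :=
  forall a l r, subtree (Node a l r) T ->
    min_ptr m a \in leaves (Node a l r) /\
    (forall b, b \in leaves (Node a l r) ->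
       item_le (item m (min_ptr m a)) (item m b)).

(* The root pointer is the word at address 0. *)
Definition represents (R : realType) (C : nat) (A : instance) (m : memory U) :
    Prop :=
  exists T : tree,
    [/\ tree_at m (word m 0) T,
        perm_eq [seq leaf_index m a | a <- leaves T] (iota 1 (num_leaves A)),
        (forall a, a \in leaves T -> item m a = key A (leaf_index m a)),
        min_pointers m T
      & forall a k, (a, k) \in leaves_depth T ->
          (k%:R%:E <= C%:R%:E * dist A (leaf_index m a) :> \bar R)%E].

(* history P w A m k b : some sequence of admissible operations, starting from
   the empty instance and zeroed memory, leads to the instance A and memory m;
   its addLeaf and access operations take k steps and have amortized costs
   summing to b. *)
Inductive history (R : realType) (P : data_structure) (w : nat) :
    instance -> memory U -> nat -> \bar R -> Prop :=
  | HistoryNil :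
      history P w empty_instance (Memory (fun=> 0) (fun=> None)) 0 0%E
  | HistoryCons A m k b o k' m' :
      history P w A m k b ->
      admissible A o ->
      exec_op P w A o m k' m' ->
      history P w (apply_op A o) m' (k + op_time o k')
        (b + amortized_cost A o)%E.

End Specification.

Arguments operation {disp} U.
Arguments instance {disp} U.

(* Main.v *)
Require Import Defs.
From mathcomp Require Import all_boot all_order all_algebra.
From mathcomp Require Import reals ereal exp.
From mathcomp Require Import zify.

(** The leaves lie in a binary trie of blocks [q 2^h, (q+1) 2^h), the blocks with q >= 1 that have
    no complete parent hanging at depth O(h) from an infinite heap. Put X_k = 2^(2^k). The blocks of
    level k have length X_(k+2), and time is cut into epochs of length X_(k+1) = sqrt X_(k+2). The
    first access in an epoch to a block of level k other than block 0 cuts this block and its two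
    neighbours out of the trie and hangs them from the heap at depth O(2^k), where they remain until
    the end of the next epoch; there are at most 3 X_(k+1) of them per epoch, so the heap has room.

    If some access to j at time s has |i - j| < X_k and t - s < X_k, then the block of i at level k
    is hung, or has number at most 1, so i has depth O(2^k); and if there is no such access, then
    d(i) >= 2^k. With the least k for which there is one, this bounds the depth by O(d(i)).

    An access costs O(2^k) for every level k at which its block is new in the epoch. Call an access
    k-far if no earlier one is within X_k in space and in time. Going back from an access through
    near predecessors, one reaches within the epoch a k-far access, or one in the last X_k steps
    before the epoch; less than X_(k+2) has been travelled, so the block is one of at most three.
    Thus the new blocks of level k number at most three times the k-far accesses, plus 3 X_k per
    epoch. A k-far access has d >= 2^k, which pays 2^k for all such k together as the sum is
    geometric; the rest is O(2^k T / X_k), summing to O(T). Adding a leaf merges blocks as a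
    binary counter carries, an increment that carries up to height h costing O(h^2). *)

Set Implicit Arguments.
Unset Strict Implicit.
Unset Printing Implicit Defensive.

(** * A Hoare logic for straight-line expressions and loops *)

(** Cutting or hanging a block is followed by a walk to the root that repairs minimum pointers, so a
    block of level k has to be moved at depth O(2^k). What ensures this is nesting: the block of
    level k + 1 around a hung block is itself hung, or has number at most 1, so that the way up
    through the trie from a block of level k ends at height [2 * lev k]. To have this at every
    single move, an access empties expired lists from level 0 upwards, while the next level is still
    intact, and hangs its blocks downwards, when the next level is already in place.

    Expired blocks are not removed when their epoch ends, as no operation would pay for it, but at
    the next new access to their level; staying hung does no harm to the depth. Each removal is paid
    in advance, by a potential, when the block is hung.

    The addresses of blocks and of heap nodes come from a pairing function. So the zeroed memory
    already represents the infinite trie and heap with all links missing, and nothing is ever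
    allocated. *)

Inductive expr := Var of nat | Lit of nat | Bin of arith & expr & expr | Get of expr.

Definition env := nat -> nat.

Fixpoint eval (r : env) (w : nat -> nat) (e : expr) : nat :=
  match e with
  | Var x => r x
  | Lit c => c
  | Bin o a b => eval_arith o (eval r w a) (eval r w b)
  | Get a => w (eval r w a)
  end.

(* Registers from 60 on hold intermediate values of expressions; register 1 is never written and
   supplies the zero of [while_pos]. *)
Definition tmp := 60.

Fixpoint wf (e : expr) : bool :=
  match e with
  | Var x => x < tmp
  | Lit _ => true
  | Bin _ a b => wf a && wf b
  | Get a => wf a
  end.

Fixpoint safe (W : nat) (r : env) (w : nat -> nat) (e : expr) : Prop :=
  match e with
  | Var x => True
  | Lit c => c < W
  | Bin o a b => [/\ safe W r w a, safe W r w b & eval_arith o (eval r w a) (eval r w b) < W]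
  | Get a => safe W r w a
  end.

Definition loc (e : expr) (t : nat) : nat := if e is Var x then x else t.

(** A variable is read where it is, so nothing is computed for it; any other value ends up in [t].
    Registers below [t] are untouched, so operands of nested operations are kept as on a stack. *)
Fixpoint comp (e : expr) (t : nat) : cmd :=
  match e with
  | Var _ => Skip
  | Lit c => Do (Const t c)
  | Bin o a b => Seq (comp a t) (Seq (comp b t.+1) (Do (Arith o t (loc a t) (loc b t.+1))))
  | Get a => Seq (comp a t) (Do (ReadWord t (loc a t)))
  end.

Fixpoint ecost (e : expr) : nat :=
  match e with
  | Var _ | Lit _ => 1
  | Bin _ a b => ecost a + (ecost b + 1)
  | Get a => ecost a + 1
  end.

(** The machine has no register move: [y] is copied by adding a zero put into [tmp]. This is why
    [asafe] asks that a copied variable fit in a word. *)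
Definition assign (x : nat) (e : expr) : cmd :=
  match e with
  | Var y => Seq (Do (Const tmp 0)) (Do (Arith Plus x y tmp))
  | Lit c => Do (Const x c)
  | Bin o a b => Seq (comp a tmp) (Seq (comp b tmp.+1) (Do (Arith o x (loc a tmp) (loc b tmp.+1))))
  | Get a => Seq (comp a tmp) (Do (ReadWord x (loc a tmp)))
  end.

Definition acost (e : expr) : nat := if e is Var _ then 2 else ecost e.

Definition asafe (W : nat) (r : env) (w : nat -> nat) (e : expr) : Prop :=
  if e is Var y then r y < W else safe W r w e.

Definition store (a b : expr) : cmd :=
  Seq (comp a tmp) (Seq (comp b tmp.+1) (Do (WriteWord (loc a tmp) (loc b tmp.+1)))).
Definition copy_item (a b : expr) : cmd :=
  Seq (comp a tmp) (Seq (comp b tmp.+1) (Do (CopyItem (loc a tmp) (loc b tmp.+1)))).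
Definition if_test (T : nat -> nat -> test) (a b : expr) (c1 c2 : cmd) : cmd :=
  Seq (comp a tmp) (Seq (comp b tmp.+1) (If (T (loc a tmp) (loc b tmp.+1)) c1 c2)).
Definition if_eq := if_test TestEq.
Definition if_lt := if_test TestLt.
Definition if_le := if_test TestItemLe.

Definition vzero := 1.
(** Machine tests only read registers, so the condition is evaluated into [f] before the loop and
    again after each round. *)
Definition while_pos (f : nat) (e : expr) (c : cmd) : cmd :=
  Seq (assign f e) (While (TestLt vzero f) (Seq c (assign f e))).

Section Hoare.
Context {disp : Order.disp_t} {U : orderType disp}.
Implicit Types (s : state U) (m : memory U) (r : env).

(** [hwp] provides some execution; determinacy transfers its postcondition to the one recorded in a
    [history]. *)
Lemma exec_det W c s k s1 : exec W c s k s1 ->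
  forall k' s2, exec W c s k' s2 -> k' = k /\ s2 = s1.
Proof.
elim=> {c s k s1}.
- by move=> s k' s2 H; inversion H.
- by move=> i s s' E k' s2 H; inversion H as [|? ? ? E'| | | |]; move: E'; rewrite E => -[->].
- move=> c1 c2 s1 s2 s3 k1 k2 _ IH1 _ IH2 k' s' H.
  inversion H as [| |? ? ? ? ? ? ? X1 X2| | |]; subst.
  by case: (IH1 _ _ X1) => ? ?; subst; case: (IH2 _ _ X2) => -> ->.
- move=> b c1 c2 s s' v k E _ IH k' s2 H.
  inversion H as [| | |? ? ? ? ? ? ? E' X| |]; subst.
  by move: E' X; rewrite E => -[<-] /IH[-> ->].
- move=> b c s E k' s2 H.
  by inversion H as [| | | | |? ? ? ? ? ? ? E']; subst => //; rewrite E in E'.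
- move=> b c s1 s2 s3 k1 k2 E _ IH1 _ IH2 k' s' H.
  inversion H as [| | | |? ? ? E'|? ? ? ? ? ? ? E' X1 X2]; subst; first by rewrite E in E'.
  by case: (IH1 _ _ X1) => ? ?; subst; case: (IH2 _ _ X2) => -> ->.
Qed.

Definition agree s r m := (forall x, x < tmp -> reg s x = r x) /\ Defs.mem s = m.

(** Total correctness, with the number of steps as an argument of the postcondition. Registers from
    [tmp] on are left unconstrained. *)
Definition hwp W (c : cmd) (Q : nat -> env -> memory U -> Prop) r m :=
  forall s, agree s r m -> exists k s' r' m',
    [/\ exec W c s k s', agree s' r' m' & Q k r' m'].

Lemma hwp_conseq W c (Q Q' : nat -> env -> memory U -> Prop) r m :
  hwp W c Q' r m -> (forall k r' m', Q' k r' m' -> Q k r' m') -> hwp W c Q r m.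
Proof.
by move=> H HQ s /H[k [s' [r' [m' [? ? /HQ ?]]]]]; exists k, s', r', m'.
Qed.

Lemma hwp_seq W c1 c2 Q r m :
  hwp W c1 (fun k r' m' => hwp W c2 (fun k2 => Q (k + k2)) r' m') r m ->
  hwp W (Seq c1 c2) Q r m.
Proof.
move=> H s /H[k [s' [r' [m' [E1 A1 /(_ _ A1)]]]]].
move=> [k2 [s2 [r2 [m2 [E2 A2 HQ]]]]]; exists (k + k2), s2, r2, m2; split=> //.
exact: ExecSeq E1 E2.
Qed.

Lemma hwp_skip W Q r m : Q 1 r m -> hwp W Skip Q r m.
Proof. by move=> HQ s A; exists 1, s, r, m; split=> //; constructor. Qed.

Lemma comp_exec W e t s r m : tmp <= t -> wf e -> agree s r m ->
  safe W r (word m) e -> exists s',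
  [/\ exec W (comp e t) s (ecost e) s', agree s' r m,
      (forall x, x < t -> reg s' x = reg s x) &
      reg s' (loc e t) = eval r (word m) e].
Proof.
elim: e t s => [x|c|o a IHa b IHb|a IHa] t s tt /=.
- by move=> xt [A ?] _; exists s; split=> //; [constructor|exact: A].
- move=> _ [A Am] cW; exists (set_reg s t c); split.
  + by constructor; rewrite /= cW.
  + by split=> //= x xt; rewrite /upd ltn_eqF ?A //; apply: leq_trans xt tt.
  + by move=> x xt; rewrite /= /upd ltn_eqF.
  + by rewrite /= /upd eqxx.
- move=> /andP[wa wb] A [sa sb oW].
  have [s1 [E1 A1 F1 V1]] := IHa t s tt wa A sa.
  have [s2 [E2 A2 F2 V2]] := IHb t.+1 s1 (leqW tt) wb A1 sb.
  have la : reg s2 (loc a t) = eval r (word m) a.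
    rewrite F2 // /loc; case: a wa {IHa sa oW E1 V1} => //= x xt.
    exact: leq_trans xt (leqW tt).
  exists (set_reg s2 t (eval_arith o (eval r (word m) a) (eval r (word m) b))); split.
  + apply: ExecSeq E1 (ExecSeq E2 _); constructor.
    by rewrite /= la V2 oW.
  + case: A2 => A2 M2; split=> //= x xt; rewrite /upd ltn_eqF ?A2 //.
    exact: leq_trans xt tt.
  + by move=> x xt; rewrite /= /upd ltn_eqF // F2 ?F1 //; apply: leqW.
  + by rewrite /= /upd eqxx.
- move=> wa A sa; have [s1 [E1 A1 F1 V1]] := IHa t s tt wa A sa.
  exists (set_reg s1 t (word m (eval r (word m) a))); split.
  + by apply: ExecSeq E1 _; constructor; case: A1 => _ M; rewrite /= V1 M.
  + case: A1 => A2 M2; split=> //= x xt; rewrite /upd ltn_eqF ?A2 //.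
    exact: leq_trans xt tt.
  + by move=> x xt; rewrite /= /upd ltn_eqF // F1.
  + by rewrite /= /upd eqxx.
Qed.

Lemma agree_upd s r m x v : x < tmp -> agree s r m -> agree (set_reg s x v) (upd r x v) m.
Proof.
by move=> xt [A M]; split=> // y yt; rewrite /= /upd; case: eqP => // _; apply: A.
Qed.

Lemma comp2 W a b s r m : wf a && wf b -> agree s r m ->
  safe W r (word m) a -> safe W r (word m) b -> exists s' s'',
  [/\ exec W (comp a tmp) s (ecost a) s', exec W (comp b tmp.+1) s' (ecost b) s'',
     agree s'' r m, reg s'' (loc a tmp) = eval r (word m) a
   & reg s'' (loc b tmp.+1) = eval r (word m) b].
Proof.
move=> /andP[wa wb] A sa sb.
have [s1 [E1 A1 F1 V1]] := comp_exec (leqnn tmp) wa A sa.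
have [s2 [E2 A2 F2 V2]] := comp_exec (leqnSn tmp) wb A1 sb.
exists s1, s2; split=> //.
rewrite F2 // /loc; case: a wa {sa E1 V1} => //= x xt.
exact: leqW.
Qed.

Lemma hwp_assign W x e Q r m : wf e && (x < tmp) -> 0 < W -> asafe W r (word m) e ->
  Q (acost e) (upd r x (eval r (word m) e)) m -> hwp W (assign x e) Q r m.
Proof.
move=> /andP[we xt] W0 se HQ s A.
suff [s' E A'] : exists2 s', exec W (assign x e) s (acost e) s'
    & agree s' (upd r x (eval r (word m) e)) m by exists (acost e), s', (upd r x (eval r (word m) e)), m.
case: e we se {HQ} => [y|c|o a b|a] /= we se.
- exists (set_reg (set_reg s tmp 0) x (r y)); last first.
    apply: agree_upd => //; case: A => A M; split=> // z zt.
    by rewrite /= /upd ltn_eqF // A.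
  apply: (@ExecSeq _ _ W _ _ _ (set_reg s tmp 0) _ 1 1); constructor; rewrite /= ?W0 //.
  rewrite /upd eqxx (ltn_eqF we) addn0.
  by case: A => [/(_ _ we) -> _]; rewrite se.
- exists (set_reg s x c); last exact: agree_upd.
  by constructor; rewrite /= se.
- case: se => sa sb oW; have [s1 [s2 [E1 E2 A2 V1 V2]]] := comp2 we A sa sb.
  exists (set_reg s2 x (eval_arith o (eval r (word m) a) (eval r (word m) b))).
    by apply: ExecSeq E1 (ExecSeq E2 _); constructor; rewrite /= V1 V2 oW.
  exact: agree_upd.
- have [s1 [E1 A1 F1 V1]] := comp_exec (leqnn tmp) we A se.
  exists (set_reg s1 x (word m (eval r (word m) a))).
    by apply: ExecSeq E1 _; constructor; case: A1 => _ M; rewrite /= V1 M.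
  exact: agree_upd.
Qed.

Definition wr m a v := Memory (upd (word m) a v) (item m).

Lemma hwp_store W a b Q r m : wf a && wf b ->
  safe W r (word m) a -> safe W r (word m) b ->
  Q (ecost a + (ecost b + 1)) r (wr m (eval r (word m) a) (eval r (word m) b)) ->
  hwp W (store a b) Q r m.
Proof.
move=> wab sa sb HQ s A; have [s1 [s2 [E1 E2 [A2 M2] V1 V2]]] := comp2 wab A sa sb.
eexists; eexists; eexists; eexists; split; last exact: HQ.
  by apply: ExecSeq E1 (ExecSeq E2 _); apply: ExecDo.
by split=> //=; rewrite M2 V1 V2.
Qed.

Lemma hwp_copy W a b Q r m : wf a && wf b ->
  safe W r (word m) a -> safe W r (word m) b ->
  Q (ecost a + (ecost b + 1)) r
   (Memory (word m) (upd (item m) (eval r (word m) a) (item m (eval r (word m) b)))) ->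
  hwp W (copy_item a b) Q r m.
Proof.
move=> wab sa sb HQ s A; have [s1 [s2 [E1 E2 [A2 M2] V1 V2]]] := comp2 wab A sa sb.
eexists; eexists; eexists; eexists; split; last exact: HQ.
  by apply: ExecSeq E1 (ExecSeq E2 _); apply: ExecDo.
by split=> //=; rewrite M2 V1 V2.
Qed.

Lemma hwp_if W T (t : nat -> nat -> memory U -> option bool) v a b c1 c2 Q r m :
  (forall x y s, eval_test (T x y) s = t (reg s x) (reg s y) (Defs.mem s)) ->
  wf a && wf b -> safe W r (word m) a -> safe W r (word m) b ->
  t (eval r (word m) a) (eval r (word m) b) m = Some v ->
  hwp W (if v then c1 else c2) (fun k => Q (ecost a + (ecost b + k.+1))) r m ->
  hwp W (if_test T a b c1 c2) Q r m.
Proof.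
move=> HT wab sa sb E HQ s A; have [s1 [s2 [E1 E2 A2 V1 V2]]] := comp2 wab A sa sb.
have [k [s3 [r3 [m3 [E3 A3 Q3]]]]] := HQ _ A2.
exists (ecost a + (ecost b + k.+1)), s3, r3, m3; split=> //.
apply: ExecSeq E1 (ExecSeq E2 _); apply: (ExecIf (v := v)) => //.
by case: A2 => _ M2; rewrite HT V1 V2 M2.
Qed.

Lemma hwp_eq W a b c1 c2 Q r m :
  wf a && wf b -> safe W r (word m) a -> safe W r (word m) b ->
  hwp W (if eval r (word m) a == eval r (word m) b then c1 else c2)
     (fun k => Q (ecost a + (ecost b + k.+1))) r m ->
  hwp W (if_eq a b c1 c2) Q r m.
Proof. by move=> *; apply: (@hwp_if W _ (fun x y _ => Some (x == y))). Qed.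

Lemma hwp_lt W a b c1 c2 Q r m :
  wf a && wf b -> safe W r (word m) a -> safe W r (word m) b ->
  hwp W (if eval r (word m) a < eval r (word m) b then c1 else c2)
     (fun k => Q (ecost a + (ecost b + k.+1))) r m ->
  hwp W (if_lt a b c1 c2) Q r m.
Proof. by move=> *; apply: (@hwp_if W _ (fun x y _ => Some (x < y))). Qed.

Lemma hwp_le W u v a b c1 c2 Q r m :
  wf a && wf b -> safe W r (word m) a -> safe W r (word m) b ->
  item m (eval r (word m) a) = Some u -> item m (eval r (word m) b) = Some v ->
  hwp W (if (u <= v)%O then c1 else c2)
     (fun k => Q (ecost a + (ecost b + k.+1))) r m ->
  hwp W (if_le a b c1 c2) Q r m.
Proof.
move=> wab sa sb E1 E2 H.
by apply: (@hwp_if W TestItemLe (fun x y m => match item m x, item m y with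
  | Some u, Some v => Some (u <= v)%O | _, _ => None end)) H; rewrite ?E1 ?E2.
Qed.

(** One unfolding, with the remaining rounds again stated for [while_pos], so that a loop is treated
    by induction on its own specification. The proof inverts the execution of these rounds and moves
    its initial assignment to the end of the first round. *)
Lemma hwp_while W f e c Q r m : wf e && (vzero < f < tmp) -> 0 < W ->
  asafe W r (word m) e -> r vzero = 0 ->
  (if eval r (word m) e == 0 then Q (acost e + 1) (upd r f 0) m
   else hwp W c (fun k => hwp W (while_pos f e c) (fun k2 => Q (k + k2 + acost e + 1)))
         (upd r f (eval r (word m) e)) m) ->
  hwp W (while_pos f e c) Q r m.
Proof.
move=> /andP[we /andP[zf ft]] W0 se z0 H s A.
have ha : hwp W (assign f e) (fun k r' m' =>
    [/\ k = acost e, r' = upd r f (eval r (word m) e) & m' = m]) r m.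
  by apply: hwp_assign => //; rewrite ?we.
have [k1 [s1 [r1 [m1 [E1 A1 [? ? ?]]]]]] := ha _ A; subst.
have et : eval_test (TestLt vzero f) s1 = Some (eval r (word m) e != 0).
  case: A1 => A1 _ /=; rewrite (A1 f) // (A1 vzero) //.
  by rewrite /upd eqxx (ltn_eqF zf) z0 lt0n.
move: H et A1; case: eqP => [->|ne] H et A1.
  exists (acost e + 1), s1, (upd r f 0), m; split=> //.
  by apply: ExecSeq E1 _; apply: ExecWhileDone; rewrite et.
have [k2 [s2 [r2 [m2 [E2 A2 H2]]]]] := H _ A1.
have [k3 [s3 [r3 [m3 [E3 A3 Q3]]]]] := H2 _ A2.
exists (k2 + k3 + acost e + 1), s3, r3, m3; split=> //.
inversion E3 as [| |? ? ? ? ? k4 k5 X1 X2| | |]; subst.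
have -> : k2 + (k4 + k5) + acost e + 1 = acost e + (k2 + k4 + k5).+1 by lia.
by apply: ExecSeq E1 _; apply: ExecWhileStep et (ExecSeq E2 X1) X2.
Qed.

End Hoare.

(** * Forests with minimum pointers *)

Notation "c1 ;; c2" := (Seq c1 c2) (at level 60, right associativity).
Notation "e '+!' c" := (Bin Plus e (Lit c)) (at level 50, left associativity).
Notation "'fld' e c" := (Get (Bin Plus e (Lit c))) (at level 10, e at level 9, c at level 9).

Arguments upd {T} f a v b /.
Arguments assign : simpl never.
Arguments store : simpl never.
Arguments copy_item : simpl never.
Arguments if_test : simpl never.
Arguments if_eq : simpl never.
Arguments if_lt : simpl never.
Arguments if_le : simpl never.
Arguments while_pos : simpl never.

(** Registers 3 and 4 hold the children to be shown, 5 and 6 their minimum pointers, 7 the better of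
    these; the last assignment moves on to the parent. *)
Definition fix_body :=
  assign 3 (fld (Var 2) 4) ;; assign 4 (fld (Var 2) 5) ;;
  assign 5 (fld (Var 3) 2) ;; assign 6 (fld (Var 4) 2) ;;
  if_eq (Var 5) (Lit 0)
    (assign 3 (Lit 0) ;; assign 7 (Var 6) ;;
     if_eq (Var 6) (Lit 0) (assign 4 (Lit 0)) Skip)
    (assign 7 (Var 5) ;;
     if_eq (Var 6) (Lit 0) (assign 4 (Lit 0))
       (if_le (Var 5) (Var 6) Skip (assign 7 (Var 6)))) ;;
  store (Var 2) (Var 3) ;; store (Var 2 +! 1) (Var 4) ;;
  store (Var 2 +! 2) (Var 7) ;; assign 2 (fld (Var 2) 6).

Definition fixup := while_pos 8 (Var 2) fix_body.

Definition frame (xs : seq nat) (r r' : env) := forall x, x \notin xs -> r' x = r x.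

Ltac sd := rewrite /=; repeat split; rewrite /=; try exact: Logic.I; lia.
Ltac asg := apply: hwp_seq; apply: hwp_assign; [by []|lia|sd|rewrite /=].
Ltac sto := apply: hwp_seq; apply: hwp_store; [by []|sd|sd|rewrite /=].

Section Forest.
Context {disp : Order.disp_t} {U : orderType disp}.
Implicit Types (m : memory U) (r : env).

(* Besides the words prescribed by [tree_at], [min_ptr] and [leaf_index], the node at address [x]
   has its children in words 4 and 5, its parent in word 6 and, in word 9, the address of the word
   of the parent that points to it. Words 0 and 1 repeat the children with leaves below them. *)
Definition par m x := word m (x + 6).
Definition kid m x s := word m (x + 4 + s).
Definition mn m x := word m (x + 2).
Arguments par : simpl never.
Arguments kid : simpl never.
Arguments mn : simpl never.
Definition node x := (16 %| x) && (x != 0).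
(** The margin of 16 allows every field of the node at a stored address to be addressed without
    overflow. *)
Definition bounded W m := forall x, word m x + 16 <= W.

Definition pick_min m x y :=
  if x == 0 then y else if y == 0 then x
  else if item_le (item m x) (item m y) then x else y.

Definition recomp m p :=
  let x := mn m (kid m p 0) in let y := mn m (kid m p 1) in
  wr (wr (wr m p (if x == 0 then 0 else kid m p 0))
       (p + 1) (if y == 0 then 0 else kid m p 1)) (p + 2) (pick_min m x y).

Lemma fix_body_spec W r m : bounded W m -> 100 < W ->
  r 2 + 16 <= W ->
  (forall s, s < 2 -> mn m (kid m (r 2) s) != 0 -> item m (mn m (kid m (r 2) s)) <> None) ->
  hwp W fix_body (fun k r' m' => [/\ k <= 60, frame (iota 2 6) r r',
     r' 2 = par m (r 2) & m' = recomp m (r 2)]) r m.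
Proof.
move=> bm W100 bp it; rewrite /fix_body.
move: (it 0 isT) (it 1 isT); rewrite /recomp /pick_min /mn /kid !addn0 -addnA [4 + 1]/= => it0 it1.
have b0 := bm (r 2 + 4); have b1 := bm (r 2 + 5).
have b2 := bm (word m (r 2 + 4) + 2); have b3 := bm (word m (r 2 + 5) + 2).
asg; asg; asg; asg.
set L := word m (r 2 + 4) in it0 b0 b2 *; set R := word m (r 2 + 5) in it1 b1 b3 *.
set x := word m (L + 2) in it0 b2 *; set y := word m (R + 2) in it1 b3 *.
apply: hwp_seq.
have tail r1 : frame (iota 2 6) r r1 -> r1 2 = r 2 ->
    r1 3 = (if x == 0 then 0 else L) -> r1 4 = (if y == 0 then 0 else R) ->
    r1 7 = pick_min m x y -> hwp W (store (Var 2) (Var 3) ;; store (Var 2 +! 1) (Var 4) ;;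
      store (Var 2 +! 2) (Var 7) ;; assign 2 (fld (Var 2) 6))
      (fun k r' m' => [/\ k <= 20, frame (iota 2 6) r r',
        r' 2 = par m (r 2) &
        m' = wr (wr (wr m (r 2) (if x == 0 then 0 else L)) (r 2 + 1) (if y == 0 then 0 else R))
              (r 2 + 2) (pick_min m x y)]) r1 m.
  move=> fr e2 e3 e4 e7; have bb : r1 2 + 16 <= W by rewrite e2.
  sto; sto; sto; apply: hwp_assign; [by []|lia|sd|rewrite /=].
  split; [lia| | |].
  - by move=> z zn /=; case: eqP => [ez|_]; [move: zn; rewrite ez|exact: fr].
  - rewrite /= e2 /par; do 3 (case: eqP => [|_]; first lia); by [].
  - by rewrite /= e2 e3 e4 e7.
rewrite /pick_min in tail *.
apply: hwp_eq; [by []|sd|sd|rewrite /=].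
case: (x =P 0) => x0 in it0 tail *.
  asg; apply: hwp_seq; apply: hwp_assign => //; [lia|rewrite /=; lia|rewrite /=].
  apply: hwp_eq; [by []|sd|sd|rewrite /=].
  case: (y =P 0) => y0 in it1 tail *.
    apply: hwp_assign => //; [lia|sd|rewrite /=].
    apply: (hwp_conseq (tail _ _ _ _ _ _)) => //=; [move=> z zn /=|by move=> k1 r1 m1 [? ? -> ->]; split=> //; lia].
    by rewrite !ifN //; apply: contraNneq zn => ->.
  apply: hwp_skip.
  apply: (hwp_conseq (tail _ _ _ _ _ _)) => //=; [move=> z zn /=|by move=> k1 r1 m1 [? ? -> ->]; split=> //; lia].
  by rewrite !ifN //; apply: contraNneq zn => ->.
apply: hwp_seq; apply: hwp_assign => //; [lia|rewrite /=; lia|rewrite /=].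
apply: hwp_eq; [by []|sd|sd|rewrite /=].
case: (y =P 0) => y0 in it1 tail *.
  apply: hwp_assign => //; [lia|sd|rewrite /=].
  apply: (hwp_conseq (tail _ _ _ _ _ _)) => //=; [move=> z zn /=|by move=> k1 r1 m1 [? ? -> ->]; split=> //; lia].
  by rewrite !ifN //; apply: contraNneq zn => ->.
case ex: (item m x) (it0 isT) tail => [u|] // _.
case ey: (item m y) (it1 isT) => [v|] // _ tail.
apply: (hwp_le (u := u) (v := v)) => //=; rewrite /= in tail.
case: ifP tail => _ tail.
  apply: hwp_skip; apply: (hwp_conseq (tail _ _ _ _ _ _)) => //=; [move=> z zn /=|by move=> k1 r1 m1 [? ? -> ->]; split=> //; lia].
  by rewrite !ifN //; apply: contraNneq zn => ->.
apply: hwp_assign => //; [lia|rewrite /=; lia|rewrite /=].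
apply: (hwp_conseq (tail _ _ _ _ _ _)) => //=; [move=> z zn /=|by move=> k1 r1 m1 [? ? -> ->]; split=> //; lia].
by rewrite !ifN //; apply: contraNneq zn => ->.
Qed.

Definition under m x b := exists d, iter d (par m) b = x.

(** Parent pointers are iterated as a total function fixing 0, and [f_end] then excludes cycles.
    Word 9 allows a node to be cut off without searching for it among the children of its parent. *)
Record forest (Lv : nat -> Prop) m : Prop := Forest {
  f_par0 : par m 0 = 0;
  f_mn0 : mn m 0 = 0;
  f_alpar : forall x, node x -> 16 %| par m x;
  f_alkid : forall x s, node x -> s < 2 -> 16 %| kid m x s;
  f_end : forall x, node x -> exists d, iter d (par m) x = 0;
  f_up : forall x, node x -> par m x != 0 -> exists s,
    [/\ s < 2, kid m (par m x) s = x & word m (x + 9) = par m x + 4 + s];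
  f_dn : forall x s, node x -> s < 2 -> kid m x s != 0 ->
    par m (kid m x s) = x /\ word m (kid m x s + 9) = x + 4 + s;
  f_lv : forall x, Lv x -> [/\ node x, (forall s, s < 2 -> kid m x s = 0) & item m x <> None]
}.

Definition min_of (Lv : nat -> Prop) m x b :=
  [/\ Lv b, under m x b &
   forall b', Lv b' -> under m x b' -> item_le (item m b) (item m b')].

(** Words 0 and 1 are judged relative to the minimum pointers stored in the children, word 2 by the
    leaves below [x]. A change of the forest therefore spoils this only on one chain of
    ancestors. *)
Definition good (Lv : nat -> Prop) m x :=
  [/\ word m x = (if mn m (kid m x 0) == 0 then 0 else kid m x 0),
      word m (x + 1) = (if mn m (kid m x 1) == 0 then 0 else kid m x 1) &
      if mn m x == 0 then forall b, Lv b -> ~ under m x b else min_of Lv m x (mn m x)].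

Definition same_shape m m' :=
  (forall y, (y < 16) || (3 <= y %% 16) -> word m' y = word m y) /\ item m' = item m.

Lemma node_fld x p f g : 16 %| x -> 16 %| p -> f < 16 -> g < 16 ->
  (x + f == p + g) = (x == p) && (f == g).
Proof. by move=> ? ? ? ?; apply/eqP/andP => [|[/eqP -> /eqP ->//]]; lia. Qed.

Lemma recomp_word m p x f : node p -> 16 %| x -> f < 16 ->
  word (recomp m p) (x + f) =
  if x == p then
    if f == 0 then if mn m (kid m p 0) == 0 then 0 else kid m p 0
    else if f == 1 then if mn m (kid m p 1) == 0 then 0 else kid m p 1
    else if f == 2 then pick_min m (mn m (kid m p 0)) (mn m (kid m p 1))
    else word m (x + f)
  else word m (x + f).
Proof.
move=> /andP[p16 p0] x16 f16; rewrite /recomp /=.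
have -> : (x + f == p) = (x == p) && (f == 0) by rewrite -{1}(addn0 p) node_fld.
by rewrite !node_fld //; case: (x == p) => //; move: f16; case: f => [|[|[|f]]].
Qed.

Lemma recomp_shape m p : node p -> same_shape m (recomp m p).
Proof.
move=> np; split=> // y yc; rewrite (divn_eq y 16) recomp_word ?dvdn_mull ?ltn_mod //.
case: eqP => // e; case: (y %% 16) yc e (divn_eq y 16) => [|[|[|]]] //= yc e ey;
 by move: np; rewrite /node; lia.
Qed.

Lemma recomp_bounded W m p : 16 <= W -> bounded W m -> bounded W (recomp m p).
Proof.
move=> W16 bm x; rewrite /recomp /= /pick_min.
case: ifP => _; first by case: ifP => _; [exact: bm|case: ifP => _; [exact: bm|case: ifP => _; exact: bm]].
case: ifP => _; first by case: ifP => _; [rewrite add0n|exact: bm].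
by case: ifP => _ //; case: ifP => _; [rewrite add0n|exact: bm].
Qed.

Lemma shape_trans m m' m'' : same_shape m m' -> same_shape m' m'' -> same_shape m m''.
Proof. by move=> [h e] [h' e']; split=> [y yc|]; rewrite ?h' ?h // e' e. Qed.

Lemma shape_fld m m' x f : same_shape m m' -> 16 %| x -> 3 <= f < 16 ->
  word m' (x + f) = word m (x + f).
Proof. by move=> [h _] ? ?; apply: h; lia. Qed.

Lemma shape_par m m' x : same_shape m m' -> 16 %| x -> par m' x = par m x.
Proof. by move=> h ?; apply: shape_fld. Qed.

Lemma shape_kid m m' x s : same_shape m m' -> 16 %| x -> s < 2 -> kid m' x s = kid m x s.
Proof. by move=> h ? ?; rewrite /kid -!addnA; apply: shape_fld => //; lia. Qed.

Lemma iter_par_al Lv m x d : forest Lv m -> 16 %| x -> 16 %| iter d (par m) x.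
Proof.
move=> F x16; elim: d => //= d IH; have [->|n0] := eqVneq (iter d (par m) x) 0.
  by rewrite (f_par0 F).
by apply: (f_alpar F); rewrite /node IH.
Qed.

Lemma shape_iter Lv m m' x d : forest Lv m -> same_shape m m' -> 16 %| x ->
  iter d (par m') x = iter d (par m) x.
Proof.
move=> F h x16; elim: d => //= d ->; apply: shape_par => //; exact: (iter_par_al _ F).
Qed.

Lemma shape_under Lv m m' x b : forest Lv m -> same_shape m m' -> 16 %| b ->
  under m' x b <-> under m x b.
Proof.
by move=> F h b16; split=> -[d <-]; exists d; rewrite (shape_iter _ F h).
Qed.

Lemma shape_forest Lv m m' : forest Lv m -> same_shape m m' -> forest Lv m'.
Proof.
move=> F h; have [h1 h2] := h; constructor.
- by rewrite (shape_par h) // (f_par0 F).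
- by rewrite /mn h1 // [LHS](f_mn0 F).
- by move=> x nx; case/andP: (nx) => x16 _; rewrite (shape_par h) // (f_alpar F).
- by move=> x s nx s2; case/andP: (nx) => x16 _; rewrite (shape_kid h) // (f_alkid F).
- move=> x nx; case/andP: (nx) => x16 _; have [d hd] := f_end F nx; exists d.
  by rewrite (shape_iter _ F h).
- move=> x nx; case/andP: (nx) => x16 _; rewrite (shape_par h) // => p0.
  have [s [s2 ks w9]] := f_up F nx p0; exists s.
  by rewrite (shape_kid h) ?(f_alpar F) // (shape_fld h).
- move=> x s nx s2; case/andP: (nx) => x16 _; rewrite (shape_kid h) // => k0.
  have k16 := f_alkid F nx s2; have [e1 e2] := f_dn F nx s2 k0.
  by rewrite (shape_par h) // (shape_fld h).
- move=> x /(f_lv F)[nx k0 it]; split=> //; rewrite ?h2 //.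
  by move=> s s2; case/andP: (nx) => x16 _; rewrite (shape_kid h) // k0.
Qed.

Lemma iter_par0 Lv m d : forest Lv m -> iter d (par m) 0 = 0.
Proof. by move=> F; elim: d => //= d ->; apply: f_par0 F. Qed.

Lemma iter_par_ge Lv m x d e : forest Lv m -> iter d (par m) x = 0 -> d <= e ->
  iter e (par m) x = 0.
Proof. by move=> F h /subnK <-; rewrite iterD h (iter_par0 _ F). Qed.

(** A cycle returns to [x] after every multiple of its length, so the chain of [x] would never
    settle at 0. *)
Lemma no_cycle Lv m x d : forest Lv m -> node x -> iter d.+1 (par m) x = x -> False.
Proof.
move=> F nx h; have [e he] := f_end F nx.
have hk k : iter (k * d.+1) (par m) x = x.
  by elim: k => // k IH; rewrite mulSn iterD IH.
have := iter_par_ge F he (leq_pmulr e (ltn0Sn d)).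
by move/eqP; rewrite hk; case/andP: nx => _ /negbTE ->.
Qed.

Lemma under_refl m x : under m x x. Proof. by exists 0. Qed.
Lemma under_par m x b : under m x (par m b) -> under m x b.
Proof. by case=> d <-; exists d.+1; rewrite iterSr. Qed.
Lemma underE m x b : under m x b <-> x = b \/ under m x (par m b).
Proof.
split=> [[[|d] <-]|[->|]]; [by left|right; exists d; rewrite -iterSr //|exact: under_refl|exact: under_par].
Qed.

Lemma under_kid Lv m x b : forest Lv m -> node x -> node b ->
  under m x b <-> x = b \/ exists2 s, s < 2 & kid m x s != 0 /\ under m (kid m x s) b.
Proof.
move=> F nx nb; split=> [[[|d] e]|[->|[s s2 [k0 [d e]]]]].
- by left.
- right; set c := iter d (par m) b; have ec : par m c = x by rewrite -e.
  have c16 : 16 %| c by apply: (iter_par_al _ F); case/andP: nb.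
  have nc : node c.
    rewrite /node c16; apply/eqP => c0; move: ec; rewrite c0 (f_par0 F) => x0.
    by move: nx; rewrite -x0.
  have p0 : par m c != 0 by rewrite ec; case/andP: nx.
  have [s [s2 ks _]] := f_up F nc p0.
  exists s => //; rewrite -ec ks; split; [by case/andP: nc|by exists d].
- exact: under_refl.
- by exists d.+1; rewrite /= e; case: (f_dn F nx s2 k0).
Qed.

Lemma item_le_trans (x y z : option U) : item_le x y -> item_le y z -> item_le x z.
Proof. by case: x => [x|] //; case: y => [y|] //; case: z => [z|] //=; apply: Order.POrderTheory.le_trans. Qed.

Lemma item_le_total (x y : option U) : x <> None -> y <> None -> ~~ item_le x y -> item_le y x.
Proof.
by case: x => [x|] //; case: y => [y|] //= _ _; case: (Order.TotalTheory.leP x y) => // /Order.POrderTheory.ltW.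
Qed.

Lemma recomp_mn m p x : node p -> 16 %| x -> x != p -> mn (recomp m p) x = mn m x.
Proof. by move=> np x16 xp; rewrite /mn recomp_word // (negbTE xp). Qed.

Lemma kid_nself Lv m p s : forest Lv m -> node p -> s < 2 -> kid m p s != 0 ->
  ~ under m (kid m p s) p.
Proof.
move=> F np s2 k0 [d e]; have [e1 _] := f_dn F np s2 k0.
by apply: (no_cycle (d := d) F np); rewrite /= e.
Qed.

(** As [p] is not a leaf, each leaf below it is below one of its two children, whose minima are
    known. *)
Lemma recomp_good Lv m p : forest Lv m -> node p -> ~ Lv p ->
  (forall s, s < 2 -> kid m p s != 0 -> good Lv m (kid m p s)) ->
  good Lv (recomp m p) p.
Proof.
move=> F np nlp gk; have sh := recomp_shape m np.
have /andP[p16 p0] := np.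
have kE s : s < 2 -> kid (recomp m p) p s = kid m p s by exact: shape_kid.
have kp s : s < 2 -> kid m p s != p.
  move=> s2; apply/eqP => e; have k0 : kid m p s != 0 by rewrite e.
  by apply: (kid_nself F np s2 k0); rewrite e; apply: under_refl.
have mk s : s < 2 -> mn (recomp m p) (kid m p s) = mn m (kid m p s).
  by move=> s2; rewrite recomp_mn ?(f_alkid F) ?kp.
split.
- by rewrite kE // mk //; have := recomp_word m np p16 (isT : 0 < 16); rewrite addn0 eqxx.
- by rewrite kE // mk // recomp_word // eqxx.
have -> : mn (recomp m p) p = pick_min m (mn m (kid m p 0)) (mn m (kid m p 1)).
  by rewrite /mn recomp_word // eqxx.
have UE b : Lv b -> under (recomp m p) p b <->
    exists2 s, s < 2 & kid m p s != 0 /\ under m (kid m p s) b.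
  move=> Lb; have [nb _ _] := f_lv F Lb; have /andP[b16 _] := nb.
  rewrite (shape_under _ F sh b16) (under_kid F np nb).
  by split=> [[e|//]|]; [case: nlp; rewrite e|right].
have mz s : s < 2 -> mn m (kid m p s) = 0 -> forall b, Lv b ->
    kid m p s != 0 -> ~ under m (kid m p s) b.
  move=> s2 z b Lb k0; case: (gk s s2 k0) => _ _; rewrite z eqxx; exact.
have mnz s : s < 2 -> mn m (kid m p s) != 0 -> kid m p s != 0 /\ min_of Lv m (kid m p s) (mn m (kid m p s)).
  move=> s2 z; have k0 : kid m p s != 0.
    by apply: contraNneq z => ->; rewrite (f_mn0 F).
  by split=> //; case: (gk s s2 k0) => _ _; rewrite (negbTE z).
have itE : item (recomp m p) = item m by case: sh.
have fin s c : s < 2 -> mn m (kid m p s) = c -> c != 0 ->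
    (forall b s', s' < 2 -> kid m p s' != 0 -> Lv b -> under m (kid m p s') b ->
       item_le (item m c) (item m b)) ->
    min_of Lv (recomp m p) p c.
  move=> s2 ec c0 H; have := mnz s s2; rewrite ec => /(_ c0)[k0 [Lc Uc _]]; split=> //.
    by apply/(UE c Lc); exists s.
  by move=> b Lb /(UE b Lb)[s' s'2 [k'0 ub]]; rewrite itE; apply: H ub.
have two s' : s' < 2 -> s' = 0 \/ s' = 1 by lia.
rewrite /pick_min; case: (eqVneq (mn m (kid m p 0)) 0) => [z0|n0].
  case: (eqVneq (mn m (kid m p 1)) 0) => [z1|n1].
    move=> b Lb /(UE b Lb)[s' s'2 [k0 ub]].
    by case: (two _ s'2) => es; subst; [apply: (mz 0) ub|apply: (mz 1) ub].
  apply: (fin 1) => // b s' s'2 k0 Lb ub.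
  case: (two _ s'2) => es; subst; first by case: (mz 0 isT z0 b Lb k0 ub).
  by case: (mnz 1 isT n1) => _ [_ _]; apply.
case: (eqVneq (mn m (kid m p 1)) 0) => [z1|n1].
  rewrite /= (negbTE n0); apply: (fin 0) => // b s' s'2 k0 Lb ub.
  case: (two _ s'2) => es; subst; last by case: (mz 1 isT z1 b Lb k0 ub).
  by case: (mnz 0 isT n0) => _ [_ _]; apply.
have [k0 [L0 U0 M0]] := mnz 0 isT n0; have [k1 [L1 U1 M1]] := mnz 1 isT n1.
have [_ _ i0] := f_lv F L0; have [_ _ i1] := f_lv F L1.
rewrite /=; case: (boolP (item_le (item m (mn m (kid m p 0))) (item m (mn m (kid m p 1))))) => cmp.
  rewrite /= (negbTE n0); apply: (fin 0) => // b s' s'2 k' Lb ub.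
  case: (two _ s'2) => es; subst; first exact: M0.
  by apply: item_le_trans cmp _; apply: M1.
rewrite /= (negbTE n1); apply: (fin 1) => // b s' s'2 k' Lb ub.
case: (two _ s'2) => es; subst; last exact: M1.
by apply: item_le_trans (item_le_total i0 i1 cmp) _; apply: M0.
Qed.

Lemma good_shape_at Lv m m' x : forest Lv m -> same_shape m m' -> node x ->
  (forall f, f < 3 -> word m' (x + f) = word m (x + f)) ->
  (forall s, s < 2 -> mn m' (kid m x s) = mn m (kid m x s)) ->
  good Lv m x -> good Lv m' x.
Proof.
move=> F sh nx wf mk [g0 g1 g2]; have /andP[x16 _] := nx.
have e0 : kid m' x 0 = kid m x 0 by apply: shape_kid sh _ _.
have e1 : kid m' x 1 = kid m x 1 by apply: shape_kid sh _ _.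
have itE : item m' = item m by case: sh.
split.
- by rewrite e0 mk // -(addn0 x) wf // addn0.
- by rewrite e1 mk // wf.
rewrite /mn wf // -/(mn m x); move: g2; case: ifP => _.
  move=> H b Lb; have [/andP[b16 _] _ _] := f_lv F Lb.
  by rewrite (shape_under _ F sh b16); apply: H.
move=> [Lm Um H]; have [/andP[m16 _] _ _] := f_lv F Lm; split=> //.
  by rewrite (shape_under _ F sh m16).
move=> b Lb; have [/andP[b16 _] _ _] := f_lv F Lb.
by rewrite (shape_under _ F sh b16) itE; apply: H.
Qed.

(** Only nodes on the chain from [p] to the root may fail to be good, and each round takes [p] off
    this chain. The induction is on a bound [d] for its length, which also bounds the cost. *)
Lemma fixup_spec W Lv d r m p : forest Lv m -> bounded W m -> 100 < W -> r 1 = 0 ->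
  r 2 = p -> p + 16 <= W -> 16 %| p -> ~ Lv p -> iter d (par m) p = 0 ->
  (forall x, node x -> ~ under m x p -> good Lv m x) ->
  hwp W fixup (fun k r' m' => [/\ k <= 70 * d.+1, frame (iota 2 7) r r',
     same_shape m m', bounded W m' & forall x, node x -> good Lv m' x]) r m.
Proof.
elim: d r m p => [|d IH] r m p F bm W100 r1 r2 bp p16 nlp hd gd.
  have p0 : p = 0 by exact: hd.
  apply: hwp_while => //=; [lia|rewrite r2; lia|].
  rewrite r2 p0 /=; split=> //; [by move=> x xs /=; case: eqP xs => [->|]| ].
  by move=> x nx; apply: gd => //; rewrite p0 => -[e]; rewrite (iter_par0 _ F) => ex; rewrite -ex in nx.
have [p0|np] := eqVneq p 0.
  apply: hwp_conseq (IH r m p F bm W100 r1 r2 bp p16 nlp _ gd) _.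
    by rewrite p0 (iter_par0 _ F).
  by move=> k r' m' [? ? ? ? ?]; split=> //; lia.
have nodep : node p by rewrite /node p16.
have gk s : s < 2 -> kid m p s != 0 -> good Lv m (kid m p s).
  move=> s2 k0; apply: gd; first by rewrite /node (f_alkid F).
  exact: (kid_nself F).
apply: hwp_while => //=; [lia|rewrite r2; lia|].
rewrite r2 (negbTE np).
apply: hwp_conseq (fix_body_spec (W := W) (r := upd r 8 p) (m := m) _ _ _ _) _ => //=.
- by rewrite r2.
- rewrite r2 => s s2 n0.
  have k0 : kid m p s != 0 by apply: contraNneq n0 => ->; rewrite (f_mn0 F).
  case: (gk s s2 k0) => _ _; rewrite (negbTE n0) => -[Lx _ _].
  by case: (f_lv F Lx).
rewrite r2 => k1 ra _ [k1b fr ra2 ->].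
have sh := recomp_shape m nodep.
have parE : par m p = par (recomp m p) p by rewrite (shape_par sh).
  apply: hwp_conseq (IH ra (recomp m p) (par m p) _ _ _ _ ra2 _ _ _ _ _) _ => //.
  + exact: shape_forest sh.
  + by apply: recomp_bounded => //; lia.
  + by rewrite fr.
  + exact: bm.
  + exact: (f_alpar F).
  + move=> Lp; have [/andP[_ nz] kz _] := f_lv F Lp.
    by have [s [s2 ks _]] := f_up F nodep nz; move: np; rewrite -ks kz.
  + by rewrite (shape_iter _ F sh) ?(f_alpar F) // -iterSr.
  + move=> x nx; have [->|xp] := eqVneq x p; first by move=> _; apply: recomp_good.
    case/andP: (nx) => x16 _.
    rewrite (shape_under _ F sh) ?(f_alpar F) // => nu.
    apply: (good_shape_at F sh) => //.
    * by move=> f f3; rewrite recomp_word ?(negbTE xp) //; lia.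
    * move=> s' s'2; rewrite recomp_mn ?(f_alkid F) //; apply/eqP => e.
      have k0 : kid m x s' != 0 by rewrite e.
      by case: (f_dn F nx s'2 k0); rewrite e => ep _; apply: nu; rewrite ep; apply: under_refl.
    * by apply: gd => //; rewrite underE => -[/eqP|//]; rewrite (negbTE xp).
  move=> k r' m' [? fr' sh' ? ?]; split=> //; [lia| |exact: shape_trans sh sh'].
  move=> x xs; rewrite fr' // fr /=.
    by case: eqP xs => [->|].
  by move: xs; rewrite !inE; lia.
Qed.
End Forest.

Arguments par {disp U} m x : simpl never.
Arguments kid {disp U} m x s : simpl never.
Arguments mn {disp U} m x : simpl never.

(** * Cutting off a subtree and hanging it elsewhere *)

Definition detach :=
  assign 2 (fld (Var 9) 6) ;;
  if_eq (Var 2) (Lit 0) Skip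
    (store (fld (Var 9) 9) (Lit 0) ;; store (Var 9 +! 6) (Lit 0) ;; fixup).

Definition link_child :=
  store (Var 10) (Var 9) ;; store (Var 9 +! 6) (Var 2) ;; store (Var 9 +! 9) (Var 10).

Definition attach := link_child ;; fixup.

Arguments fixup : simpl never.
Arguments detach : simpl never.
Arguments attach : simpl never.
Arguments link_child : simpl never.

Section Relink.
Context {disp : Order.disp_t} {U : orderType disp}.
Implicit Types (m : memory U) (r : env).

(* Words of a node that restructuring the forest leaves alone. *)
Definition other_field f := [|| f == 3, f == 7, f == 8 | 10 <= f < 16].

Definition same_other m m' :=
  [/\ forall x f, 16 %| x -> other_field f -> word m' (x + f) = word m (x + f),
      forall y, y < 16 -> word m' y = word m y & item m' = item m].

Lemma shape_other m m' : same_shape m m' -> same_other m m'.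
Proof.
move=> sh; have [h e] := sh; split=> //.
- by move=> x f x16 of_; apply: shape_fld => //; move: of_; rewrite /other_field; lia.
- by move=> y y16; apply: h; rewrite y16.
Qed.

Lemma other_trans m m' m'' : same_other m m' -> same_other m' m'' -> same_other m m''.
Proof.
move=> [a b c] [a' b' c']; split=> [x f x16 h|y h|].
- by rewrite a' ?a.
- by rewrite b' ?b.
- by rewrite c' c.
Qed.

(** A chain that avoids [c] is unchanged. One that passes through [c] splits there: its lower part
    still leads to [c], its upper part starts at the old parent of [c]. *)
Lemma under_change Lv m m1 c x b : forest Lv m -> 16 %| b ->
  (forall y, 16 %| y -> y != c -> par m1 y = par m y) ->
  under m x b -> under m1 x b \/ (under m1 c b /\ under m x (par m c)).
Proof.
move=> F b16 H [d]; elim: d b b16 => [|d IH] b b16; first by move=> <-; left; exact: under_refl.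
rewrite iterSr; have [->|bc] := eqVneq b c.
  by move=> e; right; split; [exact: under_refl|exists d].
move=> /IH [|u|[u u']].
- by apply: (iter_par_al 1 F).
- by left; apply: under_par; rewrite H.
- by right; split=> //; apply: under_par; rewrite H.
Qed.

Lemma under0 Lv m x : forest Lv m -> under m x 0 -> x = 0.
Proof. by move=> F [d <-]; apply: iter_par0 F. Qed.

(** A child may be exchanged for another if both have a null minimum, because words 0 and 1 show
    neither of them. *)
Lemma good_change Lv m m' x :
  (forall f, f < 3 -> word m' (x + f) = word m (x + f)) ->
  (forall s, s < 2 -> mn m' (kid m' x s) = 0 /\ mn m (kid m x s) = 0 \/
     kid m' x s = kid m x s /\ mn m' (kid m' x s) = mn m (kid m x s)) ->
  item m' = item m ->
  (forall b, Lv b -> under m' x b <-> under m x b) ->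
  good Lv m x -> good Lv m' x.
Proof.
move=> wf hk it hu [g0 g1 g2]; split.
- rewrite -(addn0 x) wf // addn0 g0.
  by case: (hk 0 isT) => -[-> ->].
- rewrite wf // g1.
  by case: (hk 1 isT) => -[-> ->].
rewrite /mn wf // -/(mn m x); move: g2; case: ifP => _.
  by move=> H b Lb; rewrite hu //; apply: H.
move=> [Lm Um H]; split=> //; first by rewrite hu.
by move=> b Lb; rewrite hu // it; apply: H.
Qed.

Definition detach_mem m c := wr (wr m (word m (c + 9)) 0) (c + 6) 0.

Arguments detach_mem : simpl never.
Definition detached m m' c :=
  [/\ forall x, 16 %| x -> par m' x = if x == c then 0 else par m x,
      forall x s, node x -> s < 2 -> kid m' x s = if kid m x s == c then 0 else kid m x s
    & same_other m m'].

Lemma detach_mem_word Lv m c x f : forest Lv m -> node c -> par m c != 0 -> 16 %| x -> f < 16 ->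
  exists s, [/\ s < 2, kid m (par m c) s = c &
  word (detach_mem m c) (x + f) =
    if (x == c) && (f == 6) || (x == par m c) && (f == 4 + s) then 0 else word m (x + f)].
Proof.
move=> F nc p0 x16 f16; have [s [s2 ks w9]] := f_up F nc p0; exists s; split=> //.
have /andP[c16 _] := nc; have p16 := f_alpar F nc.
rewrite /detach_mem /= w9 -addnA !node_fld //; last by lia.
by do 2 case: (_ && _).
Qed.

Lemma detach_mem_detached Lv m c : forest Lv m -> node c -> par m c != 0 ->
  detached m (detach_mem m c) c.
Proof.
move=> F nc p0; have /andP[c16 c0] := nc; have p16 := f_alpar F nc.
split.
- move=> x x16; rewrite /par.
  have [s [s2 ks ->]] := detach_mem_word F nc p0 x16 (isT : 6 < 16).
  by rewrite andbT [6 == _]eqn_leq; case: (x == c) => //=; case: s s2 {ks} => [|[]] //; rewrite andbF.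
- move=> x s nx s2; have /andP[x16 x0] := nx.
  rewrite {1}/kid -addnA; have f16 : 4 + s < 16 by lia.
  have [s' [s'2 ks ->]] := detach_mem_word F nc p0 x16 f16.
  rewrite eqn_add2l (_ : (4 + s == 6) = false) ?andbF /=; last by lia.
  rewrite addnA -/(kid m x s); case: eqP => [->|xp] /=.
    have np : node (par m c) by rewrite /node p16.
    case: (eqVneq s s') => [->|ss]; first by rewrite ks eqxx.
    case: eqP => // e; have k0 : kid m (par m c) s != 0 by rewrite e.
    have [_] := f_dn F np s2 k0; rewrite e.
    have k0' : kid m (par m c) s' != 0 by rewrite ks.
    have [_] := f_dn F np s'2 k0'; rewrite ks => -> => /eqP; rewrite eqn_add2l eq_sym.
    by rewrite (negbTE ss).
  case: eqP => // e; have k0 : kid m x s != 0 by rewrite e.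
  by have [] := f_dn F nx s2 k0; rewrite e => e'; rewrite e' in xp.
split=> //.
- move=> x f x16 of_; have f16 : f < 16 by move: of_; rewrite /other_field; lia.
  have [s [s2 ks ->]] := detach_mem_word F nc p0 x16 f16.
  rewrite ifN // negb_or !negb_and; move: of_; rewrite /other_field; lia.
- move=> y y16; have [s [s2 ks]] := detach_mem_word F nc p0 (dvdn0 16) y16.
  rewrite add0n => ->; rewrite ifN // negb_or !negb_and.
  by rewrite ![0 == _]eq_sym c0 p0.
Qed.

Lemma detach_mem_low Lv m c x f : forest Lv m -> node c -> par m c != 0 -> 16 %| x -> f < 3 ->
  word (detach_mem m c) (x + f) = word m (x + f).
Proof.
move=> F nc p0 x16 f3; have f16 : f < 16 by lia.
have [s [s2 ks ->]] := detach_mem_word F nc p0 x16 f16.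
by rewrite ifN // negb_or !negb_and; lia.
Qed.

(** A new chain is an old one until it meets [c]; from there it follows the old chain of the new
    parent, which never comes back to [c]. *)
Lemma change_end Lv m m1 c : forest Lv m -> node c ->
  (forall y, 16 %| y -> y != c -> par m1 y = par m y) ->
  16 %| par m1 c -> (forall d, iter d (par m) (par m1 c) != c) ->
  forall x, 16 %| x -> exists d, iter d (par m1) x = 0.
Proof.
move=> F nc H p16 nch.
have al d y : 16 %| y -> 16 %| iter d (par m) y by exact: iter_par_al F.
have pc d : iter d (par m1) (par m1 c) = iter d (par m) (par m1 c).
  by elim: d => //= d ->; rewrite H // al.
have /andP[c16 c0] := nc.
have endp y : 16 %| y -> exists d, iter d (par m) y = 0.
  move=> y16; have [->|y0] := eqVneq y 0; first by exists 0.
  by apply: (f_end F); rewrite /node y16.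
have [dc hc] := endp _ p16.
move=> x x16; have [d] := endp _ x16; elim: d x x16 => [|d IH] x x16.
  by move=> x0; exists 0.
rewrite iterSr; have [->|xc] := eqVneq x c.
  by move=> _; exists dc.+1; rewrite iterSr pc.
have a1 : 16 %| par m1 x by rewrite H //; apply: (al 1).
by rewrite -H // => h; have [d' h'] := IH _ a1 h; exists d'.+1; rewrite iterSr.
Qed.

Lemma par_nself Lv m c d : forest Lv m -> node c -> iter d (par m) (par m c) != c.
Proof. by move=> F nc; apply/eqP => e; apply: (no_cycle (d := d) F nc); rewrite iterSr. Qed.

Lemma detach_forest Lv m c : forest Lv m -> node c -> par m c != 0 -> forest Lv (detach_mem m c).
Proof.
move=> F nc p0; have [hp hk [ho hg hi]] := detach_mem_detached F nc p0.
have /andP[c16 c0] := nc.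
have w9 x : 16 %| x -> word (detach_mem m c) (x + 9) = word m (x + 9).
  move=> x16; have [s [s2 ks ->]] := detach_mem_word F nc p0 x16 (isT : 9 < 16).
  by rewrite ifN // negb_or !negb_and; lia.
constructor.
- by rewrite hp // eq_sym (negbTE c0) (f_par0 F).
- by rewrite /mn hg // [LHS](f_mn0 F).
- move=> x nx; have /andP[x16 _] := nx; rewrite hp //; case: eqP => // _; exact: f_alpar F _ nx.
- by move=> x s nx s2; rewrite hk //; case: eqP => // _; apply: f_alkid F _ _ nx s2.
- move=> x /andP[x16 _]; apply: (change_end F nc) => //.
  + by move=> y y16 yc; rewrite hp // (negbTE yc).
  + by rewrite hp // eqxx.
  + by move=> d; rewrite hp // eqxx (iter_par0 _ F) eq_sym.
- move=> x nx; have /andP[x16 _] := nx; rewrite hp //; case: (eqVneq x c) => // xc px.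
  have [s [s2 ks e9]] := f_up F nx px; exists s; rewrite w9 //; split=> //.
  by rewrite hk // ?ks ?(negbTE xc) // /node px (f_alpar F).
- move=> x s nx s2; rewrite hk //; case: (eqVneq (kid m x s) c) => // kc k0.
  have [e1 e2] := f_dn F nx s2 k0; have k16 := f_alkid F nx s2.
  by rewrite hp // (negbTE kc) w9.
- move=> x /(f_lv F)[nx k0 it]; split=> //.
  by move=> s s2; rewrite hk // k0 //; case: eqP.
Qed.

Lemma detach_spec W Lv d r m c : forest Lv m -> bounded W m -> 100 < W -> r 1 = 0 ->
  r 9 = c -> c + 16 <= W -> node c -> iter d (par m) c = 0 ->
  (forall x, node x -> good Lv m x) ->
  hwp W detach (fun k r' m' => [/\ k <= 70 * d.+1 + 20, frame (iota 2 7) r r',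
     detached m m' c, forest Lv m' & bounded W m' /\ forall x, node x -> good Lv m' x]) r m.
Proof.
move=> F bm W100 r1 r9 bc nc hd gd; have /andP[c16 c0] := nc.
have b9 := bm (c + 9); have b6 := bm (c + 6).
rewrite /detach; asg; rewrite r9.
apply: hwp_eq => //=; first lia.
case: eqP => [p0|/eqP p0].
  apply: hwp_skip; split=> //; first lia.
  - move=> x; rewrite !inE negb_or => /andP[/negbTE h _].
    by rewrite /= h.
  - split=> //.
      by move=> x x16; case: eqP => // ->.
    move=> x s nx s2; case: eqP => // e.
    have k0 : kid m x s != 0 by rewrite e.
    by have [e' _] := f_dn F nx s2 k0; move: nx; rewrite -e' e [par m c]p0.
sto; sto; rewrite r9 -/(detach_mem m c).
have DF := detach_forest F nc p0; have DD := detach_mem_detached F nc p0.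
have [hp hk ho] := DD; have [_ _ hi] := ho.
have np : node (par m c) by rewrite /node p0 (f_alpar F).
have itp e : iter e (par (detach_mem m c)) (par m c) = iter e (par m) (par m c).
  elim: e => // e; rewrite !iterS => ->; rewrite hp; last by apply: (iter_par_al _ F); case/andP: np.
  by rewrite (negbTE (par_nself _ F nc)).
apply: hwp_conseq (fixup_spec (W := W) (d := d) (p := par m c) DF _ _ _ _ _ _ _ _ _) _ => //.
- move=> x; rewrite /detach_mem /=; have := bm x; case: ifP => _; [lia|case: ifP => _; lia].
- by case/andP: np.
- have [s [s2 ks _]] := f_up F nc p0.
  by move=> /(f_lv F)[_ /(_ s s2)]; rewrite ks => /eqP; rewrite (negbTE c0).
- rewrite itp; apply: (iter_par_ge F (d := d.-1)); last by lia.
  by case: d hd => [/eqP|d]; [rewrite /= (negbTE c0)|rewrite iterSr].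
- move=> x nx nu; have /andP[x16 _] := nx; apply: good_change (gd x nx) => //.
  + by move=> f f3; apply: detach_mem_low F nc p0 x16 f3.
  + move=> s s2; right; rewrite hk //; case: eqP => e.
      have k0 : kid m x s != 0 by rewrite e.
      by have [e' _] := f_dn F nx s2 k0; case: nu; rewrite -e' e; apply: under_refl.
    split=> //; rewrite /mn; apply: (detach_mem_low F nc p0) => //; exact: f_alkid F _ _ nx s2.
  + move=> b Lb; have [nb _ _] := f_lv F Lb; have /andP[b16 _] := nb; split=> ub.
      have H y : 16 %| y -> y != c -> par m y = par (detach_mem m c) y.
        by move=> y16 yc; rewrite hp // (negbTE yc).
      have [//|[_]] := under_change DF b16 H ub.
      rewrite hp // eqxx => /(under0 DF) x0; by rewrite x0 in nx.
    have H y : 16 %| y -> y != c -> par (detach_mem m c) y = par m y.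
      by move=> y16 yc; rewrite hp // (negbTE yc).
    have [//|[_ [e he]]] := under_change F b16 H ub.
    by case: nu; exists e; rewrite itp.
move=> k r' m' [kb fr sh bm' gm']; split=> //; first lia.
- move=> x xs; rewrite fr //=; case: eqP => // e; by rewrite e in xs.
- have [ap ak ao] := DD; split.
  + by move=> x x16; rewrite (shape_par sh) // ap.
  + by move=> x s nx s2; rewrite (shape_kid sh) ?ak //; case/andP: nx.
  + exact: other_trans ao (shape_other sh).
- exact: shape_forest sh.
Qed.

Definition attach_mem m c p s := wr (wr (wr m (p + 4 + s) c) (c + 6) p) (c + 9) (p + 4 + s).
Arguments attach_mem : simpl never.

Definition attached m m' c p t :=
  [/\ forall x, 16 %| x -> par m' x = if x == c then p else par m x,
      forall x s, node x -> s < 2 -> kid m' x s = if (x == p) && (s == t) then c else kid m x s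
    & same_other m m'].

Record attachable (Lv : nat -> Prop) m c p t := Attachable {
  at_c : node c;
  at_p : node p;
  at_t : t < 2;
  at_par : par m c = 0;
  at_kid : kid m p t = 0;
  at_lv : ~ Lv p;
  at_chain : forall d, iter d (par m) p != c
}.

Lemma attach_mem_word m c p t x f : node c -> node p -> t < 2 -> 16 %| x -> f < 16 ->
  word (attach_mem m c p t) (x + f) =
    if (x == c) && (f == 9) then p + 4 + t else if (x == c) && (f == 6) then p else
    if (x == p) && (f == 4 + t) then c else word m (x + f).
Proof.
move=> /andP[c16 _] /andP[p16 _] t2 x16 f16.
by rewrite /attach_mem /= -addnA !node_fld //; lia.
Qed.

Lemma attach_mem_low m c p t x f : node c -> node p -> t < 2 -> 16 %| x -> f < 3 ->
  word (attach_mem m c p t) (x + f) = word m (x + f).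
Proof.
move=> nc np t2 x16 f3; rewrite attach_mem_word //; last by lia.
by rewrite !ifN // negb_and; lia.
Qed.

Lemma attach_mem_attached m c p t : node c -> node p -> t < 2 ->
  attached m (attach_mem m c p t) c p t.
Proof.
move=> nc np t2; have /andP[c16 c0] := nc; have /andP[p16 p0] := np; split.
- move=> x x16; rewrite /par attach_mem_word //= andbF andbT.
  by rewrite [6 == _]eqn_leq (_ : (6 <= 4 + t <= 6) = false) ?andbF //; lia.
- move=> x s /andP[x16 _] s2; rewrite /kid -!addnA attach_mem_word //; last by lia.
  have -> : (4 + s == 9) = false by lia.
  have -> : (4 + s == 6) = false by lia.
  by rewrite !andbF eqn_add2l.
split=> //.
- move=> x f x16 of_; have f16 : f < 16 by move: of_; rewrite /other_field; lia.
  rewrite attach_mem_word // !ifN // negb_and; move: of_; rewrite /other_field; lia.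
- move=> y y16; have := @attach_mem_word m c p t 0 y nc np t2 (dvdn0 16) y16.
  by rewrite add0n ![0 == _]eq_sym (negbTE c0) (negbTE p0).
Qed.

Lemma attach_forest Lv m c p t : forest Lv m -> attachable Lv m c p t ->
  forest Lv (attach_mem m c p t).
Proof.
move=> F [nc np t2 pc0 kp0 nlp ch].
have [hp hk [ho hg hi]] := attach_mem_attached m nc np t2.
have /andP[c16 c0] := nc; have /andP[p16 p0] := np.
have w9 x : 16 %| x -> word (attach_mem m c p t) (x + 9) = if x == c then p + 4 + t else word m (x + 9).
  move=> x16; rewrite attach_mem_word // andbT andbF; case: eqP => // _.
  by rewrite ifN // negb_and; lia.
constructor.
- by rewrite hp // eq_sym (negbTE c0) (f_par0 F).
- by rewrite /mn hg // [LHS](f_mn0 F).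
- move=> x nx; have /andP[x16 _] := nx; rewrite hp //; case: eqP => // _; exact: f_alpar F _ nx.
- by move=> x s nx s2; rewrite hk //; case: ifP => // _; apply: f_alkid F _ _ nx s2.
- move=> x /andP[x16 _]; apply: (change_end F nc) => //.
  + by move=> y y16 yc; rewrite hp // (negbTE yc).
  + by rewrite hp // eqxx.
  + by move=> d; rewrite hp // eqxx.
- move=> x nx; have /andP[x16 _] := nx; rewrite hp //; case: (eqVneq x c) => [-> _|xc px].
    by exists t; rewrite hk // !eqxx w9 // eqxx.
  have [s [s2 ks e9]] := f_up F nx px; exists s; rewrite w9 // (negbTE xc); split=> //.
  rewrite hk //; last by rewrite /node px (f_alpar F).
  case: andP => // -[/eqP e1 /eqP e2]; move: ks; rewrite e1 e2 kp0 => x0.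
  by move: nx; rewrite -x0.
- move=> x s nx s2; rewrite hk //; case: andP => [[/eqP -> /eqP ->] _|xs k0].
    by rewrite hp // eqxx w9 // eqxx.
  have [e1 e2] := f_dn F nx s2 k0; have k16 := f_alkid F nx s2.
  have kc : kid m x s != c.
    by apply/eqP => e; move: nx; rewrite -e1 e pc0.
  by rewrite hp // (negbTE kc) w9 // (negbTE kc).
- move=> x Lx; have [nx k0 it] := f_lv F Lx; split=> //.
  move=> s s2; rewrite hk // k0 //; case: andP => // -[/eqP e _].
  by case: nlp; rewrite -e.
Qed.

Lemma attach_iter Lv m c p t e : forest Lv m -> attachable Lv m c p t ->
  iter e (par (attach_mem m c p t)) p = iter e (par m) p.
Proof.
move=> F [nc np t2 pc0 kp0 nlp ch]; have [hp _ _] := attach_mem_attached m nc np t2.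
have /andP[p16 _] := np.
elim: e => // e; rewrite !iterS => ->; rewrite hp; last exact: (iter_par_al _ F).
by rewrite (negbTE (ch _)).
Qed.

Lemma attach_under Lv m c p t x b : forest Lv m -> attachable Lv m c p t -> node x -> 16 %| b ->
  (under m x b -> under (attach_mem m c p t) x b) /\
  (under (attach_mem m c p t) x b -> under m x b \/ under m c b /\ under m x p).
Proof.
move=> F A nx b16; have F' := attach_forest F A.
case: (A) => [nc np t2 pc0 kp0 nlp ch]; have [hp _ _] := attach_mem_attached m nc np t2.
have /andP[c16 c0] := nc.
have H y : 16 %| y -> y != c -> par (attach_mem m c p t) y = par m y.
  by move=> y16 yc; rewrite hp // (negbTE yc).
split=> ub.
  have [//|[_]] := under_change F b16 H ub.
  rewrite pc0 => /(under0 F) x0; by rewrite x0 in nx.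
have H' y : 16 %| y -> y != c -> par m y = par (attach_mem m c p t) y.
  by move=> y16 yc; rewrite H.
have [|[u [e he]]] := under_change F' b16 H' ub; [by left|right; split=> //].
by exists e; rewrite -(attach_iter e F A) -he hp // eqxx.
Qed.

Lemma attach_good Lv m c p t x : forest Lv m -> attachable Lv m c p t -> node x ->
  ~ under m x p -> good Lv m x -> good Lv (attach_mem m c p t) x.
Proof.
move=> F A nx nu gx; have /andP[x16 x0] := nx.
case: (A) => [nc np t2 pc0 kp0 nlp ch]; have [_ hk [_ _ hi]] := attach_mem_attached m nc np t2.
apply: good_change gx => //.
- by move=> f f3; apply: attach_mem_low.
- move=> s s2; right; rewrite hk //; case: andP => [[/eqP e _]|_].
    by case: nu; rewrite e; apply: under_refl.
  by split=> //; rewrite /mn attach_mem_low // (f_alkid F).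
- move=> b Lb; have [/andP[b16 _] _ _] := f_lv F Lb.
  have [a1 a2] := attach_under F A nx b16; split=> // /a2[//|[_ u]]; by case: nu.
Qed.

(** A subtree without leaves changes no minimum, so no node is spoiled and no [fixup] has to follow.
    This is what makes building a path of the heap cheap. *)
Lemma link_good Lv m c p t x : forest Lv m -> attachable Lv m c p t -> node x ->
  good Lv m c -> mn m c = 0 -> good Lv m x -> good Lv (attach_mem m c p t) x.
Proof.
move=> F A nx gc mc gx; have /andP[x16 x0] := nx.
case: (A) => [nc np t2 pc0 kp0 nlp ch]; have [_ hk [_ _ hi]] := attach_mem_attached m nc np t2.
apply: good_change gx => //.
- by move=> f f3; apply: attach_mem_low.
- move=> s s2; rewrite hk //; case: andP => [[/eqP e /eqP es]|_].
    left; rewrite e es kp0 (f_mn0 F); split=> //.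
    by rewrite /mn attach_mem_low //; case/andP: nc.
  by right; split=> //; rewrite /mn attach_mem_low // (f_alkid F).
- move=> b Lb; have [/andP[b16 _] _ _] := f_lv F Lb.
  have [a1 a2] := attach_under F A nx b16; split=> // /a2[//|[u _]].
  by case: gc => _ _; rewrite mc eqxx => /(_ b Lb).
Qed.

Lemma attach_bounded W m c p t : bounded W m -> c + 16 <= W -> p + 22 <= W -> t < 2 ->
  bounded W (attach_mem m c p t).
Proof.
move=> bm bc bp t2 x; rewrite /attach_mem /=.
by do 3 (case: ifP => _; [lia|]).
Qed.

Lemma link_child_run W r m c p t : 100 < W -> r 9 = c -> r 2 = p -> r 10 = p + 4 + t ->
  c + 16 <= W ->
  hwp W link_child (fun k r' m' => [/\ k <= 20, r' = r & m' = attach_mem m c p t]) r m.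
Proof.
move=> W100 r9 r2 r10 bc; rewrite /link_child.
by sto; sto; apply: hwp_store; [by []|sd|sd|rewrite /= r9 r2 r10; split; [lia| |]].
Qed.

Lemma attach_spec W Lv d r m c p t : forest Lv m -> bounded W m -> 100 < W -> r 1 = 0 ->
  r 9 = c -> r 2 = p -> r 10 = p + 4 + t -> c + 16 <= W -> p + 22 <= W ->
  attachable Lv m c p t -> iter d (par m) p = 0 ->
  (forall x, node x -> good Lv m x) ->
  hwp W attach (fun k r' m' => [/\ k <= 70 * d.+1 + 20, frame (iota 2 7) r r',
     attached m m' c p t, forest Lv m' & bounded W m' /\ forall x, node x -> good Lv m' x]) r m.
Proof.
move=> F bm W100 r1 r9 r2 r10 bc bp A hd gd; rewrite /attach.
case: (A) => [nc np t2 pc0 kp0 nlp ch].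
have DF := attach_forest F A; have AM := attach_mem_attached m nc np t2.
have LR := link_child_run (m := m) W100 r9 r2 r10 bc.
apply: hwp_seq; apply: (hwp_conseq LR).
move=> k1 _ _ [k1b -> ->].
apply: hwp_conseq (fixup_spec (W := W) (d := d) (p := p) DF _ _ _ _ _ _ _ _ _) _ => //.
- exact: attach_bounded.
- lia.
- by case/andP: np.
- by rewrite (attach_iter _ F A).
- move=> x nx nu; apply: attach_good => //; last exact: gd.
  by move=> -[e he]; apply: nu; exists e; rewrite (attach_iter _ F A).
move=> k r' m' [kb fr sh bm' gm']; split=> //; first lia.
- have [ap ak ao] := AM; split.
  + by move=> x x16; rewrite (shape_par sh) // ap.
  + by move=> x s nx s2; rewrite (shape_kid sh) ?ak //; case/andP: nx.
  + exact: other_trans ao (shape_other sh).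
- exact: shape_forest sh.
Qed.

End Relink.
Arguments attach_mem : simpl never.
Arguments detach_mem : simpl never.

(** * The trie and the heap *)

(* Injective, and quadratically bounded in [a] and [b]. Below, [trie h q] is the block
   [q 2^h, (q+1) 2^h) and [hp y] a node of the heap. The node [hp (2 * v)] has the content of slot [v]
   as its first child; the second, [hp (2 * v + 1)], has the slots [2 * v] and [2 * v + 1] below it. *)
Definition nd a b := 16 * ((a + b) * (a + b) + b).
Definition hp y := nd 0 y.
Definition trie h q := nd (h + 2) q.

Definition nd_expr a b := Bin Times (Lit 16) (Bin Plus (Bin Times (Bin Plus a b) (Bin Plus a b)) b).
Definition hp_expr y := nd_expr (Lit 0) y.
Definition trie_expr h q := nd_expr (h +! 2) q.

Lemma nd_inj a b a' b' : nd a b = nd a' b' -> a = a' /\ b = b'.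
Proof.
rewrite /nd => e; have {}e : (a + b) * (a + b) + b = (a' + b') * (a' + b') + b' by lia.
have : a + b = a' + b'.
  have : ~ (a + b < a' + b') by nia.
  have : ~ (a' + b' < a + b) by nia.
  lia.
by move=> h; rewrite h in e; lia.
Qed.

Lemma node_nd a b : 0 < a + b -> node (nd a b).
Proof. rewrite /node /nd => ?; rewrite dvdn_mulr //=; nia. Qed.

Lemma node_trie h q : node (trie h q). Proof. by apply: node_nd; lia. Qed.
Lemma node_hp y : 0 < y -> node (hp y). Proof. by move=> ?; apply: node_nd; lia. Qed.
Lemma al_trie h q : 16 %| trie h q. Proof. by case/andP: (node_trie h q). Qed.
Lemma al_hp y : 16 %| hp y. Proof. by rewrite /hp /nd dvdn_mulr. Qed.
Lemma trie_neq0 h q : trie h q != 0. Proof. by case/andP: (node_trie h q). Qed.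
Lemma hp_neq0 y : 0 < y -> hp y != 0. Proof. by case/node_hp/andP. Qed.

Lemma trie_inj h q h' q' : trie h q = trie h' q' -> h = h' /\ q = q'.
Proof. by move/nd_inj => [e ->]; split=> //; lia. Qed.
Lemma hp_inj y y' : hp y = hp y' -> y = y'. Proof. by case/nd_inj. Qed.
Lemma trie_hp h q y : trie h q = hp y -> False. Proof. by case/nd_inj; lia. Qed.
Lemma trie_eqE h q h' q' : (trie h q == trie h' q') = (h == h') && (q == q').
Proof. by apply/eqP/andP => [/trie_inj[-> ->]|[/eqP -> /eqP ->]]. Qed.
Lemma hp_eqE y y' : (hp y == hp y') = (y == y').
Proof. by apply/eqP/eqP => [/hp_inj|->]. Qed.

(** The links that may ever occur. A heap node has one possible parent, so its link is either made
    or missing; a block may hang from its trie parent or from any slot. *)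
Inductive edge : nat -> nat -> nat -> Prop :=
  | EdgeTrie h q s : s < 2 -> 0 < q -> edge (trie h.+1 q) s (trie h (2 * q + s))
  | EdgeSlot v h q : 0 < v -> edge (hp (2 * v)) 0 (trie h q)
  | EdgeAux v : 0 < v -> edge (hp (2 * v)) 1 (hp (2 * v + 1))
  | EdgeMain v s : s < 2 -> 0 < v -> edge (hp (2 * v + 1)) s (hp (2 * (2 * v + s))).

(** The inverse of [EdgeAux] and [EdgeMain]. It is meaningful from 3 on, [hp 2] being the root. *)
Definition pr y := if odd y then y.-1 else 2 * (y %/ 4) + 1.
Definition pr_side y := if odd y then 1 else (y %/ 2) %% 2.

Lemma pr_lt y : 2 < y -> 1 < pr y < y.
Proof. by rewrite /pr => ?; case: ifP; lia. Qed.

Lemma edge_pr y : 2 < y -> edge (hp (pr y)) (pr_side y) (hp y).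
Proof.
rewrite /pr /pr_side => y2; case: ifP => o.
  have -> : y.-1 = 2 * (y %/ 2) by lia.
  rewrite [X in edge _ _ (hp X)](_ : y = 2 * (y %/ 2) + 1); last by lia.
  by apply: EdgeAux; lia.
rewrite [X in edge _ _ (hp X)](_ : y = 2 * (2 * (y %/ 4) + (y %/ 2) %% 2)); last by lia.
by apply: EdgeMain; lia.
Qed.

Lemma edge_to_hp p s y : edge p s (hp y) -> [/\ 2 < y, p = hp (pr y) & s = pr_side y].
Proof.
have [x ex] : exists x, x = hp y by exists (hp y).
rewrite -ex => e; case: e ex => [h q t t2 q0|v h q v0|v v0|v t t2 v0] ex.
- by case: (trie_hp ex).
- by case: (trie_hp ex).
- by rewrite -(hp_inj ex) /pr /pr_side ifT ?ifT; try lia; split; [lia|congr hp; lia|].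
- rewrite -(hp_inj ex) /pr /pr_side ifF ?ifF; try lia.
  by split; [lia|congr hp; lia|lia].
Qed.

Lemma edge_to_trie p s h q : edge p s (trie h q) ->
  (exists2 v, 0 < v & p = hp (2 * v) /\ s = 0) \/
  [/\ 1 < q, p = trie h.+1 (q %/ 2) & s = q %% 2].
Proof.
have [x ex] : exists x, x = trie h q by exists (trie h q).
rewrite -ex => e; case: e ex => [h' q' t t2 q0|v h' q' v0|v v0|v t t2 v0] ex.
- by case/trie_inj: ex => <- <-; right; split; [lia|congr trie; lia|lia].
- by left; exists v.
- by case: (trie_hp (esym ex)).
- by case: (trie_hp (esym ex)).
Qed.

Lemma edge_of_trie h q s x : edge (trie h q) s x ->
  exists h', [/\ h = h'.+1, s < 2, 0 < q & x = trie h' (2 * q + s)].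
Proof.
have [p ep] : exists p, p = trie h q by exists (trie h q).
rewrite -ep => e; case: e ep => [h' q' t t2 q0|v h' q' v0|v v0|v t t2 v0] ep.
- by case/trie_inj: ep => <- <-; exists h'.
- by case: (trie_hp (esym ep)).
- by case: (trie_hp (esym ep)).
- by case: (trie_hp (esym ep)).
Qed.

Lemma edge_of_hp y s x : edge (hp y) s x ->
  ((exists h q, x = trie h q) /\ s = 0 /\ ~~ odd y) \/
  exists y', [/\ 2 < y', y = pr y', s = pr_side y' & x = hp y'].
Proof.
have [p ep] : exists p, p = hp y by exists (hp y).
rewrite -ep => e; case: (e) ep => [h' q' t t2 q0|v h' q' v0|v v0|v t t2 v0] ep.
- by case: (trie_hp ep).
- by left; split; [exists h', q'|split=> //; move/hp_inj: ep => <-; lia].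
- right; exists (2 * v + 1); have [? ep' <-] := edge_to_hp (EdgeAux v0); split=> //.
  by apply: hp_inj; rewrite -ep' ep.
- right; exists (2 * (2 * v + t)); have [? ep' <-] := edge_to_hp (EdgeMain t2 v0); split=> //.
  by apply: hp_inj; rewrite -ep' ep.
Qed.

Definition prn y := if y <= 2 then 0 else pr y.

(** Two steps, through the auxiliary node, lead from slot [v] to slot [v %/ 2]; one more step leaves
    the heap at slot 1. *)
Lemma prn_bound e v : 0 < v < 2 ^ e.+1 -> iter (2 * e + 1) prn (2 * v) = 0.
Proof.
elim: e v => [|e IH] v hv; first by have -> : v = 1 by move: hv; rewrite expn1; lia.
have [v1|v1] := leqP v 1; first have -> : v = 1 by lia.
  by rewrite addn1 muln1; elim: (2 * e.+1) => // k IHk; rewrite iterS IHk.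
have -> : 2 * e.+1 + 1 = (2 * e + 1).+2 by lia.
rewrite !iterSr -[RHS](IH (v %/ 2)); last by move: hv; rewrite expnS; lia.
congr iter; rewrite /prn /pr; do ?(case: ifP; try lia).
Qed.

Definition heap_test :=
  if_eq (Var 11) (Lit 2) (assign 14 (Lit 0))
    (if_eq (fld (Var 9) 6) (Lit 0) (assign 14 (Lit 1)) (assign 14 (Lit 0))).

Definition link_body :=
  if_eq (Bin Minus (Var 11) (Bin Times (Lit 2) (Bin Defs.Quotient (Var 11) (Lit 2)))) (Lit 1)
    (assign 12 (Bin Minus (Var 11) (Lit 1)) ;; assign 13 (Lit 1))
    (assign 12 (Bin Times (Lit 2) (Bin Defs.Quotient (Var 11) (Lit 4)) +! 1) ;;
     assign 13 (Bin Minus (Bin Defs.Quotient (Var 11) (Lit 2))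
                 (Bin Times (Lit 2) (Bin Defs.Quotient (Var 11) (Lit 4))))) ;;
  assign 2 (hp_expr (Var 12)) ;; assign 10 (Bin Plus (Var 2 +! 4) (Var 13)) ;;
  link_child ;; assign 11 (Var 12) ;; assign 9 (Var 2) ;; heap_test.

(** The path from a heap node to the root is linked on first use. The walk may stop at the first
    node that has a parent, since by [closed_at] the rest of the path is then present. *)
Definition link_heap :=
  assign 9 (hp_expr (Var 11)) ;; heap_test ;; while_pos 15 (Var 14) link_body.

Arguments heap_test : simpl never.
Arguments link_body : simpl never.
Arguments link_heap : simpl never.
Arguments nd : simpl never.
Arguments hp : simpl never.
Arguments trie : simpl never.
Arguments pr : simpl never.
Arguments pr_side : simpl never.
Arguments nd_expr : simpl never.
Arguments hp_expr : simpl never.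
Arguments trie_expr : simpl never.

(** All addresses [nd a b] with [a <= V + 2] and [b <= V] fit in a word, with a margin for the
    fields. *)
Definition room W V := 16 * ((V + V + 2) * (V + V + 2) + V) + 200 <= W.

Lemma nd_bound W V a b : room W V -> a <= V + 2 -> b <= V -> nd a b + 200 <= W.
Proof. rewrite /room /nd => ? ? ?; nia. Qed.
Lemma hp_bound W V y : room W V -> y <= V -> hp y + 200 <= W.
Proof. by move=> h ?; apply: (nd_bound h); lia. Qed.
Lemma trie_bound W V h q : room W V -> h <= V -> q <= V -> trie h q + 200 <= W.
Proof. by move=> h' ? ?; apply: (nd_bound h'); lia. Qed.
Lemma room_W W V : room W V -> V + 200 < W.
Proof. rewrite /room; nia. Qed.

Lemma eval_hp r w a : eval r w (hp_expr a) = hp (eval r w a).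
Proof. by []. Qed.
Lemma eval_trie r w a b : eval r w (trie_expr a b) = trie (eval r w a) (eval r w b).
Proof. by []. Qed.

Lemma safe_nd W r w a b : safe W r w a -> safe W r w b ->
  nd (eval r w a) (eval r w b) + 200 <= W -> safe W r w (nd_expr a b).
Proof. by rewrite /nd => /= ? ? ?; do ![split] => //; nia. Qed.
Lemma safe_hp W r w a : safe W r w a ->
  hp (eval r w a) + 200 <= W -> safe W r w (hp_expr a).
Proof. by move=> ? ?; apply: safe_nd => //=; lia. Qed.
Lemma safe_trie W r w a b : safe W r w a -> safe W r w b ->
  trie (eval r w a) (eval r w b) + 200 <= W -> safe W r w (trie_expr a b).
Proof.
by move=> ? ? h; apply: safe_nd => //=; split=> //; [lia|move: h; rewrite /trie /nd; nia].
Qed.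

Lemma frame_upd xs r x v : x \in xs -> frame xs r (upd r x v).
Proof. by move=> xx y yx /=; case: eqP => // e; rewrite e xx in yx. Qed.
Lemma frame_sub xs ys r r' : frame xs r r' -> all [in ys] xs -> frame ys r r'.
Proof. by move=> h /allP s x xy; apply: h; apply: contraNN xy => /s. Qed.
Lemma frame_updl xs r r' x v : x \in xs -> frame xs (upd r x v) r' -> frame xs r r'.
Proof.
by move=> xx h y yx; rewrite h //=; case: eqP => // e; rewrite e xx in yx.
Qed.
Lemma frame_comp xs r r' r'' : frame xs r r' -> frame xs r' r'' -> frame xs r r''.
Proof. by move=> a b x xx; rewrite b // a. Qed.

Section Heap.
Context {disp : Order.disp_t} {U : orderType disp}.
Implicit Types (m : memory U) (r : env).

Definition leaf n x := exists2 i, 0 < i <= n & x = trie 0 i.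

Definition legal m := forall x s, node x -> s < 2 -> kid m x s != 0 -> edge x s (kid m x s).

(** A heap node without a parent has nothing below it. So it can be linked without touching any
    minimum, and a heap node with a child is connected to the root. *)
Definition closed_at m y := 2 < y -> par m (hp y) = 0 -> forall s, s < 2 -> kid m (hp y) s = 0.

Record wfm W n m : Prop := Wfm {
  w_forest : forest (leaf n) m;
  w_bounded : bounded W m;
  w_good : forall x, node x -> good (leaf n) m x;
  w_legal : legal m;
  w_closed : forall y, closed_at m y
}.

Lemma leaf_hp n y : ~ leaf n (hp y).
Proof. by case=> i _ e; case: (trie_hp (esym e)). Qed.

Lemma leaf_trie n h q : leaf n (trie h.+1 q) -> False.
Proof. by case=> i _ /trie_inj[]. Qed.

Lemma par_edge n m x : forest (leaf n) m -> legal m -> node x -> par m x != 0 ->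
  exists2 s, edge (par m x) s x & s < 2 /\ kid m (par m x) s = x.
Proof.
move=> F L nx px; have [s [s2 ks _]] := f_up F nx px; exists s => //.
rewrite -{2}ks; apply: L => //; first by rewrite /node px (f_alpar F).
by rewrite ks; case/andP: nx.
Qed.

Lemma par_hp n m y : forest (leaf n) m -> legal m -> 0 < y -> par m (hp y) != 0 ->
  2 < y /\ par m (hp y) = hp (pr y).
Proof.
move=> F L y0 py; have [s e _] := par_edge F L (node_hp y0) py.
by have [] := edge_to_hp e.
Qed.

Lemma par_trie n m h q : forest (leaf n) m -> legal m -> par m (trie h q) != 0 ->
  (exists2 v, 0 < v & par m (trie h q) = hp (2 * v)) \/
  1 < q /\ par m (trie h q) = trie h.+1 (q %/ 2).
Proof.
move=> F L py; have [s e _] := par_edge F L (node_trie h q) py.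
have [[v v0 [-> _]]|[q1 -> _]] := edge_to_trie e; by [left; exists v|right].
Qed.

Lemma iter_hp n m y d : forest (leaf n) m -> legal m -> 0 < y -> iter d prn y = 0 ->
  iter d (par m) (hp y) = 0.
Proof.
move=> F L; elim: d y => [|d IH] y y0; first by move=> /= e; rewrite e in y0.
rewrite !iterSr; have [->|py] := eqVneq (par m (hp y)) 0; first by rewrite (iter_par0 _ F).
have [y2 ->] := par_hp F L y0 py; rewrite /prn leqNgt y2 /=; apply: IH.
by have := pr_lt y2; lia.
Qed.

Lemma iter_hp_slot n m v e : forest (leaf n) m -> legal m -> 0 < v < 2 ^ e.+1 ->
  iter (2 * e + 1) (par m) (hp (2 * v)) = 0.
Proof.
move=> F L h; apply: (iter_hp F L _ (prn_bound h)).
by rewrite muln_gt0; case/andP: h.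
Qed.

Lemma heap_chain n m y d : forest (leaf n) m -> legal m -> 0 < y ->
  iter d (par m) (hp y) = 0 \/ exists y', 0 < y' <= y /\ iter d (par m) (hp y) = hp y'.
Proof.
move=> F L; elim: d y => [|d IH] y y0; first by right; exists y; rewrite y0 leqnn.
rewrite iterSr; have [->|py] := eqVneq (par m (hp y)) 0; first by left; rewrite (iter_par0 _ F).
have [y2 ->] := par_hp F L y0 py; have yl := pr_lt y2.
have [|->|[y' [y'l ->]]] := IH (pr y); [lia|by left|right; exists y'; split=> //; lia].
Qed.

Lemma mn_nokid n m x : forest (leaf n) m -> node x -> good (leaf n) m x -> ~ leaf n x ->
  (forall s, s < 2 -> kid m x s = 0) -> mn m x = 0.
Proof.
move=> F nx [_ _ g] nl k0; move: g; case: eqP => // _ [Lb ub _].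
have [nb _ _] := f_lv F Lb.
have [e|[s s2 [ks _]]] := (under_kid F nx nb).1 ub.
  by case: nl; rewrite e.
by move: ks; rewrite k0.
Qed.

Definition heap_same m m' :=
  [/\ forall h q, par m' (trie h q) = par m (trie h q),
      forall h q s, s < 2 -> kid m' (trie h q) s = kid m (trie h q) s,
      forall v, 0 < v -> kid m' (hp (2 * v)) 0 = kid m (hp (2 * v)) 0
    & same_other m m'].

Lemma heap_same_trans m m' m'' : heap_same m m' -> heap_same m' m'' -> heap_same m m''.
Proof.
move=> [a b c d] [a' b' c' d']; split=> [h q|h q s s2|v v0|].
- by rewrite a' a. - by rewrite b' ?b. - by rewrite c' ?c. - exact: other_trans d d'.
Qed.

(** The invariant of the linking loop: [closed_at] may fail only at the top [y] of the path built so
    far, which has no leaf below it as long as it has no parent. *)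
Definition linkable n m y := [/\ forest (leaf n) m, legal m,
  (forall x, node x -> good (leaf n) m x), (forall y', y' != y -> closed_at m y') &
  2 < y -> par m (hp y) = 0 -> mn m (hp y) = 0].

(** By [legal] the side of the parent meant for [hp y] can be occupied by nothing else, and the
    chain above the parent visits only heap nodes of smaller number. *)
Lemma link_attachable n m y : linkable n m y -> 2 < y -> par m (hp y) = 0 ->
  attachable (leaf n) m (hp y) (hp (pr y)) (pr_side y).
Proof.
move=> [F L G C M] y2 py0; have yl := pr_lt y2.
constructor; try by [].
- by apply: node_hp; lia.
- by apply: node_hp; lia.
- by rewrite /pr_side; case: ifP => //; lia.
- apply/eqP/negPn/negP => k0.
  have s2 : pr_side y < 2 by rewrite /pr_side; case: ifP => //; lia.
  have np : node (hp (pr y)) by apply: node_hp; lia.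
  have [pk _] := f_dn F np s2 k0; have e := L _ _ np s2 k0.
  have [[[h [q ex]] [s0 od]]|[y' [y'2 ey es ex]]] := edge_of_hp e.
    move: s0 od; rewrite /pr_side /pr; case: ifP; first by [].
    by move=> _ _ /negP; lia.
  have ey' : y' = y by move: ey es; rewrite /pr /pr_side; do 2 case: ifP; lia.
  by move: pk; rewrite ex ey' py0 => h; have := hp_neq0 (y := pr y); rewrite -h; lia.
- exact: leaf_hp.
- move=> d; have y0 : 0 < pr y by lia.
  case: (heap_chain d F L y0) => [->|[y' [yl' ->]]].
    by rewrite eq_sym hp_neq0 //; lia.
  by rewrite hp_eqE; lia.
Qed.

Lemma linkable_step n m y : linkable n m y -> 2 < y -> par m (hp y) = 0 ->
  let m' := attach_mem m (hp y) (hp (pr y)) (pr_side y) in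
  linkable n m' (pr y) /\ heap_same m m' /\ par m' (hp y) != 0.
Proof.
move=> LK y2 py0 m'; have A := link_attachable LK y2 py0.
case: (LK) => [F L G C M]; have yl := pr_lt y2; case: (A) => nc np t2 _ kp0 _ _.
have [hp_ hk ho] := attach_mem_attached m nc np t2; rewrite -/m' in hp_ hk ho *.
have F' : forest (leaf n) m' by apply: attach_forest.
have kE x s : node x -> s < 2 -> x != hp (pr y) -> kid m' x s = kid m x s.
  by move=> nx s2 /negbTE xp; rewrite hk // xp.
split; [split=> //|split; [split=> //|]].
- move=> x s nx s2; rewrite hk //; case: andP => [[/eqP -> /eqP ->] _|_ k0].
    exact: edge_pr.
  exact: L.
- by move=> x nx; apply: link_good => //; [apply: G|apply: M|apply: G].
- move=> y' yy y'2 py' s s2; have ny' : node (hp y') by apply: node_hp; lia.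
  rewrite kE ?hp_eqE //; case: (eqVneq y' y) => [e|ny].
    by move: py'; rewrite e hp_ ?al_hp // eqxx => /eqP; rewrite (negbTE (hp_neq0 _)) //; lia.
  by move: py'; rewrite hp_ ?al_hp // hp_eqE (negbTE ny) => /C; apply.
- move=> p2; rewrite hp_ ?al_hp // hp_eqE ifN; last by lia.
  move=> pp0; have e : mn m' (hp (pr y)) = mn m (hp (pr y)).
    by rewrite /mn; apply: attach_mem_low => //; apply: al_hp.
  rewrite e; apply: mn_nokid F np (G _ np) (@leaf_hp _ _) _ => s s2.
  by apply: C => //; lia.
- by move=> h q; rewrite hp_ ?al_trie // ifN //; apply/eqP => /trie_hp.
- by move=> h q s s2; rewrite kE //; [apply: node_trie|apply/eqP => /trie_hp].
- move=> v v0; have nv : node (hp (2 * v)) by apply: node_hp; lia.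
  rewrite hk //; case: andP => // -[/eqP/hp_inj ev /eqP].
  by move: ev; rewrite /pr_side /pr; case: ifP => // o; lia.
- by rewrite hp_ ?al_hp // eqxx hp_neq0 //; lia.
Qed.
End Heap.

Definition attach_slot :=
  assign 11 (Bin Times (Lit 2) (Var 16)) ;; link_heap ;; assign 9 (Var 21) ;;
  assign 2 (hp_expr (Bin Times (Lit 2) (Var 16))) ;; assign 10 (Var 2 +! 4) ;; attach.
Arguments attach_slot : simpl never.

Section Slot.
Context {disp : Order.disp_t} {U : orderType disp}.
Implicit Types (m : memory U) (r : env).

Lemma heap_test_spec W r m y : bounded W m -> 100 < W -> r 9 = hp y -> hp y + 200 <= W ->
  r 11 = y -> 1 < y ->
  hwp W heap_test (fun k r' m' => [/\ k <= 20, m' = m &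
    r' = upd r 14 ((2 < y) && (par m (hp y) == 0) : nat)]) r m.
Proof.
move=> bm W100 r9 hb r11 y1; rewrite /heap_test.
apply: hwp_eq; [by []|sd|sd|rewrite /= r11].
case: (eqVneq y 2) => [->|y2].
  by apply: hwp_assign; [by []|lia|sd|].
have -> : 2 < y by lia.
apply: hwp_eq; [by []|sd|sd|rewrite /= r9 -/(par m (hp y))].
by case: eqP => _; apply: hwp_assign; [by []|lia|sd| |by []|lia|sd|].
Qed.

Lemma link_body_spec W V r m y : bounded W m -> room W V -> r 9 = hp y ->
  r 11 = y -> 2 < y <= V ->
  let m' := attach_mem m (hp y) (hp (pr y)) (pr_side y) in bounded W m' ->
  hwp W link_body (fun k r' m2 => [/\ k <= 120, m2 = m', frame (iota 2 14) r r' &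
    [/\ r' 9 = hp (pr y), r' 11 = pr y & r' 14 = ((2 < pr y) && (par m' (hp (pr y)) == 0) : nat)]]) r m.
Proof.
move=> bm rm r9 r11 /andP[y2 yV] m' bm'; have W100 := room_W rm.
have yl := pr_lt y2.
have hpb : hp (pr y) + 200 <= W by apply: (hp_bound rm); lia.
have hyb : hp y + 200 <= W by apply: (hp_bound rm); lia.
have s2 : pr_side y < 2 by rewrite /pr_side; case: ifP => //; lia.
rewrite /link_body; apply: hwp_seq.
have tail r1 : frame [:: 12; 13] r r1 -> r1 12 = pr y -> r1 13 = pr_side y ->
  hwp W (assign 2 (hp_expr (Var 12)) ;; assign 10 (Bin Plus (Var 2 +! 4) (Var 13)) ;;
    link_child ;; assign 11 (Var 12) ;; assign 9 (Var 2) ;; heap_test)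
  (fun k r' m2 => [/\ k <= 80, m2 = m', frame (iota 2 14) r r' &
    [/\ r' 9 = hp (pr y), r' 11 = pr y & r' 14 = ((2 < pr y) && (par m' (hp (pr y)) == 0) : nat)]]) r1 m.
  move=> fr e12 e13.
  apply: hwp_seq; apply: hwp_assign; [by []|lia| |].
    by apply: safe_hp => //=; rewrite e12.
  rewrite eval_hp /= e12; asg; rewrite e13.
  apply: hwp_seq; apply: hwp_conseq (@link_child_run _ _ W _ m (hp y) (hp (pr y)) (pr_side y) _ _ _ _ _) _ => //=.
  - lia.
  - by rewrite fr.
  - lia.
  move=> k1 _ _ [k1b -> ->].
  apply: hwp_seq; apply: hwp_assign; [by []|lia|rewrite /= e12; lia|rewrite /= e12].
  apply: hwp_seq; apply: hwp_assign; [by []|lia|rewrite /=; lia|rewrite /=].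
  apply: hwp_conseq (@heap_test_spec W _ _ (pr y) bm' _ _ hpb _ _) _ => //; [lia|lia|].
  move=> k2 _ _ [k2b -> ->]; split; [lia|by []| |by []].
  move=> x xs /=; move: (xs); rewrite !inE => xs'.
  by rewrite !ifN; try lia; apply: fr; rewrite !inE; lia.
apply: hwp_eq; [by []|rewrite /= r11; repeat split; lia|sd|rewrite /= r11].
rewrite (_ : (y - 2 * (y %/ 2) == 1) = odd y); last by lia.
case: ifP => o.
  apply: hwp_seq; apply: hwp_assign; [by []|lia|rewrite /= r11; repeat split; lia|rewrite /= r11].
  apply: hwp_assign; [by []|lia|sd|rewrite /=].
  apply: hwp_conseq (tail _ _ _ _) _.
  - by move=> x; rewrite !inE => xs /=; rewrite !ifN; lia.
  - by rewrite /= /pr o; lia.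
  - by rewrite /= /pr_side o.
  by move=> k r' m2 [? ? ? ?]; split=> //; lia.
apply: hwp_seq; apply: hwp_assign; [by []|lia|rewrite /= r11; repeat split; lia|rewrite /= r11].
apply: hwp_assign; [by []|lia|rewrite /= r11; repeat split; lia|rewrite /= r11].
apply: hwp_conseq (tail _ _ _ _) _.
- by move=> x; rewrite !inE => xs /=; rewrite !ifN; lia.
- by rewrite /= /pr o; lia.
- by rewrite /= /pr_side o; lia.
by move=> k r' m2 [? ? ? ?]; split=> //; lia.
Qed.

Lemma link_loop_spec W V n d r m y : linkable n m y -> bounded W m -> room W V ->
  r 1 = 0 -> r 9 = hp y -> r 11 = y -> 1 < y <= V -> iter d prn y = 0 ->
  r 14 = ((2 < y) && (par m (hp y) == 0) : nat) ->
  hwp W (while_pos 15 (Var 14) link_body) (fun k r' m' =>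
    [/\ k <= 130 * d.+1, frame (iota 2 14) r r', wfm W n m', heap_same m m' &
       (2 < y -> par m' (hp y) != 0) /\
       forall y', par m (hp y') != 0 -> par m' (hp y') != 0]) r m.
Proof.
elim: d r m y => [|d IH] r m y LK bm rm r1 r9 r11 yb hd r14.
  by move: hd yb => /= ->.
have W100 := room_W rm; case: (LK) => [F L G C M].
apply: hwp_while => //; [lia|rewrite /= r14; case: (_ && _); lia|].
rewrite /= r14; case: (boolP (2 < y)) r14 => y2 /=; case: (eqVneq (par m (hp y)) 0) => py r14 /=;
  last first.
1,2: split=> //; [lia|by move=> x xs /=; case: eqP xs => [->|]|].
1,2: by split=> // y'; case: (eqVneq y' y) => [-> //|/C]; move=> ? // ?; lia.
  split=> //; [lia|by move=> x xs /=; case: eqP xs => [->|]|].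
  by split=> // y'; case: (eqVneq y' y) => [-> _ e|/C //]; rewrite e in py.
have [LK' [HS pn]] := linkable_step LK y2 py; have yl := pr_lt y2.
set m' := attach_mem _ _ _ _ in LK' HS pn.
have s2 : pr_side y < 2 by rewrite /pr_side; case: ifP => //; lia.
have bm' : bounded W m'.
  apply: attach_bounded => //; first by have := hp_bound rm (y := y); lia.
  by have := hp_bound rm (y := pr y); lia.
apply: hwp_conseq (@link_body_spec W V (upd r 15 1) m y bm rm _ _ _ bm') _ => //; first by lia.
move=> k1 r2 m2 [k1b -> fr [e9 e11 e14]].
apply: hwp_conseq (IH r2 m' (pr y) LK' bm' rm _ e9 e11 _ _ e14) _.
- by rewrite fr.
- lia.
- by move: hd; rewrite iterSr /prn leqNgt y2.
have [h _ _] := attach_mem_attached m (node_hp (ltnW (ltnW y2))) (node_hp (ltnW (proj1 (andP yl)))) s2.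
have mono y' : par m (hp y') != 0 -> par m' (hp y') != 0.
  by rewrite h ?al_hp //; case: (eqVneq (hp y') (hp y)) => // _ _; apply: hp_neq0; lia.
move=> k2 r3 m3 [k2b fr2 wf3 hs3 [_ pp]]; split=> //.
- rewrite /acost; lia.
- exact: frame_comp (frame_updl _ fr) fr2.
- exact: heap_same_trans HS hs3.
split=> [_|y' /mono]; last exact: pp.
by apply: pp; rewrite h ?al_hp // eqxx hp_neq0 //; lia.
Qed.

Lemma wfm_linkable W n m y : wfm W n m -> 0 < y -> linkable n m y.
Proof.
move=> [F B G L C] y0; split=> // y2 py.
apply: mn_nokid F (node_hp y0) (G _ (node_hp y0)) (@leaf_hp _ _) _.
exact: C.
Qed.

Lemma link_heap_spec W V n d r m y : wfm W n m -> room W V ->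
  r 1 = 0 -> r 11 = y -> 1 < y <= V -> iter d prn y = 0 ->
  hwp W link_heap (fun k r' m' =>
    [/\ k <= 130 * d.+1 + 50, frame (iota 2 14) r r', wfm W n m', heap_same m m' &
       2 < y -> par m' (hp y) != 0]) r m.
Proof.
move=> wm rm r1 r11 yb hd; have W100 := room_W rm.
have hb : hp y + 200 <= W by apply: (hp_bound rm); lia.
rewrite /link_heap; apply: hwp_seq; apply: hwp_assign; [by []|lia| |].
  by apply: safe_hp => //=; rewrite r11.
rewrite eval_hp /= r11.
apply: hwp_seq; apply: hwp_conseq (@heap_test_spec W _ _ y (w_bounded wm) _ _ hb _ _) _ => //; try lia.
move=> k1 _ _ [k1b -> ->].
apply: hwp_conseq (@link_loop_spec W V n d _ m y (wfm_linkable wm _) (w_bounded wm) rm _ _ _ _ hd _) _ => //; try lia.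
move=> k2 r' m' [k2b fr wm' hs [pp _]]; split=> //.
  by move: k2b; rewrite /acost /=; lia.
exact: frame_updl (frame_updl _ fr).
Qed.

Lemma wfm_detached W n m m' h q : wfm W n m -> detached m m' (trie h q) ->
  forest (leaf n) m' -> bounded W m' -> (forall x, node x -> good (leaf n) m' x) -> wfm W n m'.
Proof.
move=> [F B G L C] [hp_ hk ho] F' B' G'; split=> //.
- by move=> x s nx s2; rewrite hk //; case: ifP => // _; apply: L.
- move=> y y2 py s s2; rewrite hk ?node_hp //; try lia; case: ifP => // _.
  apply: C => //; move: py; rewrite hp_ ?al_hp // ifN //.
  by apply/eqP => e; apply: (trie_hp (esym e)).
Qed.

Lemma wfm_attached W n m m' h q p t : wfm W n m -> attached m m' (trie h q) p t ->
  edge p t (trie h q) -> (forall y, p = hp y -> 2 < y -> par m p != 0) ->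
  forest (leaf n) m' -> bounded W m' -> (forall x, node x -> good (leaf n) m' x) -> wfm W n m'.
Proof.
move=> [F B G L C] [hp_ hk ho] e np F' B' G'; split=> //.
- move=> x s nx s2; rewrite hk //; case: andP => [[/eqP -> /eqP ->] //|_]; exact: L.
- move=> y y2; rewrite hp_ ?al_hp // ifN; last by apply/eqP => e'; apply: (trie_hp (esym e')).
  move=> py s s2; rewrite hk ?node_hp //; try lia; case: andP => [[/eqP ep _]|_]; last exact: C.
  by have := np y (esym ep) y2; rewrite -ep py.
Qed.

Definition trie_par m m' h q p :=
  (forall h' q', par m' (trie h' q') = if (h' == h) && (q' == q) then p else par m (trie h' q'))
  /\ same_other m m'.

Lemma slot_free n m v : forest (leaf n) m -> legal m -> 0 < v ->
  (forall h q, par m (trie h q) != hp (2 * v)) -> kid m (hp (2 * v)) 0 = 0.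
Proof.
move=> F L v0 fr; apply/eqP/negPn/negP => k0.
have nv : node (hp (2 * v)) by apply: node_hp; lia.
have [e _] := f_dn F nv (isT : 0 < 2) k0.
have [[[h [q ex]] _]|[y' [y'2 ey es ex]]] := edge_of_hp (L _ _ nv (isT : 0 < 2) k0).
  by have := fr h q; rewrite -ex e eqxx.
by move: ey es; rewrite /pr /pr_side; case: ifP => //; lia.
Qed.

Lemma attach_slot_spec W V n e r m h q v : wfm W n m -> room W V -> r 1 = 0 ->
  r 16 = v -> r 21 = trie h q -> 0 < v < 2 ^ e.+1 -> 2 * v <= V -> trie h q + 200 <= W ->
  par m (trie h q) = 0 -> (forall h' q', par m (trie h' q') != hp (2 * v)) ->
  hwp W attach_slot (fun k r' m' => [/\ k <= 600 * e.+1, frame (iota 2 14) r r',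
     wfm W n m' & trie_par m m' h q (hp (2 * v))]) r m.
Proof.
move=> wm rm r1 r16 r21 ve vV tb pc fr; have W100 := room_W rm.
have /andP[v0 _] := ve; have v20 : 1 < 2 * v by lia.
have hb : hp (2 * v) + 200 <= W by apply: (hp_bound rm).
rewrite /attach_slot; apply: hwp_seq; apply: hwp_assign; [by []|lia|rewrite /= r16; repeat split; lia|rewrite /= r16].
apply: hwp_seq; apply: hwp_conseq (@link_heap_spec W V n (2 * e + 1) _ m (2 * v) wm rm _ _ _ (prn_bound ve)) _ => //.
  by rewrite v20.
move=> k1 ra m1 [k1b fra wm1 [s1 s2 s3 s4] pp].
have e21 : ra 21 = trie h q by rewrite fra.
have e16 : ra 16 = v by rewrite fra.
apply: hwp_seq; apply: hwp_assign; [by []|lia|rewrite /= e21; lia|rewrite /= e21].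
apply: hwp_seq; apply: hwp_assign; [by []|lia| |].
  by apply: safe_hp; rewrite /= e16 //; repeat split; lia.
rewrite eval_hp /= e16; asg.
case: (wm) => F B G L C; case: (wm1) => F1 B1 G1 L1 C1.
have nt := node_trie h q; have nv : node (hp (2 * v)) by apply: node_hp; lia.
have A : attachable (leaf n) m1 (trie h q) (hp (2 * v)) 0.
  split=> //.
  - by rewrite s1.
  - by rewrite s3 //; apply: slot_free F L v0 fr.
  - exact: leaf_hp.
  - move=> d; have y0 : 0 < 2 * v by lia.
    case: (heap_chain d F1 L1 y0) => [->|[y' [yl' ->]]].
      by rewrite eq_sym trie_neq0.
    by apply/eqP => e'; apply: (trie_hp (esym e')).
apply: hwp_conseq (@attach_spec _ _ W _ (2 * e + 1) _ m1 (trie h q) (hp (2 * v)) 0 F1 B1 _ _ _ _ _ _ _ A _ G1) _ => //=; try lia.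
- by rewrite fra.
- exact: (iter_hp_slot F1 L1 ve).
move=> k2 rb m2 [k2b frb at2 F2 [B2 G2]]; split.
- lia.
- have frb' := frame_sub frb (ys := iota 2 14) isT.
  by apply: frame_comp (frame_updl _ fra) (frame_updl _ (frame_updl _ (frame_updl _ frb'))).
- by apply: wfm_attached wm1 at2 _ _ F2 B2 G2; [apply: EdgeSlot|move=> y /hp_inj <- /pp].
case: at2 => a1 a2 a3; split; last exact: other_trans s4 a3.
by move=> h' q'; rewrite a1 ?al_trie // trie_eqE s1.
Qed.

Lemma detach_trie W n d r m h q : wfm W n m -> 100 < W -> r 1 = 0 ->
  r 9 = trie h q -> trie h q + 16 <= W -> iter d (par m) (trie h q) = 0 ->
  hwp W detach (fun k r' m' => [/\ k <= 70 * d.+1 + 20, frame (iota 2 7) r r',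
     wfm W n m' & trie_par m m' h q 0]) r m.
Proof.
move=> wm W100 r1 r9 tb hd; case: (wm) => F B G L C.
apply: hwp_conseq (detach_spec F B W100 r1 r9 tb (node_trie h q) hd G) _.
move=> k r' m' [kb fr dt F' [B' G']]; split=> //; first exact: wfm_detached wm dt F' B' G'.
case: dt => a1 a2 a3; split=> // h' q'; by rewrite a1 ?al_trie // trie_eqE.
Qed.

Lemma attach_trie W n d r m h q : wfm W n m -> 100 < W -> r 1 = 0 ->
  r 9 = trie h q -> r 2 = trie h.+1 (q %/ 2) -> r 10 = trie h.+1 (q %/ 2) + 4 + q %% 2 ->
  trie h q + 200 <= W -> trie h.+1 (q %/ 2) + 200 <= W ->
  1 < q -> par m (trie h q) = 0 -> iter d (par m) (trie h.+1 (q %/ 2)) = 0 ->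
  hwp W attach (fun k r' m' => [/\ k <= 70 * d.+1 + 20, frame (iota 2 7) r r',
     wfm W n m' & trie_par m m' h q (trie h.+1 (q %/ 2))]) r m.
Proof.
move=> wm W100 r1 r9 r2 r10 tb pb q1 pc hd; case: (wm) => F B G L C.
have q2 : q %% 2 < 2 by lia.
have ed : edge (trie h.+1 (q %/ 2)) (q %% 2) (trie h q).
  rewrite [X in edge _ _ (trie _ X)](_ : q = 2 * (q %/ 2) + q %% 2); last by lia.
  by apply: EdgeTrie; lia.
have A : attachable (leaf n) m (trie h q) (trie h.+1 (q %/ 2)) (q %% 2).
  split=> //; try exact: node_trie.
  - apply/eqP/negPn/negP => k0.
    have [e _] := f_dn F (node_trie _ _) q2 k0.
    have [h' [[eh] _ _ ex]] := edge_of_trie (L _ _ (node_trie _ _) q2 k0).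
    have eq_ : 2 * (q %/ 2) + q %% 2 = q by lia.
    move: e; rewrite ex -eh eq_ pc => e0; by have := trie_neq0 h.+1 (q %/ 2); rewrite -e0.
  - by move/leaf_trie.
  (* The chain above the new parent consists of heap nodes and blocks of height more than [h], hence
     avoids [trie h q]. *)
  - have cl x : (exists2 y, 0 < y & x = hp y) \/ (exists h' q', x = trie (h.+1 + h') q') \/ x = 0 ->
        (exists2 y, 0 < y & par m x = hp y) \/ (exists h' q', par m x = trie (h.+1 + h') q') \/ par m x = 0.
      case=> [[y y0 ->]|[[h' [q' ->]]|->]].
      - have [->|py] := eqVneq (par m (hp y)) 0; first by right; right.
        have [y2 ->] := par_hp F L y0 py; left; exists (pr y) => //; have := pr_lt y2; lia.
      - have [->|py] := eqVneq (par m (trie (h.+1 + h') q')) 0; first by right; right.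
        have [[v v0 ->]|[_ ->]] := par_trie F L py; first by left; exists (2 * v) => //; lia.
        by right; left; exists h'.+1, (q' %/ 2); rewrite addnS.
      - by right; right; apply: f_par0 F.
    have ch d' : (exists2 y, 0 < y & iter d' (par m) (trie h.+1 (q %/ 2)) = hp y) \/
        (exists h' q', iter d' (par m) (trie h.+1 (q %/ 2)) = trie (h.+1 + h') q') \/
        iter d' (par m) (trie h.+1 (q %/ 2)) = 0.
      elim: d' => [|d' IH]; last by rewrite iterS; apply: cl.
      by right; left; exists 0, (q %/ 2); rewrite addn0.
    move=> d'; case: (ch d') => [[y y0 ->]|[[h' [q' ->]]|->]].
    + by apply/eqP => e'; apply: (trie_hp (esym e')).
    + by rewrite trie_eqE; lia.
    + by rewrite eq_sym trie_neq0.
apply: hwp_conseq (@attach_spec _ _ W _ d _ m (trie h q) _ (q %% 2) F B W100 r1 r9 r2 r10 _ _ A hd G) _ => //; try lia.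
move=> k r' m' [kb fr at2 F2 [B2 G2]]; split=> //.
- by apply: wfm_attached wm at2 ed _ F2 B2 G2 => y /trie_hp.
case: at2 => a1 a2 a3; split=> //.
by move=> h' q'; rewrite a1 ?al_trie // trie_eqE.
Qed.

End Slot.

(* The slots [8 * 2 ^ h + x] with [x < 8 * 2 ^ h] serve the blocks of height [h]: [x = 0] the block 1,
   [x = 1] the complete block whose parent is incomplete, and the others the hung blocks. *)
Definition slot h x := hp (2 * (8 * 2 ^ h + x)).
Arguments slot : simpl never.

(** Where a block belongs while it is not hung. Complete means that its last index,
    [q.+1 * 2 ^ h - 1], is at most [n]; incomplete blocks and block 0 have no parent. *)
Definition home n h q :=
  if (q == 0) || (n.+1 < q.+1 * 2 ^ h) then 0
  else if q == 1 then slot h 0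
  else if (q %/ 2).+1 * (2 * 2 ^ h) <= n.+1 then trie h.+1 (q %/ 2)
  else slot h 1.
Arguments home : simpl never.

Definition place_home :=
  if_lt (Lit 0) (Var 19)
   (if_lt (Bin Times (Var 19 +! 1) (Var 18)) (Var 20 +! 2)
     (if_eq (Var 19) (Lit 1)
        (assign 16 (Bin Times (Lit 8) (Var 18)) ;; attach_slot)
        (if_lt (Bin Times (Bin Defs.Quotient (Var 19) (Lit 2) +! 1) (Bin Times (Lit 2) (Var 18)))
               (Var 20 +! 2)
          (assign 9 (Var 21) ;;
           assign 2 (trie_expr (Var 17 +! 1) (Bin Defs.Quotient (Var 19) (Lit 2))) ;;
           assign 10 (Bin Plus (Var 2 +! 4)
             (Bin Minus (Var 19) (Bin Times (Lit 2) (Bin Defs.Quotient (Var 19) (Lit 2))))) ;;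
           attach)
          (assign 16 (Bin Times (Lit 8) (Var 18) +! 1) ;; attach_slot)))
     Skip)
   Skip.

Definition move_home := assign 9 (Var 21) ;; detach ;; place_home.

Definition rehome :=
  assign 21 (trie_expr (Var 17) (Var 19)) ;;
  if_eq (fld (Var 21) 7) (Lit 0) move_home Skip.

Arguments place_home : simpl never.
Arguments move_home : simpl never.
Arguments rehome : simpl never.

(** The slots of height [h] have the numbers from [8 * 2 ^ h] to [16 * 2 ^ h], the latter excluded,
    and these intervals are disjoint. *)
Lemma slot_inj h x h' x' : x < 8 * 2 ^ h -> x' < 8 * 2 ^ h' -> slot h x = slot h' x' ->
  h = h' /\ x = x'.
Proof.
move=> hx hx' /hp_inj e; have {}e : 8 * 2 ^ h + x = 8 * 2 ^ h' + x' by lia.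
have : ~ (h < h').
  by move=> l; have := leq_pexp2l (isT : 0 < 2) l; rewrite expnS; lia.
have : ~ (h' < h).
  by move=> l; have := leq_pexp2l (isT : 0 < 2) l; rewrite expnS; lia.
by move=> *; have eh : h = h' by [lia]; subst; split=> //; lia.
Qed.

Lemma slot_trie h x h' q : slot h x = trie h' q -> False.
Proof. by move=> e; apply: (trie_hp (esym e)). Qed.

Lemma slot_neq0 h x : slot h x != 0.
Proof. by apply: hp_neq0; have := expn_gt0 2 h; lia. Qed.

Section Home.
Context {disp : Order.disp_t} {U : orderType disp}.
Implicit Types (m : memory U) (r : env).

Lemma slot_range h x : x < 8 * 2 ^ h -> 0 < 8 * 2 ^ h + x < 2 ^ (h + 3).+1.
Proof. by move=> ?; rewrite (_ : (h + 3).+1 = h + 4) ?expnD; [have := expn_gt0 2 h; lia|lia]. Qed.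

Lemma place_home_spec W V n d r m h q : wfm W n m -> room W V -> r 1 = 0 ->
  r 17 = h -> r 18 = 2 ^ h -> r 19 = q -> r 20 = n -> r 21 = trie h q ->
  (q + 2) * 2 ^ h <= V -> 16 * 2 ^ h + 16 <= V -> h < V -> n + 2 <= V -> q <= V ->
  par m (trie h q) = 0 ->
  (forall x h' q', x < 2 -> home n h q = slot h x -> par m (trie h' q') != slot h x) ->
  (home n h q = trie h.+1 (q %/ 2) -> iter d (par m) (trie h.+1 (q %/ 2)) = 0) ->
  hwp W place_home (fun k r' m' => [/\ k <= 600 * (h + 4) + 70 * d.+1 + 100,
     frame (iota 2 15) r r', wfm W n m' & trie_par m m' h q (home n h q)]) r m.
Proof.
move=> wm rm r1 r17 r18 r19 r20 r21 b1 b2 b3 b4 b5 pc fr dp.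
have W100 := room_W rm; have p0 := expn_gt0 2 h.
have tb : trie h q + 200 <= W by apply: (trie_bound rm); lia.
have noth : home n h q = 0 -> hwp W Skip (fun k r' m' => [/\ k <= 1,
     frame (iota 2 15) r r', wfm W n m' & trie_par m m' h q (home n h q)]) r m.
  move=> ->; apply: hwp_skip; split=> //; split=> // h' q'.
  by case: andP => // -[/eqP -> /eqP ->].
have slt x e : x < 2 -> home n h q = slot h x -> eval r (word m) e = 8 * 2 ^ h + x -> wf e ->
    asafe W r (word m) e -> acost e <= 9 ->
  hwp W (assign 16 e ;; attach_slot) (fun k r' m' => [/\ k <= 600 * (h + 4) + 9,
     frame (iota 2 15) r r', wfm W n m' & trie_par m m' h q (home n h q)]) r m.
  move=> x2 eh ev we se ce; rewrite eh; have xb : x < 8 * 2 ^ h by lia.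
  apply: hwp_seq; apply: hwp_assign; [by rewrite we|lia|by []|rewrite ev].
  apply: hwp_conseq (@attach_slot_spec _ _ W V n (h + 3) _ m h q (8 * 2 ^ h + x) wm rm _ _ _ (slot_range xb) _ tb pc _) _ => //; try lia.
    by move=> h' q'; apply: (fr x).
  move=> k r' m' [kb f' wm' tp]; split=> //; first by move: kb; lia.
  exact: frame_updl (frame_sub f' (ys := iota 2 15) isT).
rewrite /place_home.
apply: hwp_lt; [by []|sd|sd|rewrite /= r19].
case: ifP => q0; last first.
  apply: hwp_conseq (noth _) _; first by rewrite /home ifT //; lia.
  by move=> k r' m' [? ? ? ?]; split=> //; lia.
have c1 : q.+1 * 2 ^ h <= V by nia.
apply: hwp_lt; [by []|rewrite /= r19 r18 addn1; repeat split; lia|rewrite /= r20; repeat split; lia|rewrite /= r19 r18 r20 addn1].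
case: ifP => qc; last first.
  apply: hwp_conseq (noth _) _; first by rewrite /home ifT //; lia.
  by move=> k r' m' [? ? ? ?]; split=> //; lia.
have hE : home n h q = if q == 1 then slot h 0
  else if (q %/ 2).+1 * (2 * 2 ^ h) <= n.+1 then trie h.+1 (q %/ 2) else slot h 1.
  by rewrite /home ifF //; lia.
apply: hwp_eq; [by []|sd|sd|rewrite /= r19].
case: eqP hE => [q1|q1] hE.
  apply: hwp_conseq (slt 0 (Bin Times (Lit 8) (Var 18)) isT hE _ _ _ _) _ => //=.
  - by rewrite r18 addn0.
  - by rewrite r18; repeat split; lia.
  by move=> k r' m' [? ? ? ?]; split=> //; lia.
have c2 : (q %/ 2).+1 * (2 * 2 ^ h) <= V by nia.
apply: hwp_lt; [by []|rewrite /= r19 r18 addn1; repeat split; lia|rewrite /= r20; repeat split; lia|rewrite /= r19 r18 r20 addn1].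
rewrite (_ : (_ < n + 2) = ((q %/ 2).+1 * (2 * 2 ^ h) <= n.+1)); last by lia.
case: leqP hE => pcm hE; last first.
  apply: hwp_conseq (slt 1 (Bin Times (Lit 8) (Var 18) +! 1) isT hE _ _ _ _) _ => //=.
  - by rewrite r18.
  - by rewrite r18; repeat split; lia.
  by move=> k r' m' [? ? ? ?]; split=> //; lia.
have pb : trie h.+1 (q %/ 2) + 200 <= W by apply: (trie_bound rm); lia.
apply: hwp_seq; apply: hwp_assign; [by []|lia|rewrite /= r21; lia|rewrite /= r21].
apply: hwp_seq; apply: hwp_assign; [by []|lia| |].
  apply: safe_trie; rewrite /= ?r17 ?r19 ?addn1 //; repeat split; lia.
rewrite eval_trie /= r17 r19 (addn1 h).
apply: hwp_seq; apply: hwp_assign; [by []|lia|rewrite /= r19; repeat split; lia|rewrite /= r19].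
have q2 : q - 2 * (q %/ 2) = q %% 2 by lia.
apply: hwp_conseq (@attach_trie _ _ W n d _ m h q wm _ _ _ _ _ tb pb _ pc (dp hE)) _ => //=; try lia.
move=> k r' m' [kb f' wm' tp]; rewrite hE; split=> //; first lia.
by have f2 := frame_sub f' (ys := iota 2 15) isT; apply: frame_updl (frame_updl _ (frame_updl _ f2)).
Qed.

(** [d0] bounds the walk after cutting, [d] the walk after attaching. The latter starts in the
    memory where the block has been cut off, so its hypothesis speaks of all such memories. *)
Lemma move_home_spec W V n d0 d r m h q : wfm W n m -> room W V -> r 1 = 0 ->
  r 17 = h -> r 18 = 2 ^ h -> r 19 = q -> r 20 = n -> r 21 = trie h q ->
  (q + 2) * 2 ^ h <= V -> 16 * 2 ^ h + 16 <= V -> h < V -> n + 2 <= V -> q <= V ->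
  iter d0 (par m) (trie h q) = 0 ->
  (forall x h' q', x < 2 -> home n h q = slot h x -> (h', q') <> (h, q) ->
     par m (trie h' q') != slot h x) ->
  (home n h q = trie h.+1 (q %/ 2) -> forall m', wfm W n m' -> trie_par m m' h q 0 ->
    iter d (par m') (trie h.+1 (q %/ 2)) = 0) ->
  hwp W move_home (fun k r' m' => [/\ k <= 600 * (h + 4) + 70 * (d0 + d) + 300,
     frame (iota 2 15) r r', wfm W n m' & trie_par m m' h q (home n h q)]) r m.
Proof.
move=> wm rm r1 r17 r18 r19 r20 r21 b1 b2 b3 b4 b5 hd0 fr dp.
have W100 := room_W rm; have p0 := expn_gt0 2 h.
have tb : trie h q + 200 <= W by apply: (trie_bound rm); lia.
apply: hwp_seq; apply: hwp_assign; [by []|lia|rewrite /= r21; lia|rewrite /= r21].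
apply: hwp_seq; apply: hwp_conseq (@detach_trie _ _ W n d0 _ m h q wm _ _ _ _ hd0) _ => //; try lia.
move=> k1 ra m1 [k1b fra wm1 tp1]; have [tpa so] := tp1.
apply: hwp_conseq (@place_home_spec W V n d ra m1 h q wm1 rm _ _ _ _ _ _ b1 b2 b3 b4 b5 _ _ _) _.
1-6: by rewrite fra.
- by rewrite tpa !eqxx.
- move=> x h' q' x2 eh; rewrite tpa; case: andP => [_|ne]; first by rewrite eq_sym slot_neq0.
  by apply: fr => // -[e1 e2]; apply: ne; rewrite e1 e2 !eqxx.
- by move=> eh; apply: dp.
move=> k2 rb m2 [k2b frb wm2 [tpb so2]]; split=> //.
- by move: k1b k2b; rewrite /=; lia.
- have f1 := frame_sub (frame_updl (xs := iota 2 15) (x := 9) isT (frame_sub fra (ys := iota 2 15) isT)) (ys := iota 2 15) isT.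
  exact: frame_comp f1 frb.
split; last exact: other_trans so so2.
by move=> h' q'; rewrite tpb tpa; case: (_ && _).
Qed.

(* Word 7 of a block tells whether it is hung; [layout] allows the heights to be at different sizes,
   as they are while a leaf is being added. *)
Definition flag m h q := word m (trie h q + 7).

(** A block of height [h] that hangs from the heap does so at depth O(h). *)
Definition own_slots m := forall h q v, 0 < v -> par m (trie h q) = hp (2 * v) -> v < 2 ^ (h + 4).

(** The way up through the trie ends here: the block hangs from a slot or from nothing. *)
Definition stop m h q := par m (trie h q) != trie h.+1 (q %/ 2).

(** There are at most [j] links in the trie, followed by a path in the heap from a slot of height at
    most [h + j], with two links per level of the heap. All bounds on depth come from here. *)
Lemma dep_stop W n m j h q : wfm W n m -> own_slots m -> stop m (h + j) (q %/ 2 ^ j) ->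
  iter (j + 2 * (h + j) + 8) (par m) (trie h q) = 0.
Proof.
move=> wm own; case: (wm) => F B G L C.
elim: j h q => [|j IH] h q.
  rewrite addn0 divn1 => st; rewrite add0n addnS iterSr.
  have [->|py] := eqVneq (par m (trie h q)) 0; first by rewrite (iter_par0 _ F).
  have [[v v0 e]|[_ e]] := par_trie F L py; last by move: st; rewrite /stop e eqxx.
  rewrite e (_ : 2 * h + 7 = 2 * (h + 3) + 1); last by lia.
  apply: (iter_hp_slot F L); rewrite v0 /= -addnS; exact: own v0 e.
move=> st; rewrite !addSn iterSr.
have [->|py] := eqVneq (par m (trie h q)) 0; first by rewrite (iter_par0 _ F).
have [[v v0 e]|[_ e]] := par_trie F L py.
  rewrite e; apply: (iter_par_ge F (d := 2 * (h + 3) + 1)); last by lia.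
  apply: (iter_hp_slot F L); rewrite v0 /= -addnS; exact: own v0 e.
rewrite e; apply: (iter_par_ge F (d := j + 2 * (h.+1 + j) + 8)); last by lia.
by apply: IH; rewrite -divnMA -expnS addSn -addnS.
Qed.

Definition layout (hm : nat -> nat) m := forall h q,
  if flag m h q == 0 then par m (trie h q) = home (hm h) h q
  else exists2 x, 1 < x < 8 * 2 ^ h & par m (trie h q) = slot h x.

Lemma home_own n h q v : home n h q = hp (2 * v) -> 0 < v -> v < 2 ^ (h + 4).
Proof.
rewrite /home => e v0; have p0 := expn_gt0 2 h; rewrite expnD; move: e.
case: ifP => _; first by move=> e; have := hp_neq0 (y := 2 * v); rewrite -e; lia.
case: ifP => _; first by move/hp_inj; lia.
by case: ifP => _; [move/trie_hp|move/hp_inj; lia].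
Qed.

Lemma layout_own W n hm m : wfm W n m -> layout hm m -> own_slots m.
Proof.
move=> wm L h q v v0 e; have := L h q; case: ifP => _.
  by rewrite e => /esym eh; apply: home_own eh v0.
by case=> x xb; rewrite e => /hp_inj ev; rewrite expnD; lia.
Qed.

Lemma layout_stop_flag hm m h q : layout hm m -> flag m h q != 0 -> stop m h q.
Proof.
move=> L f; have := L h q; rewrite (negbTE f) /stop => -[x _ ->].
by apply/eqP => /slot_trie.
Qed.

Lemma layout_stop_home hm m h q : layout hm m -> home (hm h) h q != trie h.+1 (q %/ 2) -> stop m h q.
Proof.
move=> L hn; have := L h q; rewrite /stop; case: ifP => [_ -> //|_ [x _ ->]].
by apply/eqP => /slot_trie.
Qed.

Lemma rehome_spec W V n d0 d r m h q : wfm W n m -> room W V -> r 1 = 0 ->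
  r 17 = h -> r 18 = 2 ^ h -> r 19 = q -> r 20 = n ->
  (q + 2) * 2 ^ h <= V -> 16 * 2 ^ h + 16 <= V -> h < V -> n + 2 <= V -> q <= V ->
  iter d0 (par m) (trie h q) = 0 ->
  (forall x h' q', x < 2 -> home n h q = slot h x -> (h', q') <> (h, q) ->
     par m (trie h' q') != slot h x) ->
  (home n h q = trie h.+1 (q %/ 2) -> forall m', wfm W n m' -> trie_par m m' h q 0 ->
    iter d (par m') (trie h.+1 (q %/ 2)) = 0) ->
  hwp W rehome (fun k r' m' => [/\ k <= 600 * (h + 4) + 70 * (d0 + d) + 400,
     frame (21 :: iota 2 15) r r', wfm W n m' & same_other m m' /\
     forall h' q', par m' (trie h' q') =
       if (h' == h) && (q' == q) && (flag m h q == 0) then home n h q else par m (trie h' q')]) r m.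
Proof.
move=> wm rm r1 r17 r18 r19 r20 b1 b2 b3 b4 b5 hd0 fr dp.
have W100 := room_W rm; have p0 := expn_gt0 2 h.
have tb : trie h q + 200 <= W by apply: (trie_bound rm); lia.
rewrite /rehome; apply: hwp_seq; apply: hwp_assign; [by []|lia| |].
  by apply: safe_trie => //=; rewrite r17 r19.
rewrite eval_trie /= r17 r19.
apply: hwp_eq; [by []|sd|sd|rewrite /= -/(flag m h q)].
case: (eqVneq (flag m h q) 0) => f0.
  apply: hwp_conseq (@move_home_spec W V n d0 d _ m h q wm rm _ _ _ _ _ _ b1 b2 b3 b4 b5 hd0 fr dp) _ => //.
  move=> k r' m' [kb f' wm' [tp so]]; split=> //.
  - rewrite /nd_expr /=; lia.
  - exact: frame_updl (frame_sub f' (ys := 21 :: iota 2 15) isT).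
  - by split=> // h' q'; rewrite tp andbT.
apply: hwp_skip; split=> //.
- rewrite /nd_expr /=; lia.
- exact: frame_upd.
- by split=> // h' q'; rewrite andbF.
Qed.

End Home.
Arguments flag {disp U} m h q : simpl never.

(** * Adding a leaf and changing a key *)

(* Registers: 17 the height [h], 18 its power [2 ^ h], 19 the block [q], 20 the number of leaves,
   21 the address of the block. *)
Definition add_body :=
  rehome ;;
  if_eq (Bin Minus (Var 19) (Bin Times (Lit 2) (Bin Defs.Quotient (Var 19) (Lit 2)))) (Lit 1)
    (if_eq (Var 19) (Lit 1) (assign 22 (Lit 0))
       (assign 19 (Bin Minus (Var 19) (Lit 1)) ;; rehome ;;
        assign 17 (Var 17 +! 1) ;; assign 18 (Bin Times (Lit 2) (Var 18)) ;;
        assign 19 (Bin Defs.Quotient (Var 19) (Lit 2))))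
    (assign 22 (Lit 0)).

Definition new_leaf :=
  assign 20 (Get (Lit 1) +! 1) ;; store (Lit 1) (Var 20) ;;
  assign 21 (trie_expr (Lit 0) (Var 20)) ;; copy_item (Var 21) (Lit 0) ;;
  store (Var 21 +! 2) (Var 21) ;; store (Var 21 +! 3) (Var 20).

(** The literal 96 is the address of the root, [hp 2]. *)
Definition add_leaf :=
  new_leaf ;;
  assign 17 (Lit 0) ;; assign 18 (Lit 1) ;; assign 19 (Var 20) ;; assign 22 (Lit 1) ;;
  while_pos 23 (Var 22) add_body ;; store (Lit 0) (Lit 96).

Definition change_key :=
  assign 9 (trie_expr (Lit 0) (Var 0)) ;; copy_item (Var 9) (Lit 0) ;;
  assign 2 (fld (Var 9) 6) ;; fixup.

Arguments add_body : simpl never.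
Arguments new_leaf : simpl never.

(** The increment to [N] carries up to each height [h'] for which [2 ^ h'] divides [N], at a cost
    proportional to the height. *)
Definition carry_cost h N := \sum_(h <= h' < N | 2 ^ h' %| N) h'.+1.

Lemma home_incomplete n h q : n.+1 < q.+1 * 2 ^ h -> home n h q = 0.
Proof. by rewrite /home => ->; rewrite orbT. Qed.

Lemma home0 n h : home n h 0 = 0.
Proof. by rewrite /home. Qed.

(** A test in [home] changes its outcome only if the block or its parent ends exactly at [n.+2];
    this concerns [q] and, for odd [q], its sibling. *)
Lemma home_next n h q q' : q.+1 * 2 ^ h = n.+2 -> q' <> q ->
  ~ [/\ odd q, 1 < q & q' = q.-1] -> home n.+1 h q' = home n h q'.
Proof.
move=> e nq ns; have p0 := expn_gt0 2 h.
rewrite /home; have [->|q'0] := posnP q'; first by [].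
rewrite /=.
have -> : (n.+2 < q'.+1 * 2 ^ h) = (n.+1 < q'.+1 * 2 ^ h).
  have ne : q'.+1 * 2 ^ h <> n.+2 by rewrite -e => /eqP; rewrite eqn_pmul2r // => /eqP [].
  by apply/idP/idP; lia.
case: ifP => // cm; case: eqP => // q'1.
suff -> : ((q' %/ 2).+1 * (2 * 2 ^ h) <= n.+2) = ((q' %/ 2).+1 * (2 * 2 ^ h) <= n.+1) by [].
apply/idP/idP; last by lia.
move=> l; suff : (q' %/ 2).+1 * (2 * 2 ^ h) != n.+2 by lia.
apply/eqP; rewrite -e mulnA => /eqP; rewrite eqn_pmul2r // => /eqP ee.
apply: ns; split; lia.
Qed.

(** A block of greater height ending at [n.+2] would make [q.+1] even, so [q = 1], and then it is
    block 0 of height [h.+1], which is never placed. *)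
Lemma home_stop n h q h' q' : q.+1 * 2 ^ h = n.+2 -> ~~ odd q \/ q = 1 -> h < h' ->
  home n.+1 h' q' = home n h' q'.
Proof.
move=> e hq hh; have p0 := expn_gt0 2 h.
have [j ej] : exists j, h' = h + j.+1 by exists (h' - h.+1); lia.
have nd c : 0 < c -> c * 2 ^ h' = n.+2 -> c = 1 /\ h' = h.+1.
  rewrite ej -e addnC expnD mulnA => c0 /eqP; rewrite eqn_pmul2r // expnS mulnCA => /eqP ec.
  case: hq => [o|q1]; first by lia.
  move: ec; rewrite q1; case: j {ej} => [|j]; first by rewrite expn0; lia.
  by rewrite expnS; have := expn_gt0 2 j; nia.
rewrite /home; have [->|q'0] := posnP q'; first by [].
rewrite /=.
have -> : (n.+2 < q'.+1 * 2 ^ h') = (n.+1 < q'.+1 * 2 ^ h').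
  have ne : q'.+1 * 2 ^ h' <> n.+2 by case/nd => //; lia.
  by apply/idP/idP; lia.
case: ifP => // cm; case: eqP => // q'1.
suff -> : ((q' %/ 2).+1 * (2 * 2 ^ h') <= n.+2) = ((q' %/ 2).+1 * (2 * 2 ^ h') <= n.+1) by [].
apply/idP/idP; last by lia.
move=> l; suff : (q' %/ 2).+1 * (2 * 2 ^ h') != n.+2 by lia.
apply/eqP; rewrite mulnA => /nd[]//; lia.
Qed.

Lemma home_slot n h q h' x : home n h q = slot h' x -> x < 2 ->
  h' = h /\ q.+1 * 2 ^ h <= n.+1 /\
  (x = 0 /\ q = 1 \/ [/\ x = 1, 1 < q & n.+1 < (q %/ 2).+1 * (2 * 2 ^ h)]).
Proof.
rewrite /home => e x2; have p0 := expn_gt0 2 h; have p1 := expn_gt0 2 h'; move: e.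
case: ifP => [_ e|/negbT]; first by have := slot_neq0 h' x; rewrite -e.
rewrite negb_or -leqNgt => /andP[q0 cm].
have sl y : y < 2 -> slot h y = slot h' x -> h' = h /\ y = x.
  by move=> y2 /slot_inj; case; [lia|lia|move=> -> ->].
case: eqP => [q1 /sl[]// -> <-|q1]; first by split=> //; split=> //; left.
case: (leqP _ n.+1) => [_ ex|l /sl[]// -> <-]; first by case: (slot_trie (esym ex)).
by split=> //; split=> //; right; split=> //; lia.
Qed.

(** If [q'] waits for its parent to become complete, then [q] comes after [q'] but within this
    parent, so it is the right child. Hence slot 1 is free when an even block becomes complete. *)
Lemma pending_unique n h q q' :
  q.+1 * 2 ^ h = n.+2 -> q'.+1 * 2 ^ h <= n.+1 ->
  n.+1 < (q' %/ 2).+1 * (2 * 2 ^ h) -> odd q.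
Proof.
move=> e a b; have p0 := expn_gt0 2 h.
have : q' < q.
  have : q'.+1 * 2 ^ h < q.+1 * 2 ^ h by lia.
  by rewrite ltn_pmul2r.
have : q < (q' %/ 2).+1 * 2.
  have : q.+1 * 2 ^ h <= ((q' %/ 2).+1 * 2) * 2 ^ h by lia.
  by rewrite leq_pmul2r.
lia.
Qed.

Section Add.
Context {disp : Order.disp_t} {U : orderType disp}.
Implicit Types (m : memory U) (r : env).

Definition half_new n h (h' : nat) := if h' < h then n.+1 else n.

Lemma own_trie_par0 m m' h q : own_slots m -> trie_par m m' h q 0 -> own_slots m'.
Proof.
move=> own [tp _] h' q' v v0; rewrite tp; case: ifP => _; last exact: own.
by move=> e; have := hp_neq0 (y := 2 * v); rewrite -e; lia.
Qed.

Lemma stop_trie_par0 m m' h q h' q' : stop m h' q' -> trie_par m m' h q 0 -> stop m' h' q'.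
Proof.
move=> st [tp _]; rewrite /stop tp; case: ifP => _ //; by rewrite eq_sym trie_neq0.
Qed.

Lemma stop_dep W n m h q : wfm W n m -> own_slots m -> stop m h q ->
  iter (2 * h + 8) (par m) (trie h q) = 0.
Proof.
move=> wm own st; have := @dep_stop _ _ W n m 0 h q wm own.
by rewrite addn0 divn1 add0n; apply.
Qed.

Lemma other_flag m m' h q : same_other m m' -> flag m' h q = flag m h q.
Proof. by move=> [h1 _ _]; rewrite /flag h1 // al_trie. Qed.

Lemma layout_step hm hm' m m' h q n : layout hm m -> same_other m m' ->
  (forall h' q', par m' (trie h' q') =
       if (h' == h) && (q' == q) && (flag m h q == 0) then home n h q else par m (trie h' q')) ->
  forall h' q', ((h', q') = (h, q) -> home n h q = home (hm' h) h q) ->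
   ((h', q') <> (h, q) -> home (hm h') h' q' = home (hm' h') h' q') ->
   if flag m' h' q' == 0 then par m' (trie h' q') = home (hm' h') h' q'
  else exists2 x, 1 < x < 8 * 2 ^ h' & par m' (trie h' q') = slot h' x.
Proof.
move=> L so tp h' q' e1 e2; rewrite (other_flag h' q' so) tp; have := L h' q'.
case: (eqVneq h' h) e1 e2 => [->|hh]; last first.
  move=> _ e2; rewrite /=; case: ifP => // _ ->; apply: e2 => -[e _].
  by rewrite e eqxx in hh.
case: (eqVneq q' q) => [->|qq]; last first.
  move=> _ e2; rewrite /=; case: ifP => // _ ->; apply: e2 => -[e].
  by rewrite e eqxx in qq.
by move=> e1 _; rewrite /=; case: ifP => // _ _; apply: e1.
Qed.

Definition kept m m' := same_other m m' /\
  forall h q, flag m h q != 0 -> par m' (trie h q) = par m (trie h q).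

Lemma kept_trans m m' m'' : kept m m' -> kept m' m'' -> kept m m''.
Proof.
move=> [s k] [s' k']; split; first exact: other_trans s s'.
by move=> h q f; rewrite k' ?k // (other_flag _ _ s).
Qed.

Lemma kept_rehome m m' h q p : same_other m m' -> (forall h' q', par m' (trie h' q') =
  if (h' == h) && (q' == q) && (flag m h q == 0) then p else par m (trie h' q')) -> kept m m'.
Proof.
move=> s tp; split=> // h' q' f; rewrite tp ifN //.
by apply: contra f => /andP[/andP[/eqP -> /eqP ->]].
Qed.

(** The two blocks moved at height [h], and the parent that may receive them, hang from slots or
    from nothing; thus all walks have length O(h), and two moves stay within [10000 * h.+1]
    steps. *)
Lemma add_loop W V n r m h q : wfm W n.+1 m -> layout (half_new n h) m -> room W V ->
  16 * n + 100 <= V -> r 1 = 0 -> r 17 = h -> r 18 = 2 ^ h -> r 19 = q -> r 20 = n.+1 ->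
  r 22 = 1 -> 0 < q -> q.+1 * 2 ^ h = n.+2 ->
  hwp W (while_pos 23 (Var 22) add_body) (fun k r' m' =>
    [/\ k <= 100 * (100 * carry_cost h n.+2) + 20, wfm W n.+1 m',
     layout (fun=> n.+1) m' & kept m m']) r m.
Proof.
move=> wm L rm Vb r1 r17 r18 r19 r20 r22 q0 e.
elim/ltn_ind: q h r m wm L r1 r17 r18 r19 r20 r22 q0 e => q IH h r m wm L r1 r17 r18 r19 r20 r22 q0 e.
have W100 := room_W rm; have p0 := expn_gt0 2 h.
have hl : h < 2 ^ h by exact: ltn_expl.
have pn : 2 ^ h <= n.+1 by nia.
have qn : q <= n.+1 by nia.
have cc : h.+1 + carry_cost h.+1 n.+2 <= carry_cost h n.+2.
  rewrite /carry_cost [leqRHS]big_ltn_cond; last by lia.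
  by rewrite (_ : 2 ^ h %| n.+2) // -e dvdn_mull.
have own := layout_own wm L.
have h_inc : home (half_new n h h) h q = 0.
  by rewrite /half_new ltnn; apply: home_incomplete; lia.
have P_inc h' : h <= h' -> home (half_new n h h.+1) h.+1 (q %/ 2) != trie h.+2 ((q %/ 2) %/ 2).
  move=> _; rewrite /half_new ltnNge leqnSn /= home_incomplete ?(eq_sym 0) ?trie_neq0 //.
  by rewrite expnS; nia.
have st_q : stop m h q.
  by apply: (layout_stop_home L); rewrite h_inc eq_sym trie_neq0.
have st_P : stop m h.+1 (q %/ 2) by apply: (layout_stop_home L); apply: (P_inc h).
apply: hwp_while => //; [lia|rewrite /= r22; lia|rewrite /= r22 /=].
rewrite /add_body; apply: hwp_seq.
apply: hwp_conseq (@rehome_spec _ _ W V n.+1 (2 * h + 8) (2 * h.+1 + 8) _ m h q wm rm _ _ _ _ _ _ _ _ _ _ _ _ _) _ => //; try nia.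
- exact: stop_dep wm own st_q.
(* Slot 0 belongs to block 1, which would be [q] itself. If slot 1 were taken, [q] would be odd and
   its parent complete, so [q] would not go to a slot. *)
- move=> x h' q' x2 /home_slot/(_ x2)[_ [_ hx]] ne; apply/eqP => ep.
  have := L h' q'; rewrite ep; case: ifP => _.
    move=> /esym/home_slot/(_ x2)[eh [cm hx']]; subst h'.
    move: cm hx'; rewrite /half_new ltnn => cm.
    case: hx => [[-> eq1]|[-> q1 pcm]] [[//= _ eq1']|[//= _ q1' pcm']].
      by apply: ne; rewrite eq1 eq1'.
    have o := pending_unique e cm pcm'.
    by move: pcm; nia.
  case=> x' /andP[x'1 xb'] es; have xb : x < 8 * 2 ^ h by lia.
  by have [_ ex] := slot_inj xb xb' es; lia.
- move=> eh m' wm' tp; apply: stop_dep wm' (own_trie_par0 own tp) (stop_trie_par0 st_P tp).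
move=> k1 ra m1 [k1b fra wm1 [so1 tp1]].
have ra17 : ra 17 = h by rewrite fra.
have ra18 : ra 18 = 2 ^ h by rewrite fra.
have ra19 : ra 19 = q by rewrite fra.
have ra20 : ra 20 = n.+1 by rewrite fra.
have fin : ~~ odd q \/ q = 1 -> layout (fun=> n.+1) m1.
  move=> hq h' q'; apply: (layout_step (hm := half_new n h) (hm' := fun=> n.+1) L so1 tp1) => //.
  move=> ne; rewrite /half_new; case: (ltngtP h' h) => // hh; first exact/esym/(home_stop _ e hq hh).
  subst h'; apply/esym/(home_next e) => [qq|[o q1 _]]; first by apply: ne; rewrite qq.
  by case: hq => [/negP//|]; lia.
apply: hwp_eq; [by []|rewrite /= ra19; repeat split; lia|sd|rewrite /= ra19].
rewrite (_ : (q - 2 * (q %/ 2) == 1) = odd q); last by lia.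
have done_ : ~~ odd q \/ q = 1 -> hwp W (assign 22 (Lit 0)) (fun k2 r' m' =>
    hwp W (while_pos 23 (Var 22) add_body) (fun k3 r2 m2 =>
     [/\ k2 + k3 <= 50, wfm W n.+1 m2, layout (fun=> n.+1) m2 & kept m1 m2]) r' m') ra m1.
  move=> hq; apply: hwp_assign; [by []|lia|sd|rewrite /=].
  apply: hwp_while => //; [lia|rewrite /=; lia|by rewrite /= fra|rewrite /=].
  by split=> //; exact: fin.
have L1 h' q' : (h', q') <> (h, q) -> (h', q') <> (h, q.-1) \/ ~~ odd q \/ q = 1 ->
   flag m1 h' q' == 0 -> par m1 (trie h' q') = home (half_new n h.+1 h') h' q'.
  move=> ne hs f0; have := @layout_step (half_new n h) (half_new n h.+1) m m1 h q n.+1 L so1 tp1 h' q'.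
  rewrite f0; apply=> // _; rewrite /half_new ltnS; case: (ltngtP h' h) => // hh.
  subst h'; apply/esym/(home_next e) => [qq|[o q1 qq]]; first by apply: ne; rewrite qq.
  by case: hs => [[]|[/negP|]]//; [rewrite qq|lia].
case: (boolP (odd q)) => o; last first.
  apply: hwp_conseq (done_ (or_introl _)) _ => // k2 r2 m2 H2.
  apply: hwp_conseq H2 _ => k3 r3 m3 [kb w3 l3 s3]; split=> //; last exact: kept_trans (kept_rehome so1 tp1) s3.
  by move: k1b kb cc; rewrite /acost; nia.
apply: hwp_eq; [by []|sd|sd|rewrite /= ra19].
case: (eqVneq q 1) => q1.
  apply: hwp_conseq (done_ (or_intror _)) _ => // k2 r2 m2 H2.
  apply: hwp_conseq H2 _ => k3 r3 m3 [kb w3 l3 s3]; split=> //; last exact: kept_trans (kept_rehome so1 tp1) s3.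
  by move: k1b kb cc; rewrite /acost; nia.
apply: hwp_seq; apply: hwp_assign; [by []|lia|rewrite /= ra19; repeat split; lia|rewrite /= ra19].
have q3 : 2 < q by lia.
have qe : q.-1 %/ 2 = q %/ 2 by lia.
have own1 : own_slots m1.
  move=> h' q' v v0; rewrite tp1; case: ifP => [/andP[/andP[/eqP -> _] _] ev|_]; last exact: own.
  exact: home_own ev v0.
have st1 : stop m1 h q.-1.
  rewrite /stop tp1 (_ : (q.-1 == q) = false) ?andbF /=; last by lia.
  apply: (layout_stop_home L); rewrite /half_new ltnn /home.
  case: ifP => _; first by rewrite eq_sym trie_neq0.
  case: ifP => _; first by apply/eqP => /slot_trie.
  case: leqP => [l|_]; last by apply/eqP => /slot_trie.
  by move: l; nia.
have stP1 : stop m1 h.+1 (q.-1 %/ 2).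
  by rewrite qe /stop tp1 (_ : (h.+1 == h) = false) //=; lia.
apply: hwp_seq.
apply: hwp_conseq (@rehome_spec _ _ W V n.+1 (2 * h + 8) (2 * h.+1 + 8) _ m1 h q.-1 wm1 rm _ _ _ _ _ _ _ _ _ _ _ _ _) _ => //; try nia.
- by rewrite /= fra.
- by rewrite /=; lia.
- exact: stop_dep wm1 own1 st1.
- move=> x h' q' x2 /home_slot/(_ x2)[_ [_ [[_ q2]|[_ _ pc]]]]; first by lia.
  by move: pc; rewrite qe; nia.
- move=> eh m' wm' tp; apply: stop_dep wm' (own_trie_par0 own1 tp) (stop_trie_par0 stP1 tp).
move=> k2 rb m2 [k2b frb wm2 [so2 tp2]].
have rb17 : rb 17 = h by rewrite frb //= fra.
have rb18 : rb 18 = 2 ^ h by rewrite frb //= fra.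
have rb19 : rb 19 = q.-1 by rewrite frb //=; lia.
have rb1 : rb 1 = 0 by rewrite frb //= fra.
have rb20 : rb 20 = n.+1 by rewrite frb //= fra.
have rb22 : rb 22 = 1 by rewrite frb //= fra.
have L2 : layout (half_new n h.+1) m2.
  move=> h' q'; rewrite (other_flag h' q' so2) tp2.
  have hE : half_new n h.+1 h = n.+1 by rewrite /half_new ltnSn.
  case: (eqVneq (flag m1 h' q') 0) => f0; last first.
    rewrite ifN; last first.
      by apply/negP => /andP[/andP[/eqP eh /eqP eq_]]; rewrite -eh -eq_ (negbTE f0).
    rewrite tp1 ifN; last first.
      apply/negP => /andP[/andP[/eqP eh /eqP eq_]] /eqP f1.
      by move: f0; rewrite (other_flag _ _ so1) eh eq_ f1.
    have := L h' q'; rewrite -(other_flag h' q' so1) (negbTE f0); exact.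
  case: (boolP ((h' == h) && (q' == q.-1))) => [/andP[/eqP eh /eqP eq_]|ne].
    by rewrite -eh -eq_ f0 /= eh hE.
  rewrite /=; have [[eh eq_]|nq] : (h', q') = (h, q) \/ (h', q') <> (h, q).
  - by case: (eqVneq h' h) => [->|hh]; [case: (eqVneq q' q) => [->|qq]|]; [left|right|right] => //; case; lia.
  - subst h' q'; rewrite tp1 !eqxx hE ifT //.
    by rewrite -(other_flag h q so1) f0.
  apply: L1 => //; last by rewrite f0.
  by left => -[eh eq_]; move: ne; rewrite eh eq_ !eqxx.
apply: hwp_seq; apply: hwp_assign; [by []|lia|rewrite /= rb17; repeat split; lia|rewrite /= rb17].
apply: hwp_seq; apply: hwp_assign; [by []|lia|rewrite /= rb18; repeat split; nia|rewrite /= rb18].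
apply: hwp_assign; [by []|lia|rewrite /= rb19; repeat split; lia|rewrite /= rb19].
apply: hwp_conseq (IH (q %/ 2) _ h.+1 _ m2 wm2 L2 _ _ _ _ _ _ _ _) _ => //=; try lia.
- by rewrite expnS.
- by rewrite expnS -e; nia.
move=> k3 rc m3 [kb w3 l3 s3]; split=> //; last exact: kept_trans (kept_rehome so1 tp1) (kept_trans (kept_rehome so2 tp2) s3).
by move: k1b k2b kb cc; rewrite /acost /=; nia.
Qed.
End Add.

Arguments add_leaf : simpl never.
Arguments change_key : simpl never.

Section Leaf.
Context {disp : Order.disp_t} {U : orderType disp}.
Implicit Types (m : memory U) (r : env).

Lemma iter_par_ext Lv m m' b d : forest Lv m -> (forall y, 16 %| y -> par m' y = par m y) ->
  16 %| b -> iter d (par m') b = iter d (par m) b.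
Proof.
move=> F e b16; elim: d => // d; rewrite !iterS => ->; apply: e; exact: (iter_par_al d F b16).
Qed.

Lemma under_ext Lv m m' x b : forest Lv m -> (forall y, 16 %| y -> par m' y = par m y) ->
  16 %| b -> under m' x b <-> under m x b.
Proof.
by move=> F e b16; split=> -[d <-]; exists d; rewrite (iter_par_ext d F e b16).
Qed.

(* [item] may change at the exempted leaf [c], on whose chain [good] is then not claimed. *)
Lemma wfm_item W n m c v : wfm W n m -> v <> None ->
  let m' := Memory (word m) (upd (item m) c v) in
  forest (leaf n) m' /\ forall x, node x -> ~ under m x c -> good (leaf n) m' x.
Proof.
move=> [F B G L C] vn m'; split.
  case: (F) => *; constructor => //.
  by move=> x Lx; have [nx k0 it] := f_lv F Lx; split=> //=; case: ifP.
move=> x nx nu; have [g0 g1 g2] := G x nx; split=> //.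
move: g2; rewrite -[mn m' x]/(mn m x); case: ifP => // _ [Lb ub H]; split=> //.
have ne b : under m x b -> (b == c) = false.
  by move=> u; apply/eqP => e; apply: nu; rewrite -e.
by move=> b Lb' ub' /=; rewrite (ne _ ub) (ne _ ub'); apply: H.
Qed.

Lemma wfm_item0 W n m v : wfm W n m -> v <> None ->
  wfm W n (Memory (word m) (upd (item m) 0 v)).
Proof.
move=> wm vn; have [F G] := wfm_item 0 wm vn; case: wm => F0 B0 G0 L0 C0; split=> //.
by move=> x nx; apply: G => // u; move: nx; rewrite (under0 F0 u).
Qed.

(** Words 2 and 6 are the minimum and the parent of the null node, which [forest] keeps at 0. *)
Lemma wfm_write W n m y v : wfm W n m -> y != 2 -> y != 6 -> v + 16 <= W ->
  (y < 16) || other_field (y %% 16) -> wfm W n (wr m y v).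
Proof.
move=> [F B G L C] y2 y6 vW yf; set m' := wr m y v.
have wE x f : node x -> f \in [:: 0; 1; 2; 4; 5; 6; 9] -> word m' (x + f) = word m (x + f).
  move=> /andP[x16 x0] fi /=; rewrite ifN //; apply/eqP.
  by move: fi yf; rewrite !inE /other_field; lia.
have parE x : 16 %| x -> par m' x = par m x.
  move=> x16; case: (eqVneq x 0) => [->|x0]; last by apply: wE => //; rewrite /node x16.
  by rewrite /par /= eq_sym (negbTE y6).
have mnE x : 16 %| x -> mn m' x = mn m x.
  move=> x16; case: (eqVneq x 0) => [->|x0]; last by apply: wE => //; rewrite /node x16.
  by rewrite /mn /= eq_sym (negbTE y2).
have kidE x s : node x -> s < 2 -> kid m' x s = kid m x s.
  by move=> nx s2; rewrite /kid -!addnA wE // !inE; lia.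
have F' : forest (leaf n) m'.
  constructor.
  - by rewrite parE // (f_par0 F).
  - by rewrite mnE // (f_mn0 F).
  - by move=> x nx; have /andP[x16 _] := nx; rewrite parE //; apply: f_alpar F _ nx.
  - by move=> x s nx s2; rewrite kidE //; apply: f_alkid F _ _ nx s2.
  - move=> x nx; have /andP[x16 _] := nx; have [d hd] := f_end F nx; exists d.
    by rewrite (iter_par_ext d F parE).
  - move=> x nx; have /andP[x16 _] := nx; rewrite parE // => px.
    have [s [s2 ks w9]] := f_up F nx px; exists s; rewrite wE // kidE //.
    by rewrite /node px (f_alpar F).
  - move=> x s nx s2; rewrite kidE // => k0; have k16 := f_alkid F nx s2.
    have nk : node (kid m x s) by rewrite /node k16.
    by rewrite parE // wE //; exact: (f_dn F nx s2 k0).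
  - move=> x Lx; have [nx k0 it] := f_lv F Lx; split=> // s s2; by rewrite kidE // k0.
split=> //.
- by move=> x /=; case: ifP => // _.
- move=> x nx; have [g0 g1 g2] := G x nx; have /andP[x16 _] := nx; split.
  + by rewrite kidE // mnE ?(f_alkid F) // -(addn0 x) wE // addn0.
  + by rewrite kidE // mnE ?(f_alkid F) // wE.
  rewrite mnE //; move: g2; case: ifP => _.
    move=> H b Lb; have [/andP[b16 _] _ _] := f_lv F Lb.
    by rewrite (under_ext _ F parE b16); apply: H.
  move=> [Lb ub H]; have [/andP[b16 _] _ _] := f_lv F Lb; split=> //.
    by rewrite (under_ext _ F parE b16).
  move=> b Lb'; have [/andP[b'16 _] _ _] := f_lv F Lb'.
  by rewrite (under_ext _ F parE b'16); apply: H.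
- by move=> x s nx s2; rewrite kidE //; apply: L.
- move=> y' y'2; rewrite parE ?al_hp // => p0 s s2; rewrite kidE //; first exact: C.
  by apply: node_hp; lia.
Qed.

Lemma wfm_field W n m h q f v : wfm W n m -> v + 16 <= W -> other_field f ->
  wfm W n (wr m (trie h q + f) v).
Proof.
move=> wm vW of_; have /andP[t16 t0] := node_trie h q.
have f16 : f < 16 by move: of_; rewrite /other_field; lia.
apply: wfm_write => //; try lia.
by rewrite (_ : (trie h q + f) %% 16 = f) ?of_ ?orbT //; lia.
Qed.

Definition fresh_mem m N v := let c := trie 0 N in
  wr (wr (Memory (upd (word m) 1 N) (upd (item m) c v)) (c + 2) c) (c + 3) N.
Arguments fresh_mem : simpl never.

Lemma fresh_word m N v x f : 16 %| x -> f < 16 ->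
  word (fresh_mem m N v) (x + f) =
  if (x == trie 0 N) && (f == 3) then N else if (x == trie 0 N) && (f == 2) then trie 0 N
  else if (x == 0) && (f == 1) then N else word m (x + f).
Proof.
move=> x16 f16; rewrite /fresh_mem /= !node_fld ?al_trie //.
by have -> : (x + f == 1) = (x == 0) && (f == 1) by rewrite -[1]/(0 + 1) node_fld.
Qed.

Lemma item_le_refl (x : option U) : x <> None -> item_le x x.
Proof. by case: x => [x|] //= _; apply: Order.POrderTheory.lexx. Qed.

(** The block of height 0 that becomes a leaf has no parent yet, so the new leaf enters only its own
    minimum. *)
Lemma wfm_fresh W n m v : wfm W n m -> v <> None -> par m (trie 0 n.+1) = 0 ->
  trie 0 n.+1 + 16 <= W -> n.+1 + 16 <= W ->
  wfm W n.+1 (fresh_mem m n.+1 v) /\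
  forall x f, node x -> 3 < f < 16 -> word (fresh_mem m n.+1 v) (x + f) = word m (x + f).
Proof.
move=> [F B G L C] vn pc cb nb; set m' := fresh_mem _ _ _; set c := trie 0 n.+1 in pc cb *.
have nc : node c by apply: node_trie.
have /andP[c16 c0] := nc.
have wE x f : node x -> 3 < f < 16 -> word m' (x + f) = word m (x + f).
  move=> /andP[x16 x0] fb; rewrite fresh_word //; last by lia.
  by rewrite (negbTE x0) !ifN // negb_and; lia.
have low x f : node x -> x != c -> f < 3 -> word m' (x + f) = word m (x + f).
  move=> /andP[x16 x0] xc fb; rewrite fresh_word //; last by lia.
  by rewrite (negbTE x0) (negbTE xc).
have parE x : 16 %| x -> par m' x = par m x.
  move=> x16; rewrite /par fresh_word // !andbF; by [].
have mnE x : 16 %| x -> x != c -> mn m' x = mn m x.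
  by move=> x16 xc; rewrite /mn fresh_word // (negbTE xc) /= andbF.
have kidE x s : node x -> s < 2 -> kid m' x s = kid m x s.
  by move=> nx s2; rewrite /kid -!addnA wE //; lia.
have kc s : s < 2 -> kid m c s = 0.
  move=> s2; apply/eqP/negPn/negP => k0; have [h' [e _ _ _]] := edge_of_trie (L _ _ nc s2 k0).
  by [].
have itE b : b != c -> item m' b = item m b by move=> bc; rewrite /m' /fresh_mem /= (negbTE bc).
have itc : item m' c = v by rewrite /m' /fresh_mem /= eqxx.
have lc : leaf n.+1 c by exists n.+1 => //; rewrite leqnn.
have lE x : leaf n.+1 x -> x = c \/ leaf n x /\ x != c.
  case=> i /andP[i0 i1] ->; case: (eqVneq i n.+1) => [->|ni]; first by left.
  by right; split; [exists i => //; lia|rewrite /c trie_eqE (negbTE ni) andbF].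
have ul x : node x -> under m x c -> x = c.
  move=> nx /underE[//|]; rewrite pc => /(under0 F) x0; by rewrite x0 in nx.
have F' : forest (leaf n.+1) m'.
  constructor.
  - by rewrite parE // (f_par0 F).
  - by rewrite mnE ?(f_mn0 F) // eq_sym.
  - by move=> x nx; have /andP[x16 _] := nx; rewrite parE //; apply: f_alpar F _ nx.
  - by move=> x s nx s2; rewrite kidE //; apply: f_alkid F _ _ nx s2.
  - move=> x nx; have /andP[x16 _] := nx; have [d hd] := f_end F nx; exists d.
    by rewrite (iter_par_ext d F parE).
  - move=> x nx; have /andP[x16 _] := nx; rewrite parE // => px.
    have [s [s2 ks w9]] := f_up F nx px; exists s; rewrite wE // kidE //.
    by rewrite /node px (f_alpar F).
  - move=> x s nx s2; rewrite kidE // => k0; have k16 := f_alkid F nx s2.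
    have nk : node (kid m x s) by rewrite /node k16.
    by rewrite parE // wE //; exact: (f_dn F nx s2 k0).
  - move=> x /lE[->|[Lx xc]].
      by split=> //; [move=> s s2; rewrite kidE // kc|rewrite itc].
    by have [nx k0 it] := f_lv F Lx; split; rewrite ?itE // => s s2; rewrite kidE // k0.
split=> //; split=> //.
- move=> x; rewrite /m' /fresh_mem /=; do 3 (case: ifP => _; [lia|]); exact: B.
- move=> x nx; have /andP[x16 x0] := nx.
  have [xc|xc] := eqVneq x c.
    rewrite xc; have [g0 g1 _] := G c nc; split.
    + rewrite kidE // kc // mnE 1?eq_sym // (f_mn0 F) eqxx.
      have := fresh_word m n.+1 v c16 (isT : 0 < 16); rewrite !addn0 /= !andbF => ->.
      by rewrite g0 kc // (f_mn0 F).
    + rewrite kidE // kc // mnE 1?eq_sym // (f_mn0 F) eqxx.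
      by rewrite fresh_word //= !andbF g1 kc // (f_mn0 F).
    have -> : mn m' c = c by rewrite /mn fresh_word //= -/c eqxx.
    rewrite (negbTE c0); split=> //; first exact: under_refl.
    move=> b /lE[->|[Lb bc]]; first by rewrite itc => _; apply: item_le_refl.
    have [/andP[b16 b0] _ _] := f_lv F Lb; rewrite (under_ext _ F parE b16).
    move=> /(under_kid F nc (_ : node b)) []; first by rewrite /node b16.
      by move=> e; rewrite e eqxx in bc.
    by case=> s s2 [ks _]; rewrite kc in ks.
  have [g0 g1 g2] := G x nx.
  have kxc s : s < 2 -> kid m x s != c.
    move=> s2; apply/eqP => e; have k0 : kid m x s != 0 by rewrite e.
    by have [e' _] := f_dn F nx s2 k0; move: x0; rewrite -e' e pc.
  split.
  + by rewrite kidE // mnE ?(f_alkid F) ?kxc //; have := low x 0 nx xc isT; rewrite !addn0 => ->.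
  + by rewrite kidE // mnE ?(f_alkid F) ?kxc // low.
  rewrite mnE //; move: g2; case: ifP => _.
    move=> H b /lE[->|[Lb bc]].
      by rewrite (under_ext _ F parE c16) => /(ul x nx) e; rewrite e eqxx in xc.
    have [/andP[b16 _] _ _] := f_lv F Lb.
    by rewrite (under_ext _ F parE b16); apply: H.
  move=> [Lb ub H]; have [/andP[b16 b0] _ _] := f_lv F Lb.
  have bc : mn m x != c.
    by apply/eqP => e; move: ub; rewrite e => /(ul x nx) e'; rewrite e' eqxx in xc.
  split.
  + by case: Lb => i ib ->; exists i => //; lia.
  + by rewrite (under_ext _ F parE b16).
  move=> b /lE[->|[Lb' bc']].
    by rewrite (under_ext _ F parE c16) => /(ul x nx) e; rewrite e eqxx in xc.
  have [/andP[b'16 _] _ _] := f_lv F Lb'.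
  by rewrite (under_ext _ F parE b'16) !itE //; apply: H.
- by move=> x s nx s2; rewrite kidE //; apply: L.
- move=> y' y'2; rewrite parE ?al_hp // => p0 s s2; rewrite kidE //; first exact: C.
  by apply: node_hp; lia.
Qed.

Lemma add_leaf_spec W V n r m x : wfm W n m -> layout (fun=> n) m ->
  (forall q, flag m 0 q = 0) -> room W V -> 16 * n + 100 <= V -> r 1 = 0 ->
  word m 1 = n -> item m 0 = Some x ->
  hwp W add_leaf (fun k r' m' =>
    [/\ k <= 100 * (100 * carry_cost 0 n.+2) + 100, wfm W n.+1 m', layout (fun=> n.+1) m' &
     [/\ word m' 0 = 96, word m' 1 = n.+1 /\ word m' 3 = word m 3,
       forall h q, flag m h q != 0 -> par m' (trie h q) = par m (trie h q),
       forall y, item m' y = if y == trie 0 n.+1 then Some x else item m y &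
      forall y f, 16 %| y -> y != 0 -> other_field f ->
        word m' (y + f) = if (y == trie 0 n.+1) && (f == 3) then n.+1 else word m (y + f)]]) r m.
Proof.
move=> wm L fl0 rm Vb r1 w1 i0; have W100 := room_W rm; have B := w_bounded wm.
have tb : trie 0 n.+1 + 200 <= W by apply: (trie_bound rm); lia.
have pc : par m (trie 0 n.+1) = 0.
  have := L 0 n.+1; rewrite fl0 eqxx => ->; apply: home_incomplete; by rewrite expn0; lia.
have sx : Some x <> None by [].
have cb : trie 0 n.+1 + 16 <= W by lia.
have nb : n.+1 + 16 <= W by lia.
have [wm1 w1E] := wfm_fresh wm sx pc cb nb.
set m1 := fresh_mem _ _ _ in wm1 w1E.
have L1 : layout (half_new n 0) m1.
  move=> h q; have := L h q; rewrite /flag w1E ?node_trie // -/(flag m h q).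
  by rewrite /par w1E ?node_trie // -/(par m (trie h q)) /half_new ltn0.
rewrite /add_leaf; apply: hwp_seq.
have nl : hwp W new_leaf (fun k r' m' => [/\ k <= 40, m' = m1, r' 1 = 0 & r' 20 = n.+1]) r m.
  rewrite /new_leaf; apply: hwp_seq; apply: hwp_assign; [by []|lia|rewrite /= w1; repeat split; lia|rewrite /= w1 (addn1 n)].
  sto; apply: hwp_seq; apply: hwp_assign; [by []|lia| |].
    by apply: safe_trie => //=; lia.
  rewrite eval_trie /=; apply: hwp_seq; apply: hwp_copy; [by []|sd|sd|rewrite /= i0].
  by sto; apply: hwp_store; [by []|sd|sd|rewrite /=; split].
apply: hwp_conseq nl _ => k1 ra _ [k1b -> a1 a20].
asg; asg; apply: hwp_seq; apply: hwp_assign; [by []|lia|rewrite /= a20; lia|rewrite /= a20].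
asg; apply: hwp_seq.
apply: hwp_conseq (@add_loop _ _ W V n _ m1 0 n.+1 _ _ _ _ _ _ _ _ _ _ _ _) _ => //.
  by rewrite expn0 muln1.
move=> k2 rb m2 [k2b wm2 L2 [[so1 so2 so3] kp]].
apply: hwp_store; [by []|sd|sd|rewrite /=].
split.
- by move: k1b k2b; rewrite /acost /=; lia.
- by apply: wfm_write => //; lia.
- move=> h q; have /andP[t16 t0] := node_trie h q; have := L2 h q; rewrite /flag /par /=.
  have E f : (trie h q + f == 0) = false by lia.
  by rewrite !E.
have h16 y : y < 16 -> word m2 y = if y == 1 then n.+1 else word m y.
  move=> y16; rewrite so2 //; have := @fresh_word m n.+1 (Some x) 0 y (dvdn0 16) y16.
  by rewrite add0n ![0 == _]eq_sym (negbTE (trie_neq0 _ _)) eqxx.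
split=> //=.
- by rewrite !h16.
- move=> h q f; have /andP[t16 t0] := node_trie h q; rewrite {1}/par /= ifN; last by lia.
  rewrite -/(par m2 (trie h q)) kp; first by rewrite /par w1E ?node_trie.
  by rewrite /flag w1E ?node_trie.
- by move=> y; rewrite so3.
move=> y f y16 y0 of_; rewrite ifN; last by lia.
rewrite so1 // fresh_word //; last by move: of_; rewrite /other_field; lia.
rewrite (negbTE y0) /=; case: ifP => // _; rewrite ifN //.
by rewrite negb_and; move: of_; rewrite /other_field; lia.
Qed.

(** A leaf is the only leaf below itself, so its own words stay correct and the repair starts at its
    parent. *)
Lemma change_key_spec W V n d r m x i : wfm W n m -> room W V -> n <= V -> r 1 = 0 ->
  r 0 = i -> 0 < i <= n -> item m 0 = Some x -> iter d (par m) (trie 0 i) = 0 ->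
  hwp W change_key (fun k r' m' =>
    [/\ k <= 70 * d + 100, wfm W n m', same_shape (Memory (word m) (item m')) m' &
     (forall y, word (Memory (word m) (item m')) y = word m y) /\
     (forall y, item m' y = if y == trie 0 i then Some x else item m y)]) r m.
Proof.
move=> wm rm nV r1 r0 ib i0 hd; have W100 := room_W rm.
have tb : trie 0 i + 200 <= W by apply: (trie_bound rm); lia.
have sx : Some x <> None by [].
have [F1 G1] := wfm_item (trie 0 i) wm sx.
case: (wm) => F B G L C.
set m1 := Memory (word m) (upd (item m) (trie 0 i) (Some x)) in F1 G1.
rewrite /change_key; apply: hwp_seq; apply: hwp_assign; [by []|lia| |].
  by apply: safe_trie => //=; rewrite ?r0 //; lia.
rewrite eval_trie /= r0; apply: hwp_seq; apply: hwp_copy; [by []|sd|sd|rewrite /= i0 -/m1].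
apply: hwp_seq; apply: hwp_assign; [by []|lia|sd|rewrite /= -/(par m (trie 0 i))].
have nt := node_trie 0 i; have p16 : 16 %| par m (trie 0 i) by apply: f_alpar F _ nt.
have d0 : 0 < d.
  by case: d hd => // /eqP; rewrite /= (negbTE (trie_neq0 _ _)).
apply: hwp_conseq (@fixup_spec _ _ W _ d.-1 _ m1 (par m (trie 0 i)) F1 _ _ _ _ _ p16 _ _ _) _ => //=; try lia.
- by have := B (trie 0 i + 6); rewrite /par.
- move=> Lp; have [/andP[_ p0] kz _] := f_lv F Lp.
  have [s [s2 ks _]] := f_up F nt p0; by have := trie_neq0 0 i; rewrite -ks kz.
- by have := hd; rewrite -(prednK d0) iterSr.
- move=> y ny nu; have /andP[y16 y0] := ny; have [ey|yt] := eqVneq y (trie 0 i).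
    have [g0 g1 g2] := G y ny; rewrite ey in g0 g1 g2 *.
    have kz s : s < 2 -> kid m (trie 0 i) s = 0.
      move=> s2; apply/eqP/negPn/negP => k0; by have [h' [e _ _ _]] := edge_of_trie (L _ _ nt s2 k0).
    have lt : leaf n (trie 0 i) by exists i.
    split=> //; rewrite -[mn m1 _]/(mn m (trie 0 i)).
    move: g2; case: (mn m (trie 0 i) == 0); first by move=> /(_ _ lt)[]; apply: under_refl.
    have one b : leaf n b -> under m (trie 0 i) b -> b = trie 0 i.
      move=> Lb ub; have [nb _ _] := f_lv F Lb.
      have [//|[s s2 [ks _]]] := (under_kid F nt nb).1 ub; by rewrite kz in ks.
    move=> [Lb ub H]; split=> // b Lb' ub'.
    by rewrite (one _ Lb ub) (one _ Lb' ub') /= eqxx /= Order.POrderTheory.lexx.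
  apply: G1 => // /underE[e|//]; by rewrite e eqxx in yt.
move=> k r' m' [kb fr sh bm gm]; have [sh1 sh2] := sh; split.
- by move: kb; rewrite /acost /=; lia.
- split=> //; first exact: shape_forest F1 sh.
  + by move=> y s ny s2; have /andP[y16 _] := ny; rewrite (shape_kid sh) //; apply: L.
  + move=> y y2; rewrite (shape_par sh) ?al_hp // => py s s2.
    by rewrite (shape_kid sh) ?al_hp //; apply: C.
- by split.
by split=> // y; rewrite sh2.
Qed.

End Leaf.

(** * Hung blocks *)

(** Here [radius k] is X_k, [epo k] is X_(k+1), and [2 ^ lev k] is X_(k+2). One level up, [lev]
    doubles and [epo] is squared, which the program can do without logarithms. *)
Definition radius k := 2 ^ 2 ^ k.
Definition lev k := 4 * 2 ^ k.
Definition epo k := radius k.+1.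
Definition bk k x := x %/ 2 ^ lev k.
Arguments lev : simpl never.
Arguments epo : simpl never.
Arguments bk : simpl never.
Arguments radius : simpl never.

Lemma radiusS k : radius k.+1 = radius k * radius k.
Proof. by rewrite /radius expnS mul2n -addnn expnD. Qed.
Lemma radius_ge2 k : 2 <= radius k.
Proof. by rewrite /radius -{1}(expn1 2) leq_exp2l // expn_gt0. Qed.
Lemma epo_ge4 k : 4 <= epo k.
Proof. by rewrite /epo radiusS; have := radius_ge2 k; nia. Qed.
Lemma levS k : lev k.+1 = 2 * lev k. Proof. by rewrite /lev expnS; lia. Qed.
Lemma epoS k : epo k.+1 = epo k * epo k. Proof. exact: radiusS. Qed.
Lemma exp_lev k : 2 ^ lev k = epo k * epo k.
Proof.
by rewrite /epo !radiusS /radius /lev !mulnA -!expnD; congr (2 ^ _); lia.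
Qed.
Lemma lev_gt0 k : 3 < lev k.
Proof. by rewrite /lev; have := expn_gt0 2 k; lia. Qed.
Lemma lev_inj k k' : lev k = lev k' -> k = k'.
Proof. by rewrite /lev => /eqP; rewrite eqn_pmul2l // eqn_exp2l // => /eqP. Qed.

Lemma bkS k x : bk k.+1 x = bk k x %/ 2 ^ lev k.
Proof. by rewrite /bk levS mul2n -addnn expnD divnMA. Qed.
Lemma epo_divS k s : s %/ epo k.+1 = s %/ epo k %/ epo k.
Proof. by rewrite epoS divnMA. Qed.

Lemma bk_le k k' x : k <= k' -> bk k x = 0 -> bk k' x = 0.
Proof. by move=> /subnK <-; elim: (k' - k) => //= j IH /IH; rewrite addSn bkS => ->; rewrite div0n. Qed.
Lemma bk_eq_le k k' x y : k <= k' -> bk k x = bk k y -> bk k' x = bk k' y.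
Proof. by move=> /subnK <-; elim: (k' - k) => //= j IH /IH; rewrite addSn !bkS => ->. Qed.
Lemma epo_eq_le k k' x y : k <= k' -> x %/ epo k = y %/ epo k -> x %/ epo k' = y %/ epo k'.
Proof. by move=> /subnK <-; elim: (k' - k) => //= j IH /IH; rewrite addSn !epo_divS => ->. Qed.

Lemma bk0 x : bk x x = 0.
Proof.
rewrite /bk divn_small // (leq_trans (ltn_expl x (isT : 1 < 2))) // leq_exp2l //.
by rewrite /lev; have := ltn_expl x (isT : 1 < 2); lia.
Qed.

Lemma leq_divS B x y : 0 < B -> x <= y + B -> x %/ B <= (y %/ B).+1.
Proof. by move=> B0 /(leq_div2r B); rewrite divnDr // divnn B0 addn1. Qed.

Section History.
Variable a : nat -> nat.

(** The access falls into block [q] or a neighbour of it. Accesses to block 0 do not count, since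
    leaves in the blocks 0 and 1 are shallow anyway. *)
Definition touched k q s := [&& 0 < bk k (a s), bk k (a s) <= q.+1 & q <= (bk k (a s)).+1].

(* [e] is one more than the last epoch, of length [L], holding a time before [t] that satisfies
   [P], and [0] if there is none. *)
Definition lastep t L (P : pred nat) e :=
  (forall s, s < t -> P s -> s %/ L < e) /\
  (0 < e -> exists s, [/\ s < t, P s & (s %/ L).+1 = e]).

Lemma lastep_ex t L P : exists e, lastep t L P e.
Proof.
elim: t => [|t [e [h1 h2]]]; first by exists 0; split.
case: (boolP (P t)) => Pt; last first.
  exists e; split=> [s|/h2[s [st Ps <-]]]; last by exists s; split=> //; lia.
  by rewrite ltnS leq_eqVlt => /orP[/eqP ->|/h1//]; rewrite (negbTE Pt).
exists (maxn e (t %/ L).+1); split=> [s|_].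
  rewrite ltnS leq_eqVlt => /orP[/eqP -> _|st Ps]; first by lia.
  by have := h1 s st Ps; lia.
case: (leqP e (t %/ L).+1) => l; first by exists t; split=> //; lia.
have e0 : 0 < e by exact: leq_ltn_trans l.
have [s [st Ps se]] := h2 e0; exists s; split=> //; first exact: ltnW.
Qed.

Lemma lastep_uniq t L P e e' : lastep t L P e -> lastep t L P e' -> e = e'.
Proof.
move=> [h1 h2] [h1' h2']; apply/eqP; rewrite eqn_leq; apply/andP; split.
  by case: (posnP e) => [->//|/h2[s [st Ps <-]]]; apply: h1'.
by case: (posnP e') => [->//|/h2'[s [st Ps <-]]]; apply: h1.
Qed.

Lemma lastep_step t L (P : pred nat) e : lastep t L P e ->
  (P t -> exists2 s, s < t & P s /\ s %/ L = t %/ L) -> lastep t.+1 L P e.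
Proof.
move=> [h1 h2] H; split=> [s|/h2[s [st Ps <-]]]; last by exists s; split=> //; lia.
rewrite ltnS leq_eqVlt => /orP[/eqP ->|/h1//] /H[s' s't [Ps <-]]; exact: h1.
Qed.

Lemma lastep_now t L (P : pred nat) : P t -> lastep t.+1 L P (t %/ L).+1.
Proof.
move=> Pt; split=> [s st _|_]; last by exists t.
by rewrite ltnS; apply: leq_div2r; lia.
Qed.

Lemma lastep_bound t L P e : lastep t L P e -> e <= (t %/ L).+1.
Proof.
case=> _ h; case: (posnP e) => [->//|/h[s [st _ <-]]].
by rewrite ltnS; apply: leq_div2r; lia.
Qed.

(* [T] is the last epoch of level [k] with an access outside block 0. *)
Definition top_epoch t k T :=
  (forall s, s < t -> 0 < bk k (a s) -> s %/ epo k <= T) /\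
  (0 < T -> exists s, [/\ s < t, 0 < bk k (a s) & s %/ epo k = T]).

Lemma top_epoch_le t k T : top_epoch t k T -> T <= t %/ epo k.
Proof.
case=> _ h; case: (posnP T) => [->//|/h[s [st _ <-]]].
by apply: leq_div2r; lia.
Qed.

(** Blocks that are equal or adjacent lie in blocks of the next level that are equal or adjacent;
    the only way to fail is an access that falls into block 0 there. *)
Lemma touched_up k q s : touched k q s ->
  (q %/ 2 ^ lev k <= 1) || touched k.+1 (q %/ 2 ^ lev k) s.
Proof.
case/and3P=> b0 b1 b2; have B0 := expn_gt0 2 (lev k); rewrite /touched bkS.
set c := bk k (a s) in b0 b1 b2 *; set B := 2 ^ lev k in B0 *.
have l1 : q %/ B <= (c %/ B).+1.
  by apply: leq_divS => //; lia.
have l2 : c %/ B <= (q %/ B).+1.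
  by apply: leq_divS => //; lia.
rewrite l1 l2 !andbT; case: (posnP (c %/ B)) => [e|_]; rewrite ?orbT //.
by rewrite e in l1; rewrite l1.
Qed.

End History.

Section Levels.
Context {disp : Order.disp_t} {U : orderType disp}.
Implicit Types (m : memory U) (r : env) (a : nat -> nat).

(* Word 8 of a block is one more than the last epoch with an access to it. The hung blocks of level
   [k] form two lists, by the parity of the epoch plus one; words 11 to 14 of block 0 of that height
   hold their lengths [cnt] and epochs plus one [le_], and word 15 holds [epo k], which spares
   the computation of square roots. *)
Definition stamp m h q := word m (trie h q + 8).
Definition qname m h q := word m (trie h q + 10).
Definition cnt m k s := word m (trie (lev k) 0 + (11 + s)).
Definition le_ m k s := word m (trie (lev k) 0 + (13 + s)).
Definition tab m k := word m (trie (lev k) 0 + 15).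
(** Two runs of [3 * epo k] slots, one for each list, after the two slots reserved for [home]. *)
Definition pool k s i := slot (lev k) (2 + s * (3 * epo k) + i).

(* [tq q] is the time up to which the hanging of block [q] has been brought; it varies with [q] only
   while the three blocks around an access are being hung. *)
Definition blocks a (tq : nat -> nat) cf k m := forall q, flag m (lev k) q != 0 ->
  qname m (lev k) q = q /\ exists s i, [/\ s < 2, i < cf s,
    par m (trie (lev k) q) = pool k s i &
    lastep (tq q) (epo k) (touched a k q) (le_ m k s)].

(** As [e] is one more than an epoch, these are the blocks touched in epoch [T - 1] or later.
    Measuring from the last active epoch [T] and not from the present lets an idle level keep its
    lists. *)
Definition revs a (tq : nat -> nat) T k m := forall q e,
  lastep (tq q) (epo k) (touched a k q) e -> 0 < e -> T <= e -> flag m (lev k) q != 0.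

Definition stamps a t k m := forall q, 0 < q ->
  lastep t (epo k) (fun s => bk k (a s) == q) (stamp m (lev k) q).

(** Each time step of the epoch of a list adds at most three entries, so a list fits into its part
    of the pool. A level with a nonempty list has [2 ^ lev k <= n], so large levels carry no
    potential. *)
Definition lists t n k m := forall s, s < 2 ->
  [/\ cnt m k s <= 3 * minn (epo k) (t - (le_ m k s).-1 * epo k),
      le_ m k s <= (t %/ epo k).+1,
      0 < le_ m k s -> le_ m k s %% 2 = s &
      0 < cnt m k s -> 0 < le_ m k s /\ 2 ^ lev k <= n].

Definition tops T k m := forall s, s < 2 -> 0 < cnt m k s -> T <= le_ m k s.

Definition level a t n k m := exists T, top_epoch a t k T /\
  [/\ blocks a (fun=> t) (cnt m k) k m, revs a (fun=> t) T k m, stamps a t k m, lists t n k m & tops T k m].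

Definition same_level k m m' :=
  [/\ forall q, par m' (trie (lev k) q) = par m (trie (lev k) q) &
      forall q f, other_field f -> word m' (trie (lev k) q + f) = word m (trie (lev k) q + f)].

Lemma same_level_trans k m m' m'' : same_level k m m' -> same_level k m' m'' -> same_level k m m''.
Proof.
move=> [h1 h2] [h1' h2']; split=> [q|q f o]; first by rewrite h1' h1.
by rewrite h2' // h2.
Qed.

Definition same_fields k m m' :=
  forall q f, other_field f -> word m' (trie (lev k) q + f) = word m (trie (lev k) q + f).

Lemma same_fields_views k m m' : same_fields k m m' ->
  [/\ forall q, flag m' (lev k) q = flag m (lev k) q,
      forall q, qname m' (lev k) q = qname m (lev k) q,
      forall q, stamp m' (lev k) q = stamp m (lev k) q &
      [/\ forall s, s < 2 -> cnt m' k s = cnt m k s,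
      forall s, s < 2 -> le_ m' k s = le_ m k s & tab m' k = tab m k]].
Proof.
move=> h.
have hs f s : other_field (f + s) -> word m' (trie (lev k) 0 + (f + s)) = word m (trie (lev k) 0 + (f + s)).
  exact: h.
split=> [q|q|q|]; try exact: h.
split=> [s s2|s s2|]; last exact: h.
  by apply: hs; rewrite /other_field; lia.
by apply: hs; rewrite /other_field; lia.
Qed.

Lemma same_level_fields k m m' : same_level k m m' ->
  [/\ forall q, flag m' (lev k) q = flag m (lev k) q,
      forall q, qname m' (lev k) q = qname m (lev k) q,
      forall q, stamp m' (lev k) q = stamp m (lev k) q &
      [/\ forall s, s < 2 -> cnt m' k s = cnt m k s,
      forall s, s < 2 -> le_ m' k s = le_ m k s & tab m' k = tab m k]].
Proof. by case=> _; apply: same_fields_views. Qed.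

Lemma level_kept a t n k m m' : same_fields k m m' ->
  (forall q, flag m (lev k) q != 0 -> par m' (trie (lev k) q) = par m (trie (lev k) q)) ->
  level a t n k m -> level a t n k m'.
Proof.
move=> sl pE [T [tp [bl rv st ls tps]]]; have [fE qE sE [cE lE _]] := same_fields_views sl.
exists T; split=> //; split.
- move=> q; rewrite fE => fq; have [qe [s [i [s2 ic pq le]]]] := bl q fq; split; first by rewrite qE.
  by exists s, i; rewrite cE // lE // pE.
- by move=> q e le e0 Te; rewrite fE; apply: (rv q e).
- by move=> q q0; rewrite sE; apply: st.
- by move=> s s2; rewrite cE // lE //; apply: ls.
- by move=> s s2; rewrite cE // lE //; apply: tps.
Qed.

Lemma level_frame a t n k m m' : same_level k m m' -> level a t n k m -> level a t n k m'.
Proof. by case=> hp hf; apply: level_kept. Qed.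

Lemma lists_mono t n k m t' n' : t <= t' -> n <= n' -> lists t n k m -> lists t' n' k m.
Proof.
move=> tt nn ls s s2; have [l1 l2 l3 l4] := ls s s2; split=> //.
- by apply: leq_trans l1 _; rewrite leq_mul2l /=; lia.
- by apply: leq_trans l2 _; rewrite ltnS leq_div2r.
- by move=> /l4[? ?]; split=> //; lia.
Qed.

Lemma level_n a t n n' k m : n <= n' -> level a t n k m -> level a t n' k m.
Proof.
by move=> nn [T [tp [bl rv st ls tps]]]; exists T; split=> //; split=> //; apply: lists_mono ls.
Qed.

(* At the levels the access at time [t] leaves alone, nothing is new. *)
Lemma level_stop a t n k m : level a t n k m ->
  bk k (a t) = 0 \/ (exists s, [/\ s < t, bk k (a s) = bk k (a t) & s %/ epo k = t %/ epo k]) ->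
  level a t.+1 n k m.
Proof.
move=> [T [[tp1 tp2] [bl rv st ls tps]]] hs; exists T.
have tch q e : lastep t (epo k) (touched a k q) e <-> lastep t.+1 (epo k) (touched a k q) e.
  have H : forall e, lastep t (epo k) (touched a k q) e -> lastep t.+1 (epo k) (touched a k q) e.
    move=> e' le; apply: lastep_step le _ => tc.
    case: hs => [b0|[s [st' be se]]]; first by move: tc; rewrite /touched b0.
    by exists s => //; split=> //; move: tc; rewrite /touched be.
  split; first exact: H.
  move=> h; have [e' h'] := lastep_ex t (epo k) (touched a k q).
  by rewrite (lastep_uniq h (H _ h')).
split; [split=> [s|/tp2[s [st' b0 <-]]]|split].
- rewrite ltnS leq_eqVlt => /orP[/eqP -> b0|/tp1//].
  case: hs => [b00|[s' [st' be <-]]]; first by rewrite b00 in b0.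
  by apply: tp1 => //; rewrite be.
- by exists s; split=> //; lia.
- move=> q /bl[qe [s [i [s2 ic pq le]]]]; split=> //; exists s, i; split=> //.
  by apply/tch.
- by move=> q e /tch; apply: rv.
- move=> q q0; apply: lastep_step (st q q0) _ => /eqP be.
  case: hs => [b0|[s [st' be' se]]]; first by rewrite b0 in be; rewrite -be in q0.
  by exists s => //; split=> //; apply/eqP; rewrite be'.
- by apply: lists_mono ls => //; lia.
- exact: tps.
Qed.

(** Equal blocks and equal epochs stay equal at higher levels. So the levels at which an access is
    new form an initial segment, and the upward loop may end at the first failure. *)
Lemma stop_up a t k k' : k <= k' ->
  bk k (a t) = 0 \/ (exists s, [/\ s < t, bk k (a s) = bk k (a t) & s %/ epo k = t %/ epo k]) ->
  bk k' (a t) = 0 \/ (exists s, [/\ s < t, bk k' (a s) = bk k' (a t) & s %/ epo k' = t %/ epo k']).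
Proof.
move=> kk [b0|[s [st be se]]]; first by left; apply: bk_le b0.
by right; exists s; split=> //; [apply: bk_eq_le be|apply: epo_eq_le se].
Qed.

Lemma epo_up k x y : x %/ epo k <= (y %/ epo k).+1 -> x %/ epo k.+1 <= (y %/ epo k.+1).+1.
Proof.
rewrite !epo_divS => h; have L0 := epo_ge4 k; set u := y %/ epo k in h *.
by apply: leq_divS; lia.
Qed.

(** The hung block was touched in epoch [T - 1] or later of its level, so the block around it was
    touched in the last active epoch of the next level or the one before: an access outside block 0
    there is one here too. This nesting bounds the cost of every eviction. *)
Lemma flag_up a t n k m : level a t n k m -> level a t n k.+1 m ->
  forall q, flag m (lev k) q != 0 ->
  q %/ 2 ^ lev k <= 1 \/ flag m (lev k.+1) (q %/ 2 ^ lev k) != 0.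
Proof.
move=> [T [[tp1 _] [bl _ _ ls tps]]] [T' [[_ tp2'] [_ rv' _ _ _]]] q /bl[_ [s [i [s2 ic _ [le1 le2]]]]].
have c0 : 0 < cnt m k s by lia.
have [_ _ _ /(_ c0)[l0 _]] := ls s s2; have Tl := tps s s2 c0.
have [w [wt tw we]] := le2 l0.
case/orP: (touched_up tw) => [|tw']; [by left|right].
have [e' le'] := lastep_ex t (epo k.+1) (touched a k.+1 (q %/ 2 ^ lev k)).
have we' : w %/ epo k.+1 < e' by case: (le') => h _; apply: h.
apply: (rv' _ e') => //; first by exact: leq_ltn_trans we'.
case: (posnP T') => [->//|/tp2'[w2 [w2t b0 <-]]].
apply: leq_trans we'; apply: epo_up.
have : w2 %/ epo k <= T.
  by apply: tp1 => //; apply/negPn/negP => b; move: b0; rewrite (bk_le (leqnSn k)) //; lia.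
by move=> h; apply: leq_trans h _; rewrite we.
Qed.

Lemma pool_inj k s i s' i' : s < 2 -> s' < 2 -> i < 3 * epo k -> i' < 3 * epo k ->
  pool k s i = pool k s' i' -> s = s' /\ i = i'.
Proof.
move=> s2 s'2 i3 i'3; rewrite /pool; have e4 := epo_ge4 k => /slot_inj[||_].
1,2: by rewrite exp_lev; nia.
by move: s2 s'2; case: s => [|[|]] //; case: s' => [|[|]] //; lia.
Qed.

Lemma pool_bound k s i : s < 2 -> i < 3 * epo k -> 1 < 2 + s * (3 * epo k) + i < 8 * 2 ^ lev k.
Proof. by have e4 := epo_ge4 k; rewrite exp_lev => ? ?; nia. Qed.

Lemma cnt_bound t n k m s : lists t n k m -> s < 2 -> cnt m k s <= 3 * epo k.
Proof. by move=> ls /ls[h _ _ _]; lia. Qed.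

End Levels.

Arguments stamp {disp U} m h q : simpl never.
Arguments qname {disp U} m h q : simpl never.
Arguments cnt {disp U} m k s : simpl never.
Arguments le_ {disp U} m k s : simpl never.
Arguments tab {disp U} m k : simpl never.
Arguments pool : simpl never.

(** * Evicting expired blocks *)

Definition evict_body s :=
  assign 31 (Bin Minus (Var 31) (Lit 1)) ;;
  assign 16 (Bin Plus (Bin Plus (Bin Times (Lit 8) (Var 18) +! 2)
     (Bin Times (Lit s) (Bin Times (Lit 3) (Var 26)))) (Var 31)) ;;
  assign 21 (fld (hp_expr (Bin Times (Lit 2) (Var 16))) 4) ;;
  if_eq (Var 21) (Lit 0) Skip
    (store (Var 21 +! 7) (Lit 0) ;; assign 19 (fld (Var 21) 10) ;; move_home).

(** The test amounts to [le_ < t %/ epo k]. As [le_] is one more than the epoch of the list, the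
    lists of the current and of the preceding epoch are kept. *)
Definition evict_list s :=
  if_lt (fld (Var 30) (13 + s) +! 1) (Var 27)
    (assign 31 (fld (Var 30) (11 + s)) ;;
     while_pos 35 (Var 31) (evict_body s) ;;
     store (Var 30 +! (11 + s)) (Lit 0))
    Skip.

Arguments evict_body : simpl never.
Arguments evict_list : simpl never.

(** Two complete blocks of one height with incomplete parents have the same parent, and both are
    even, because an odd block ends where its parent does. *)
Lemma home_slot_inj n h q h' q' x : x < 2 -> home n h q = slot h' x ->
  home n h q' = slot h' x -> q = q'.
Proof.
move=> x2 /home_slot/(_ x2)[_ [c1 h1]] /home_slot/(_ x2)[_ [c2 h2]].
have p0 := expn_gt0 2 h.
case: h1 h2 => [[-> ->]|[-> q1 l1]] [[e1 e2]|[e1 q2 l2]] //.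
have a1 : q < (q' %/ 2).+1 * 2.
  by rewrite -(ltn_pmul2r p0); lia.
have a2 : q' < (q %/ 2).+1 * 2.
  by rewrite -(ltn_pmul2r p0); lia.
have o (p : nat) : p.+1 * 2 ^ h <= n.+1 -> n.+1 < (p %/ 2).+1 * (2 * 2 ^ h) -> ~~ odd p.
  move=> b1 b2; apply/negP => od; suff : (p %/ 2).+1 * (2 * 2 ^ h) = p.+1 * 2 ^ h by lia.
  by rewrite mulnA; congr (_ * _); lia.
have : ~~ odd q by apply: (o q).
have : ~~ odd q' by apply: (o q').
lia.
Qed.

Lemma home_pool n h q h' x : home n h q = slot h' x -> x < 8 * 2 ^ h' -> x < 2.
Proof.
have p0 := expn_gt0 2 h; have p1 := expn_gt0 2 h'.
rewrite /home => + xb; case: ifP => [_ e|_]; first by have := slot_neq0 h' x; rewrite -e.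
have sl y : y < 2 -> slot h y = slot h' x -> x < 2.
  by move=> y2 es; have yb : y < 8 * 2 ^ h by [lia]; have [_ <-] := slot_inj yb xb es.
case: ifP => _; first exact: sl.
by case: ifP => _; [move=> e; case: (slot_trie (esym e))|exact: sl].
Qed.

Section Evict.
Context {disp : Order.disp_t} {U : orderType disp}.
Implicit Types (m : memory U) (r : env) (a : nat -> nat).

(* Everything but the hoisting of blocks of level [k] is unchanged. *)
Definition same_but k m m' :=
  [/\ forall h q f, other_field f -> (h == lev k) && (f == 7) = false ->
        word m' (trie h q + f) = word m (trie h q + f),
      forall h q, h != lev k -> par m' (trie h q) = par m (trie h q),
      forall y, y < 16 -> word m' y = word m y & item m' = item m].

Lemma same_but_trans k m m' m'' : same_but k m m' -> same_but k m' m'' -> same_but k m m''.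
Proof.
move=> [a b c d] [a' b' c' d']; split=> [h q f of_ hf|h q hk|y y16|].
- by rewrite a' ?a. - by rewrite b' ?b. - by rewrite c' ?c. - by rewrite d' d.
Qed.

Lemma same_but_level k k' m m' : same_but k m m' -> k' != k -> same_level k' m m'.
Proof.
move=> [a b _ _] kk; have hk : lev k' != lev k by apply: contraNneq kk => /lev_inj ->.
by split=> [q|q f of_]; [apply: b|apply: a => //; rewrite (negbTE hk)].
Qed.

Definition covered k m := forall q, flag m (lev k) q != 0 ->
  q %/ 2 ^ lev k <= 1 \/ flag m (lev k.+1) (q %/ 2 ^ lev k) != 0.

Lemma stop_small n m h q : layout (fun=> n) m -> q <= 1 -> stop m h q.
Proof.
move=> L q1; apply: (layout_stop_home L); rewrite /home.
case: ifP => [_|/negbT]; first by rewrite eq_sym trie_neq0.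
rewrite negb_or => /andP[q0 _].
by rewrite (_ : (q == 1) = true); [apply/eqP => /slot_trie|lia].
Qed.

Lemma stop_cover n m k q : layout (fun=> n) m ->
  q %/ 2 ^ lev k <= 1 \/ flag m (lev k.+1) (q %/ 2 ^ lev k) != 0 ->
  stop m (lev k + lev k) (q %/ 2 ^ lev k).
Proof.
move=> L; rewrite addnn -mul2n -levS => -[q1|fl]; first exact: stop_small L q1.
exact: layout_stop_flag L fl.
Qed.

Lemma flag_write m h q f v h' q' : other_field f ->
  flag (wr m (trie h q + f) v) h' q' = if (h' == h) && (q' == q) && (f == 7) then v else flag m h' q'.
Proof.
move=> of_; rewrite /flag /= node_fld ?al_trie //; last by move: of_; rewrite /other_field; lia.
by rewrite trie_eqE [7 == f]eq_sym.
Qed.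

Lemma par_write m h q f v y : other_field f -> 16 %| y -> par (wr m (trie h q + f) v) y = par m y.
Proof.
move=> of_ y16; rewrite /par /= node_fld ?al_trie //; last by move: of_; rewrite /other_field; lia.
by rewrite ifN // negb_and; move: of_; rewrite /other_field; lia.
Qed.

Lemma field_write m h q f v h' q' f' : other_field f -> f' < 16 ->
  word (wr m (trie h q + f) v) (trie h' q' + f') =
  if (h' == h) && (q' == q) && (f' == f) then v else word m (trie h' q' + f').
Proof.
move=> of_ f16; rewrite /= node_fld ?al_trie ?trie_eqE //.
by move: of_; rewrite /other_field; lia.
Qed.

Lemma stop_write m h q f v h' q' : other_field f -> stop (wr m (trie h q + f) v) h' q' = stop m h' q'.
Proof. by move=> of_; rewrite /stop par_write ?al_trie. Qed.

Definition evicts k s j m m' := 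
  (forall q, (flag m' (lev k) q = flag m (lev k) q /\ par m' (trie (lev k) q) = par m (trie (lev k) q)) \/
     [/\ flag m' (lev k) q = 0, flag m (lev k) q != 0 &
        exists2 i, i < j & par m (trie (lev k) q) = pool k s i]) /\
  (forall q i, i < j -> flag m (lev k) q != 0 -> par m (trie (lev k) q) = pool k s i ->
     flag m' (lev k) q = 0).

Definition evict_vars := [:: 35; 31; 21; 19; 2; 3; 4; 5; 6; 7; 8; 9; 10; 11; 12; 13; 14; 15; 16].

Lemma evict_body_spec W V n r m k s j : wfm W n m -> layout (fun=> n) m -> room W V ->
  covered k m -> (forall q, flag m (lev k) q != 0 -> qname m (lev k) q = q /\
     (q + 2) * 2 ^ lev k <= V) ->
  s < 2 -> j < 3 * epo k -> r 1 = 0 -> r 17 = lev k -> r 18 = 2 ^ lev k -> r 20 = n ->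
  r 26 = epo k -> r 31 = j.+1 -> 32 * 2 ^ lev k + 32 <= V -> n + 2 <= V ->
  hwp W (evict_body s) (fun c r' m' => [/\ c <= 100 * (20 * lev k + 50),
    frame evict_vars r r' /\ r' 31 = j,
    wfm W n m' /\ layout (fun=> n) m', same_but k m m' &
    (forall q, flag m (lev k) q != 0 /\ par m (trie (lev k) q) = pool k s j /\ flag m' (lev k) q = 0 \/
      [/\ ~ (flag m (lev k) q != 0 /\ par m (trie (lev k) q) = pool k s j),
       flag m' (lev k) q = flag m (lev k) q & par m' (trie (lev k) q) = par m (trie (lev k) q)])]) r m.
Proof.
move=> wm L rm cov qn s2 j3 r1 r17 r18 r20 r26 r31 b1 b2; have W100 := room_W rm.
have e4 := epo_ge4 k; have pB := pool_bound s2 j3; have h4 := lev_gt0 k.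
have hl : lev k < 2 ^ lev k by exact: ltn_expl.
set H := lev k in cov qn r17 r18 b1 pB h4 hl *.
have p0 := expn_gt0 2 H; set x := 2 + s * (3 * epo k) + j in pB.
have sE : s * (3 * epo k) <= x by rewrite /x; lia.
have eE : 3 * epo k <= 8 * 2 ^ H by rewrite /H exp_lev; nia.
rewrite /evict_body; apply: hwp_seq; apply: hwp_assign; [by []|lia|rewrite /= r31; repeat split; lia|rewrite /= r31 subn1 /=].
apply: hwp_seq; apply: hwp_assign; [by []|lia| |rewrite /= r18 r26].
  by rewrite /= r18 r26; repeat split; rewrite /= ?r18; lia.
have vE : 8 * 2 ^ H + 2 + s * (3 * epo k) + j = 8 * 2 ^ H + x by rewrite /x; lia.
rewrite vE; have hb : hp (2 * (8 * 2 ^ H + x)) + 200 <= W by apply: (hp_bound rm); lia.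
apply: hwp_seq; apply: hwp_assign; [by []|lia| |].
  split; [|rewrite /=; lia|].
    apply: safe_hp; rewrite ?eval_hp /=; [repeat split; lia|exact: hb].
  by rewrite -[X in X < _]/(hp (2 * (8 * 2 ^ H + x)) + 4); lia.
set ra := upd _ 21 _; have ra21 : ra 21 = kid m (slot H x) 0.
  by rewrite /ra /kid addn0.
have fra : frame evict_vars r ra.
  apply: (@frame_updl _ _ _ 31 j) => //.
  by apply: (@frame_updl _ _ _ 16 (8 * 2 ^ H + x)) => //; apply: frame_upd.
have ra31 : ra 31 = j by [].
have ra1 : ra 1 = 0 by [].
have ra17 : ra 17 = H by [].
have ra18 : ra 18 = 2 ^ H by [].
have ra20 : ra 20 = n by [].
have ac : acost (fld (hp_expr (Bin Times (Lit 2) (Var 16))) 4) <= 40 by [].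
set w := acost _ in ac *.
move: ra ra21 fra ra31 ra1 ra17 ra18 ra20 => ra ra21 fra ra31 ra1 ra17 ra18 ra20.
have x1 : ~ x < 2 by lia.
have v0 : 0 < 8 * 2 ^ H + x by lia.
have ns : node (slot H x) by apply: node_hp; lia.
have kidE : kid m (slot H x) 0 = 0 \/ exists q, kid m (slot H x) 0 = trie H q /\
   flag m H q != 0 /\ par m (trie H q) = slot H x.
  case: (eqVneq (kid m (slot H x) 0) 0) => k0; [by left|right].
  have [pk _] := f_dn (w_forest wm) ns (isT : 0 < 2) k0.
  have [[[h [q ex]] _]|[y' [y'2 ey es ex]]] := edge_of_hp (w_legal wm ns (isT : 0 < 2) k0); last first.
    by move: ey es; rewrite /pr /pr_side; case: ifP => //; lia.
  rewrite ex in pk; have := L h q; case: ifP => fl.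
    by rewrite pk => /esym/home_pool; lia.
  case=> x' /andP[_ xb']; rewrite pk => es.
  have xb : x < 8 * 2 ^ H by lia.
  have [eh exx] := slot_inj xb xb' es.
  by subst h; exists q; rewrite ex fl.
apply: hwp_eq; [by []|sd|sd|rewrite /= ra21].
(* An empty position: a block that was hung there has been hung again at another one. *)
case: kidE => [k0|[q [kq [fq pq]]]].
  rewrite k0 /=; apply: hwp_skip; split=> //.
  - by rewrite /=; lia.
  move=> q; right; split=> // -[fq pq].
  have pn : par m (trie H q) != 0 by rewrite pq slot_neq0.
  have [t [t2 kt w9]] := f_up (w_forest wm) (node_trie H q) pn.
  have k00 : kid m (par m (trie H q)) t != 0 by rewrite kt trie_neq0.
  have := w_legal wm _ t2 k00; rewrite kt {1}pq => /(_ ns) ed.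
  case: (edge_to_trie ed) => [[v _ [_ t0]]|[_ ex _]]; last by case: (slot_trie (etrans (esym pq) ex)).
  by move: kt; rewrite t0 pq -/x k0 => t00; have := trie_neq0 H q; rewrite -t00.
rewrite kq (negbTE (trie_neq0 _ _)).
have [qnq qV] := qn q fq; have tb : trie H q + 200 <= W by apply: (trie_bound rm); nia.
have r21 : ra 21 = trie H q by rewrite ra21.
sto; rewrite r21; set m1 := wr m _ 0.
have of7 : other_field 7 by [].
have wm1 : wfm W n m1 by apply: wfm_field => //; lia.
have own1 : own_slots m1.
  by move=> h' q' v v00; rewrite par_write ?al_trie //; apply: (layout_own wm L).
have qe : word m1 (trie H q + 10) = q by rewrite /m1 field_write // andbF.
have ev : eval ra (word m1) (fld (Var 21) 10) = q by rewrite -qe -r21.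
apply: hwp_seq; apply: hwp_assign; [by []|lia|sd|rewrite ev].
apply: hwp_conseq (@move_home_spec _ _ W V n (2 * H + 8) (5 * H + 8) _ m1 H q wm1 rm _ _ _ _ _ _ _ _ _ _ _ _ _ _) _ => //; try lia.
- nia.
- by apply: (stop_dep wm1 own1); rewrite /m1 stop_write //; exact: layout_stop_flag L fq.
- move=> y h' q' y2 eh ne; rewrite par_write ?al_trie //; apply/eqP => ep.
  have := L h' q'; rewrite ep; case: ifP => _.
    move=> /esym e'; have [eh' _] := home_slot e' y2; rewrite -eh' in e' ne.
    by apply: ne; rewrite (home_slot_inj y2 eh e').
  case=> y' /andP[y'1 yb'] es; have yb : y < 8 * 2 ^ H by lia.
  by have [_ ey] := slot_inj yb yb' es; lia.
(* The parent has height [H.+1], and by [covered] its path in the trie stops at height [2 * H]: at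
   most [H - 1] links there and [4 * H + 8] in the heap. *)
- move=> eh m' wm' tp; have own' := own_trie_par0 own1 tp.
  have hE : (lev k).-1.+1 = lev k by rewrite prednK //; lia.
  have st : stop m' (H.+1 + H.-1) (q %/ 2 %/ 2 ^ H.-1).
    apply: stop_trie_par0 tp; rewrite /m1 stop_write // addSnnS /H hE -divnMA -expnS hE.
    by apply: stop_cover L _; apply: cov.
  by apply: (iter_par_ge (w_forest wm') (dep_stop wm' own' st)); lia.
move=> c rb m2 [cb frb wm2 [tp so]].
have flE h' q' : flag m2 h' q' = if (h' == H) && (q' == q) then 0 else flag m h' q'.
  by rewrite (other_flag _ _ so) flag_write // andbT.
have paE h' q' : par m2 (trie h' q') = if (h' == H) && (q' == q) then home n H q else par m (trie h' q').
  by rewrite tp par_write ?al_trie.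
split.
- by move: cb; rewrite /= /acost /=; lia.
- split; last by rewrite frb.
  move=> z zn; rewrite frb; last by apply: contraNN zn; rewrite !inE; lia.
  rewrite /= ifN ?fra //; by apply: contraNneq zn => ->.
- split=> // h' q'; rewrite flE paE; case: andP => [[/eqP -> /eqP ->]|_] //.
  exact: L.
- case: so => so1 so2 so3; split.
  + move=> h' q' f of_ hf; rewrite so1 ?al_trie // field_write //; last first.
      by move: of_; rewrite /other_field; lia.
    case: ifP => // /andP[/andP[/eqP eh _] /eqP ef].
    by move: hf; rewrite eh ef !eqxx.
  + by move=> h' q' hh; rewrite paE (negbTE hh).
  + move=> y y16; rewrite so2 // /m1 /= ifN //.
    by have /andP[? ?] := node_trie H q; lia.
  + by rewrite so3.
move=> q'; case: (eqVneq q' q) => [->|qq].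
  by left; rewrite flE !eqxx.
right; rewrite flE paE (negbTE qq) andbF; split=> // -[fq' pq'].
have pn : par m (trie H q') != 0 by rewrite pq' slot_neq0.
have [t [t2 kt w9]] := f_up (w_forest wm) (node_trie H q') pn.
have k00 : kid m (par m (trie H q')) t != 0 by rewrite kt trie_neq0.
have := w_legal wm _ t2 k00; rewrite kt {1}pq' => /(_ ns) ed.
case: (edge_to_trie ed) => [[v _ [_ t0]]|[_ ex _]]; last by case: (slot_trie (etrans (esym pq') ex)).
move: kt; rewrite t0 pq' -/x kq => /trie_inj[_ e]; by rewrite e eqxx in qq.
Qed.
End Evict.

Section EvictList.
Context {disp : Order.disp_t} {U : orderType disp}.
Implicit Types (m : memory U) (r : env) (a : nat -> nat).

Definition named V k m := forall q, flag m (lev k) q != 0 -> qname m (lev k) q = q /\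
     (q + 2) * 2 ^ lev k <= V.

Lemma same_but_flag k k' m m' q : same_but k m m' -> k' != k ->
  flag m' (lev k') q = flag m (lev k') q.
Proof. by move=> /same_but_level h /h/same_level_fields[-> _]. Qed.

Lemma same_but_qname k m m' h q : same_but k m m' -> qname m' h q = qname m h q.
Proof. by case=> hf _ _ _; apply: hf => //; rewrite andbF. Qed.

Lemma covered_sub k m m' : same_but k m m' ->
  (forall q, flag m' (lev k) q != 0 -> flag m (lev k) q != 0) -> covered k m -> covered k m'.
Proof.
move=> sb sub cov q /sub/cov[|f]; [by left|right].
by rewrite (same_but_flag _ sb) // eqn_leq ltnn.
Qed.

Lemma named_sub V k m m' : same_but k m m' ->
  (forall q, flag m' (lev k) q != 0 -> flag m (lev k) q != 0) -> named V k m -> named V k m'.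
Proof. by move=> sb sub nm q /sub/nm[qe qV]; rewrite (same_but_qname _ _ sb). Qed.

Lemma evict_loop_spec W V n r m k s j : wfm W n m -> layout (fun=> n) m -> room W V ->
  covered k m -> named V k m ->
  s < 2 -> j <= 3 * epo k -> r 1 = 0 -> r 17 = lev k -> r 18 = 2 ^ lev k -> r 20 = n ->
  r 26 = epo k -> r 31 = j -> 32 * 2 ^ lev k + 32 <= V -> n + 2 <= V ->
  hwp W (while_pos 35 (Var 31) (evict_body s)) (fun c r' m' =>
    [/\ c <= j * (100 * (20 * lev k + 51)) + 10, frame evict_vars r r',
    wfm W n m' /\ layout (fun=> n) m', same_but k m m' & evicts k s j m m']) r m.
Proof.
move=> wm L rm; have W100 := room_W rm.
elim: j r m wm L => [|j IH] r m wm L cov nm s2 j3 r1 r17 r18 r20 r26 r31 b1 b2.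
  apply: hwp_while => //; [lia|rewrite /= r31; lia|rewrite /= r31 /=].
  split=> //; first exact: frame_upd.
  by split=> // q; left.
have e4 := epo_ge4 k.
apply: hwp_while => //; [lia| |rewrite /= r31 /=].
  rewrite /= r31; have := room_W rm; rewrite /room in rm.
  by move: b1; rewrite exp_lev; nia.
apply: hwp_conseq (@evict_body_spec _ _ W V n _ m k s j wm L rm cov nm s2 j3 _ _ _ _ _ _ b1 b2) _ => //.
move=> c1 r2 m2 [c1b [fr2 r31'] [wm2 L2] sb ev].
have sub q : flag m2 (lev k) q != 0 -> flag m (lev k) q != 0.
  by case: (ev q) => [[_ [_ ->]]//|[_ -> _]].
apply: hwp_conseq (IH r2 m2 wm2 L2 (covered_sub sb sub cov) (named_sub sb sub nm) s2 _ _ _ _ _ _ _ b1 b2) _ => //.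
- lia.
- by rewrite fr2.
- by rewrite fr2.
- by rewrite fr2.
- by rewrite fr2.
- by rewrite fr2.
move=> c2 r3 m3 [c2b fr3 wl3 sb3 [ev1 ev2]]; split=> //.
- by move: c1b c2b; rewrite /acost /=; lia.
- exact: frame_comp (frame_updl _ fr2) fr3.
- exact: same_but_trans sb sb3.
split=> [q|q i ij fq pq].
  case: (ev1 q) => [[-> ->]|[f3 f2 [i ij p2]]].
    case: (ev q) => [[fq [pq ->]]|[_ -> ->]]; last by left.
    by right; split=> //; exists j.
  right; split=> //; first exact: sub.
  exists i; first by lia.
  case: (ev q) => [[_ [_ f20]]|[_ _ <-]] //.
  by rewrite f20 in f2.
case: (ev q) => [[_ [_ f2]]|[ne f2 p2]].
  case: (ev1 q) => [[-> _]//|[//]].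
have ij' : i < j.
  by move: ij; rewrite ltnS leq_eqVlt => /orP[/eqP ei|//]; case: ne; rewrite -ei.
by apply: (ev2 q i ij'); rewrite ?f2 // p2.
Qed.

Definition off k m m' :=
  [/\ forall h q f, other_field f -> h != lev k -> word m' (trie h q + f) = word m (trie h q + f),
      forall h q, h != lev k -> par m' (trie h q) = par m (trie h q),
      forall y, y < 16 -> word m' y = word m y & item m' = item m].

Lemma off_refl k m : off k m m. Proof. by []. Qed.
Lemma off_trans k m m' m'' : off k m m' -> off k m' m'' -> off k m m''.
Proof.
move=> [a b c d] [a' b' c' d']; split=> [h q f of_ hf|h q hk|y y16|].
- by rewrite a' ?a. - by rewrite b' ?b. - by rewrite c' ?c. - by rewrite d' d.
Qed.
Lemma same_but_off k m m' : same_but k m m' -> off k m m'.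
Proof. by move=> [a b c d]; split=> // h q f of_ hk; apply: a => //; rewrite (negbTE hk). Qed.
Lemma off_level k k' m m' : off k m m' -> k' != k -> same_level k' m m'.
Proof.
move=> [a b _ _] kk; have hk : lev k' != lev k by apply: contraNneq kk => /lev_inj ->.
by split=> [q|q f of_]; [apply: b|apply: a].
Qed.
Lemma off_write k m q f v : other_field f -> off k m (wr m (trie (lev k) q + f) v).
Proof.
move=> of_; split=> //.
- move=> h q' f' of' hk; rewrite field_write ?(negbTE hk) //; by move: of'; rewrite /other_field; lia.
- by move=> h q' hk; rewrite par_write ?al_trie.
- move=> y y16 /=; rewrite ifN //; have /andP[? ?] := node_trie (lev k) q; lia.
Qed.

Lemma layout_write n m h q f v : other_field f -> f != 7 -> layout (fun=> n) m ->
  layout (fun=> n) (wr m (trie h q + f) v).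
Proof.
move=> of_ f7 L h' q'; rewrite flag_write // (negbTE f7) andbF par_write ?al_trie //; exact: L.
Qed.

Definition purged k s e m m' :=
  [/\ forall q, qname m' (lev k) q = qname m (lev k) q /\ stamp m' (lev k) q = stamp m (lev k) q,
      forall s', s' < 2 -> le_ m' k s' = le_ m k s',
      forall s', s' < 2 -> cnt m' k s' = if (s' == s) && (le_ m k s < e) then 0 else cnt m k s' &
      evicts k s (if le_ m k s < e then cnt m k s else 0) m m'].

Lemma evict_list_spec W V n e r m k s : wfm W n m -> layout (fun=> n) m -> room W V ->
  covered k m -> named V k m ->
  s < 2 -> cnt m k s <= 3 * epo k -> r 1 = 0 -> r 17 = lev k -> r 18 = 2 ^ lev k -> r 20 = n ->
  r 26 = epo k -> r 27 = e.+1 -> r 30 = trie (lev k) 0 ->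
  32 * 2 ^ lev k + 32 <= V -> n + 2 <= V ->
  hwp W (evict_list s) (fun c r' m' =>
    [/\ c + (100 * (20 * lev k + 51)) * cnt m' k s <= (100 * (20 * lev k + 51)) * cnt m k s + 60,
     frame evict_vars r r',
     wfm W n m' /\ layout (fun=> n) m', off k m m' & purged k s e m m']) r m.
Proof.
move=> wm L rm cov nm s2 cb r1 r17 r18 r20 r26 r27 r30 b1 b2; have W100 := room_W rm.
have hl : lev k < 2 ^ lev k by exact: ltn_expl.
have tb : trie (lev k) 0 + 200 <= W by apply: (trie_bound rm); lia.
have bl := w_bounded wm (trie (lev k) 0 + (13 + s)); have bc := w_bounded wm (trie (lev k) 0 + (11 + s)).
rewrite /evict_list; apply: hwp_lt; [by []|rewrite /= r30; repeat split; lia|sd|rewrite /= r30 r27].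
rewrite -/(le_ m k s) (_ : (le_ m k s + 1 < e.+1) = (le_ m k s < e)); last by lia.
case: (boolP (le_ m k s < e)) => le; last first.
  apply: hwp_skip; split=> //; first by rewrite /=; lia.
  split=> // [s' _|]; first by rewrite (negbTE le) andbF.
  by rewrite (negbTE le); split=> // q; left.
apply: hwp_seq; apply: hwp_assign; [by []|lia|rewrite /= r30; repeat split; lia|rewrite /= r30].
rewrite -/(cnt m k s); apply: hwp_seq.
apply: hwp_conseq (@evict_loop_spec W V n _ m k s _ wm L rm cov nm s2 cb _ _ _ _ _ _ b1 b2) _ => //.
move=> c1 r2 m2 [c1b fr2 [wm2 L2] sb ev].
have r230 : r2 30 = trie (lev k) 0 by rewrite fr2.
have of_ : other_field (11 + s) by rewrite /other_field; lia.
apply: hwp_store; [by []|rewrite /= r230; repeat split; lia|sd|rewrite /= r230].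
set m3 := wr m2 _ 0.
have cE s' : s' < 2 -> cnt m3 k s' = if s' == s then 0 else cnt m k s'.
  move=> s'2; rewrite /m3 /cnt field_write ?eqxx ?eqn_add2l //=; last by lia.
  case: eqP => // _; case: sb => h _ _ _; rewrite h ?andbT //; first by rewrite /other_field; lia.
  by rewrite eqxx; lia.
split.
- by rewrite cE // eqxx; move: c1b; rewrite /acost /=; lia.
- exact: frame_updl fr2.
- by split; [apply: wfm_field => //; lia|apply: layout_write => //; lia].
- by apply: off_trans (same_but_off sb) _; apply: off_write.
have fw f q : f < 11 -> f != 7 -> other_field f -> word m3 (trie (lev k) q + f) = word m (trie (lev k) q + f).
  move=> f11 f7 off_; rewrite /m3 field_write //; last by lia.
  rewrite (_ : (f == 11 + s) = false) ?andbF; last by lia.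
  by case: sb => h _ _ _; rewrite h // (negbTE f7) andbF.
split.
- by move=> q; split; apply: fw.
- move=> s' s'2; rewrite /le_ /m3 field_write //; last by lia.
  rewrite (_ : (13 + s' == 11 + s) = false) ?andbF; last by lia.
  case: sb => h _ _ _; rewrite h //; first by rewrite /other_field; lia.
  by rewrite (_ : (13 + s' == 7) = false) ?andbF; lia.
- by move=> s' s'2; rewrite cE // le andbT.
rewrite le; case: ev => ev1 ev2.
have fE q : flag m3 (lev k) q = flag m2 (lev k) q.
  by rewrite /m3 flag_write // (_ : (11 + s == 7) = false) ?andbF; lia.
have pE q : par m3 (trie (lev k) q) = par m2 (trie (lev k) q) by rewrite par_write ?al_trie.
by split=> [q|q i ij]; rewrite fE ?pE; [apply: ev1|apply: ev2].
Qed.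

Definition up_test :=
  assign 18 (Bin Times (Var 26) (Var 26)) ;;
  assign 36 (Bin Defs.Quotient (Var 0) (Var 18)) ;;
  assign 27 (Bin Defs.Quotient (Var 25) (Var 26) +! 1) ;;
  if_eq (Var 36) (Lit 0) (assign 28 (Lit 0))
    (if_eq (fld (trie_expr (Var 17) (Var 36)) 8) (Var 27) (assign 28 (Lit 0)) (assign 28 (Lit 1))).

Definition up_body :=
  assign 30 (trie_expr (Var 17) (Lit 0)) ;;
  evict_list 0 ;; evict_list 1 ;;
  store (trie_expr (Var 17) (Var 36) +! 8) (Var 27) ;;
  assign 29 (Bin Minus (Var 27) (Bin Times (Lit 2) (Bin Defs.Quotient (Var 27) (Lit 2)))) ;;
  store (Bin Plus (Var 30 +! 13) (Var 29)) (Var 27) ;;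
  store (Var 30 +! 15) (Var 26) ;;
  assign 17 (Bin Times (Lit 2) (Var 17)) ;; assign 26 (Bin Times (Var 26) (Var 26)) ;;
  up_test.

Arguments up_test : simpl never.
Arguments up_body : simpl never.

Definition fresh_access a t k := 0 < bk k (a t) /\
  forall s, s < t -> bk k (a s) = bk k (a t) -> s %/ epo k <> t %/ epo k.

(** The level after the eviction: the epoch of reference is the current one and the access is
    already stamped, but the three blocks around it are still to be hung. *)
Definition halfway a t n k m :=
  [/\ blocks a (fun=> t) (cnt m k) k m, revs a (fun=> t) (t %/ epo k) k m,
      stamps a t.+1 k m, lists t n k m & tops (t %/ epo k) k m] /\
  le_ m k ((t %/ epo k).+1 %% 2) = (t %/ epo k).+1 /\ tab m k = epo k.

Lemma halfway_frame a t n k m m' : same_level k m m' -> halfway a t n k m -> halfway a t n k m'.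
Proof.
move=> sl [[bl rv st ls tps] [leE tE]]; have [fE qE sE [cE lE tabE]] := same_level_fields sl.
have [pE _] := sl; split; [split|].
- move=> q; rewrite fE => /bl[qe [s [i [s2 ic pq le]]]]; split; first by rewrite qE.
  by exists s, i; rewrite cE // lE // pE.
- by move=> q e le e0 Te; rewrite fE; apply: (rv q e).
- by move=> q q0; rewrite sE; apply: st.
- by move=> s s2; rewrite cE // lE //; apply: ls.
- by move=> s s2; rewrite cE // lE //; apply: tps.
- by rewrite lE ?tabE // ltn_mod.
Qed.

(* Once both lists are purged and the head of the list of the current epoch is set, level [k] is
   halfway to the next time. *)
Lemma purge_halfway a t n k m m1 m2 m' : level a t n k m -> fresh_access a t k ->
  let e := t %/ epo k in
  purged k 0 e m m1 -> purged k 1 e m1 m2 ->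
  (forall q, flag m' (lev k) q = flag m2 (lev k) q) ->
  (forall q, par m' (trie (lev k) q) = par m2 (trie (lev k) q)) ->
  (forall q, qname m' (lev k) q = qname m2 (lev k) q) ->
  (forall q, stamp m' (lev k) q = if q == bk k (a t) then e.+1 else stamp m2 (lev k) q) ->
  (forall s, s < 2 -> cnt m' k s = cnt m2 k s) ->
  (forall s, s < 2 -> le_ m' k s = if s == e.+1 %% 2 then e.+1 else le_ m2 k s) ->
  tab m' k = epo k -> halfway a t n k m'.
Proof.
move=> [T [tp [bl rv st ls tps]]] [b0 new] e pu1 pu2 fE pE qE sE cE lE tE.
case: pu1 => qs1 le1 c1 [ev1 ev1']; case: pu2 => qs2 le2 c2 [ev2 ev2'].
have Te : T <= e by apply: top_epoch_le tp.
have cm s : s < 2 -> cnt m' k s = if le_ m k s < e then 0 else cnt m k s.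
  move=> s2; rewrite cE // c2 // c1 // le1 //.
  by move: s2; case: s => [|[|]] //= _; case: ifP.
have lm s : s < 2 -> le_ m' k s = if s == e.+1 %% 2 then e.+1 else le_ m k s.
  by move=> s2; rewrite lE // le2 // le1.
(* For a nonempty list that survives, [le_] is [e] or [e.+1]; if its parity is that of [e.+1], it is
   the list of the current epoch, and writing its head again changes nothing. *)
have big s : s < 2 -> (le_ m k s < e) = false -> 0 < cnt m k s -> le_ m' k s = le_ m k s.
  move=> s2 le c0; rewrite lm //; case: eqP => // es; have [_ l2 l3 /(_ c0)[l0 _]] := ls s s2.
  have aux (l d : nat) : l <= d.+1 -> (l < d) = false -> l %% 2 = d.+1 %% 2 -> d.+1 = l by lia.
  by apply: aux => //; rewrite -es l3.
have c11 : cnt m1 k 1 = cnt m k 1 by rewrite c1.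
have flag_iff q : flag m (lev k) q != 0 ->
   (flag m' (lev k) q = 0 /\ exists s i, [/\ s < 2, le_ m k s < e, i < cnt m k s & par m (trie (lev k) q) = pool k s i]) \/
   (flag m' (lev k) q = flag m (lev k) q /\ par m' (trie (lev k) q) = par m (trie (lev k) q) /\
     forall s i, s < 2 -> le_ m k s < e -> i < cnt m k s -> par m (trie (lev k) q) = pool k s i -> flag m (lev k) q = 0).
  move=> fq; have ifl (b : bool) (x y : nat) : x < (if b then y else 0) -> b /\ x < y by case: b.
  case: (ev1 q) => [[f1 p1]|[f1 _ [i /ifl[l0 ic] pi]]]; last first.
    left; split; last by exists 0, i.
    rewrite fE; case: (ev2 q) => [[-> _]|[-> _]] //.
  case: (ev2 q) => [[f2 p2]|[f2 _ [i /ifl[l0 ic] pi]]]; last first.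
    left; split; first by rewrite fE.
    by exists 1, i; split=> //; [rewrite -le1|rewrite -c11|rewrite -p1].
  right; split; first by rewrite fE f2.
  split; first by rewrite pE p2.
  move=> s i; case: s => [|[|]] // _ l0 ic pi.
    by rewrite -f1; apply: (ev1' q i) => //; rewrite l0.
  by rewrite -f1 -f2; apply: (ev2' q i); rewrite ?le1 ?l0 ?c11 ?f1 ?p1.
have fsub q : flag m' (lev k) q != 0 -> flag m (lev k) q != 0.
  rewrite fE; case: (ev2 q) => [[-> _]|[-> //]]; case: (ev1 q) => [[-> _]|[-> //]] //.
split; [split|split] => //.
- move=> q fq'; have fq := fsub q fq'; have [qe [s [i [s2 ic pq le]]]] := bl q fq.
  split; first by rewrite qE; case: (qs2 q) => -> _; case: (qs1 q) => -> _.
  case: (flag_iff q fq) => [[f0 _]|[_ [p' none]]]; first by rewrite f0 in fq'.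
  have les : (le_ m k s < e) = false.
    by apply/negP => l; move: fq; rewrite (none s i).
  exists s, i; rewrite cm // les; split=> //; first by rewrite p'.
  by rewrite big //; lia.
- move=> q e' le' e'0 ee'; have fq : flag m (lev k) q != 0.
    by apply: (rv q e') => //; apply: leq_trans ee'.
  case: (flag_iff q fq) => [[_ [s [i [s2 les ic pq]]]]|[-> _]] //.
  have [_ [s' [i' [s'2 ic' pq' le'']]]] := bl q fq.
  have i3 : i < 3 * epo k by apply: leq_trans ic (cnt_bound ls s2).
  have i'3 : i' < 3 * epo k by apply: leq_trans ic' (cnt_bound ls s'2).
  have [es _] := pool_inj s2 s'2 i3 i'3 (etrans (esym pq) pq').
  by move: les; rewrite es -(lastep_uniq le' le'') ltnNge ee'.
- move=> q q0; rewrite sE; case: eqP => [->|qb].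
    by apply: lastep_now; rewrite eqxx.
  case: (qs2 q) => _ ->; case: (qs1 q) => _ ->.
  by apply: lastep_step (st q q0) _ => /eqP bq; case: qb.
- move=> s s2; have [l1 l2 l3 l4] := ls s s2; rewrite cm // lm //.
  case: (boolP (le_ m k s < e)) => l; case: (eqVneq s (e.+1 %% 2)) => es //.
  + by split=> // _; rewrite es.
  have c_le : 0 < cnt m k s -> le_ m k s = e.+1.
    by move=> c0; have := big s s2 (negbTE l) c0; rewrite lm // es eqxx => <-.
  split=> //.
  + case: (posnP (cnt m k s)) => [-> //|c0]; move: l1; by rewrite c_le.
  + by move=> c0; split=> //; case: (l4 c0).
- move=> s s2; rewrite cm //; case: (boolP (le_ m k s < e)) => // l c0.
  by rewrite big // ?(negbTE l) //; lia.
- by rewrite lm ?eqxx // ltn_mod.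
Qed.

End EvictList.

Section Up.
Context {disp : Order.disp_t} {U : orderType disp}.
Implicit Types (m : memory U) (r : env) (a : nat -> nat).

Lemma up_test_spec W V r m k i t : bounded W m -> room W V -> 2 ^ lev k + i <= V -> t + 20 <= W ->
  r 0 = i -> r 25 = t -> r 17 = lev k -> r 26 = epo k ->
  hwp W up_test (fun c r' m' => [/\ c <= 80, m' = m, frame [:: 18; 36; 27; 28] r r' &
    [/\ r' 18 = 2 ^ lev k, r' 36 = bk k i, r' 27 = (t %/ epo k).+1 &
      r' 28 = ((0 < bk k i) && (stamp m (lev k) (bk k i) != (t %/ epo k).+1) : nat)]]) r m.
Proof.
move=> bm rm b1 tW r0 r25 r17 r26; have W100 := room_W rm.
have hl : lev k < 2 ^ lev k by exact: ltn_expl.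
have ek := exp_lev k; have e4 := epo_ge4 k.
have bi : bk k i <= i by exact: leq_div.
have te : t %/ epo k <= t by exact: leq_div.
have eV : epo k <= 2 ^ lev k by rewrite ek leq_pmull //; lia.
rewrite /up_test; apply: hwp_seq; apply: hwp_assign; [by []|lia| |rewrite /= r26 -ek].
  by rewrite /= r26 -ek; split=> //; lia.
apply: hwp_seq; apply: hwp_assign; [by []|lia| |rewrite /= r0 -/(bk k i)].
  by rewrite /= r0 -/(bk k i); split=> //; lia.
apply: hwp_seq; apply: hwp_assign; [by []|lia| |rewrite /= r25 r26 (addn1 (t %/ epo k))].
  by rewrite /= r25 r26; repeat split => //; lia.
have tb : trie (lev k) (bk k i) + 200 <= W by apply: (trie_bound rm); lia.
have fr v : frame [:: 18; 36; 27; 28] r (upd (upd (upd (upd r 18 (2 ^ lev k)) 36 (bk k i)) 27 (t %/ epo k).+1) 28 v).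
  by move=> x; rewrite !inE !negb_or => /and4P[/negbTE x1 /negbTE x2 /negbTE x3 /negbTE x4] /=; rewrite x1 x2 x3 x4.
apply: hwp_eq; [by []|sd|sd|rewrite /=].
case: (posnP (bk k i)) => b0 /=.
  by apply: hwp_assign; [by []|lia|sd|rewrite /=; split=> //; rewrite -?b0; apply: fr].
apply: hwp_eq; [by []| |sd|].
  split; [|rewrite /=; lia|].
    by apply: safe_trie => //=; rewrite r17.
  by rewrite -[X in X < _]/(trie (r 17) (bk k i) + 8) r17; lia.
rewrite -[X in X == _]/(word m (trie (r 17) (bk k i) + 8)) r17 -/(stamp m (lev k) (bk k i)) /=.
by case: eqP => _; apply: hwp_assign; [by []|lia|sd|split=> //|by []|lia|sd|split=> //].
Qed.

(** An upper bound both for hanging one block and for evicting one entry of a list. *)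
Definition weight k := 100 * (20 * lev k + 51).
(* The potential: evicting a block of level [k] is paid for when the block is hung. *)
Definition load m k := weight k * (cnt m k 0 + cnt m k 1).

Definition up_vars := [:: 17; 18; 26; 27; 28; 29; 30; 33; 36] ++ evict_vars.

Lemma level_named a t n V k m : level a t n k m -> (forall s, s < t -> a s <= n) ->
  n + 3 * 2 ^ lev k <= V -> named V k m.
Proof.
move=> [T [_ [bl _ _ ls _]]] an nV q /bl[qe [s [i [s2 ic _ [_ le2]]]]]; split=> //.
have c0 : 0 < cnt m k s by exact: leq_ltn_trans ic.
have [_ _ _ /(_ c0)[l0 _]] := ls s s2.
have [w [wt /and3P[_ _ tq] _]] := le2 l0.
apply: leq_trans nV; have := an w wt; have := leq_divM (a w) (2 ^ lev k); rewrite -/(bk k (a w)).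
by nia.
Qed.

Lemma mod2E e : e - 2 * (e %/ 2) = e %% 2. Proof. lia. Qed.

Lemma up_body_spec a t W V n r m k : wfm W n m -> layout (fun=> n) m -> room W V ->
  level a t n k m -> level a t n k.+1 m -> (forall s, s <= t -> a s <= n) ->
  fresh_access a t k -> 100 * (n + 2) * (n + 2) <= V -> t + 20 <= W ->
  r 0 = a t -> r 1 = 0 -> r 17 = lev k -> r 18 = 2 ^ lev k -> r 20 = n -> r 25 = t ->
  r 26 = epo k -> r 27 = (t %/ epo k).+1 -> r 36 = bk k (a t) ->
  hwp W up_body (fun c r' m' => [/\ c + load m' k <= load m k + 400, frame up_vars r r',
    wfm W n m' /\ layout (fun=> n) m', off k m m' /\ halfway a t n k m' &
    [/\ r' 17 = lev k.+1, r' 26 = epo k.+1 & [/\ r' 18 = 2 ^ lev k.+1, r' 36 = bk k.+1 (a t), r' 27 = (t %/ epo k.+1).+1 &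
      r' 28 = ((0 < bk k.+1 (a t)) && (stamp m' (lev k.+1) (bk k.+1 (a t)) != (t %/ epo k.+1).+1) : nat)]]]) r m.
Proof.
move=> wm L rm lv lv' an fa nV tW r0 r1 r17 r18 r20 r25 r26 r27 r36; have W100 := room_W rm.
have hl : lev k < 2 ^ lev k by exact: ltn_expl.
have ek := exp_lev k; have e4 := epo_ge4 k.
have ant := an t (leqnn t); case: (fa) => b0 _.
have Bn : 2 ^ lev k <= n.
  by apply: leq_trans ant; have := leq_divM (a t) (2 ^ lev k); rewrite -/(bk k (a t)); nia.
have bi : bk k (a t) <= a t by exact: leq_div.
have te : t %/ epo k <= t by exact: leq_div.
have eV : epo k <= 2 ^ lev k by rewrite ek leq_pmull //; lia.
have VV : 100 * n + 200 <= V by lia.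
(* The program computes the block length of the next level before it knows whether that level
   matters. This length is the square of the present one, hence up to [n] squared; this forces [V]
   to be quadratic in [n]. *)
have sq : 2 ^ lev k.+1 + 100 * n + 200 <= V.
  by rewrite exp_lev epoS -ek; have := leq_mul Bn Bn; lia.
have hl1 : lev k.+1 < 2 ^ lev k.+1 by exact: ltn_expl.
have nm : named V k m by apply: (level_named lv) => [s st|]; [apply: an; lia|lia].
have cov : covered k m by move=> q; apply: flag_up lv lv' q.
have ls : lists t n k m by case: (lv) => T [_ [_ _ _ ls _]].
have tb : trie (lev k) (bk k (a t)) + 200 <= W by apply: (trie_bound rm); lia.
have tb0 : trie (lev k) 0 + 200 <= W by apply: (trie_bound rm); lia.
have of8 : other_field 8 by [].
rewrite /up_body; apply: hwp_seq; apply: hwp_assign; [by []|lia| |].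
  by apply: safe_trie => //=; rewrite ?r17 //; lia.
rewrite eval_trie -[eval r _ (Lit 0)]/0 -[eval r _ (Var 17)]/(r 17) r17.
apply: hwp_seq.
apply: hwp_conseq (@evict_list_spec _ _ W V n (t %/ epo k) _ m k 0 wm L rm cov nm isT _ _ _ _ _ _ _ _ _ _) _ => //=; try lia.
  exact: (cnt_bound ls).
move=> c1 r2 m1 [c1b fr1 [wm1 L1] of1 pu1].
have fsub1 q : flag m1 (lev k) q != 0 -> flag m (lev k) q != 0.
  by case: pu1 => _ _ _ [ev _]; case: (ev q) => [[-> _]|[-> _]].
have cov1 : covered k m1.
  have kk : k.+1 != k by rewrite eqn_leq ltnn.
  have [fE1 _ _ _] := same_level_fields (off_level of1 kk).
  by move=> q /fsub1/cov[|f]; [left|right; rewrite fE1].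
have nm1 : named V k m1.
  by move=> q /fsub1/nm[qe qV]; split=> //; case: pu1 => h _ _ _; case: (h q) => ->.
have c1E s : s < 2 -> cnt m1 k s <= 3 * epo k.
  move=> s2; case: pu1 => _ _ -> // _; case: ifP => // _; exact: cnt_bound ls s2.
apply: hwp_seq.
apply: hwp_conseq (@evict_list_spec _ _ W V n (t %/ epo k) _ m1 k 1 wm1 L1 rm cov1 nm1 isT (c1E 1 isT) _ _ _ _ _ _ _ _ _) _ => //=; try lia; try by rewrite fr1.
move=> c2 r3 m2 [c2b fr2 [wm2 L2] of2 pu2].
have r3E x : x \notin evict_vars -> x != 30 -> r3 x = r x.
  by move=> xe x30; rewrite fr2 // fr1 //= (negbTE x30).
have r330 : r3 30 = trie (lev k) 0 by rewrite fr2 // fr1.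
have sE : (t %/ epo k).+1 - 2 * ((t %/ epo k).+1 %/ 2) = (t %/ epo k).+1 %% 2 by exact: mod2E.
have s2 : (t %/ epo k).+1 %% 2 < 2 by exact: ltn_mod.
have d2 : (t %/ epo k).+1 %/ 2 <= (t %/ epo k).+1 by exact: leq_div.
have d22 : 2 * ((t %/ epo k).+1 %/ 2) <= (t %/ epo k).+1 by lia.
set E := (t %/ epo k).+1 in r27 sE s2 d2 d22 *.
have EW : E + 16 <= W by rewrite /E; lia.
set s := E %% 2 in sE s2 *.
have r317 : r3 17 = lev k by rewrite r3E.
have r336 : r3 36 = bk k (a t) by rewrite r3E.
have r327 : r3 27 = E by rewrite r3E.
have r326 : r3 26 = epo k by rewrite r3E.
have ofs : other_field (13 + s) by rewrite /other_field; lia.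
apply: hwp_seq; apply: hwp_store; [by []| |by []|].
  split; [|rewrite /=; lia|].
    by apply: safe_trie => //=; rewrite r317 r336.
  by rewrite -[X in X < _]/(trie (r3 17) (r3 36) + 8) r317 r336; lia.
rewrite -[X in wr m2 X _]/(trie (r3 17) (r3 36) + 8) -[X in wr m2 _ X]/(r3 27) r317 r336 r327.
set m0 := wr m2 _ _.
apply: hwp_seq; apply: hwp_assign; [by []|lia| |rewrite /= r327 sE].
  by rewrite /= r327 sE; repeat split; lia.
apply: hwp_seq; apply: hwp_store; [by []|rewrite /= r330; repeat split; lia|by []|rewrite /= r330 r327].
rewrite -[trie (lev k) 0 + 13 + s]addnA; set m3 := wr m0 _ E.
apply: hwp_seq; apply: hwp_store; [by []|rewrite /= r330; repeat split; lia|by []|rewrite /= r330 r326].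
set m4 := wr m3 _ (epo k).
have w4 q f : f < 16 -> word m4 (trie (lev k) q + f) =
   if (q == 0) && (f == 15) then epo k else if (q == 0) && (f == 13 + s) then E
   else if (q == bk k (a t)) && (f == 8) then E else word m2 (trie (lev k) q + f).
  by move=> f16; rewrite /m4 /m3 /m0 !field_write // eqxx.
have wm4 : wfm W n m4 by do 3 (apply: wfm_field => //; try lia).
have L4 : layout (fun=> n) m4.
  by do 3 (apply: layout_write => //; try lia).
have of4 : off k m m4.
  apply: off_trans of1 (off_trans of2 _).
  apply: off_trans (off_write k m2 (bk k (a t)) E of8) _.
  by apply: off_trans (off_write k m0 0 E ofs) _; apply: off_write.
have par4 y : 16 %| y -> par m4 y = par m2 y.
  by move=> y16; rewrite /m4 par_write // /m3 par_write // /m0 par_write.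
have cE s' : s' < 2 -> cnt m4 k s' = cnt m2 k s'.
  by move=> s'2; rewrite /cnt w4 ?ifN // ?negb_and; lia.
have hw : halfway a t n k m4.
  apply: (purge_halfway lv fa pu1 pu2) => //.
  - by move=> q; rewrite /flag w4 // !ifN // negb_and; lia.
  - by move=> q; rewrite par4 ?al_trie.
  - by move=> q; rewrite /qname w4 // !ifN // negb_and; lia.
  - move=> q; have n13 : (8 == 13 + s) = false by lia.
    by rewrite /stamp w4 // n13 !andbF andbT.
  - move=> s' s'2; rewrite /le_ w4; last by lia.
    have n15 : (13 + s' == 15) = false by lia.
    have n8 : (13 + s' == 8) = false by lia.
    by rewrite n15 n8 !andbF eqn_add2l eqxx.
  - by rewrite /tab w4.
apply: hwp_seq; apply: hwp_assign; [by []|lia| |rewrite /= r317 -levS].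
  by rewrite /= r317 -levS; split=> //; lia.
apply: hwp_seq; apply: hwp_assign; [by []|lia| |rewrite /= r326 -epoS].
  by rewrite /= r326 -epoS epoS -ek; split=> //; lia.
have k1 : 2 ^ lev k.+1 + a t <= V by lia.
apply: hwp_conseq (@up_test_spec W V (upd (upd (upd r3 29 s) 17 (lev k.+1)) 26 (epo k.+1)) m4 k.+1 (a t) t (w_bounded wm4) rm k1 tW _ _ _ _) _ => //=.
- by rewrite r3E.
- by rewrite r3E.
move=> c3 r4 m5 [c3b -> fr4 [e18 e36 e27 e28]]; split=> //.
- rewrite /load !cE //; move: c1b c2b; rewrite -/(weight k).
  case: pu1 => _ _ pc1 _; case: pu2 => _ _ pc2 _.
  have -> : cnt m2 k 0 = cnt m1 k 0 by rewrite pc2.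
  have <- : cnt m1 k 1 = cnt m k 1 by rewrite pc1.
  by rewrite /acost /= !mulnDr; lia.
- move=> x; rewrite /up_vars mem_cat negb_or => /andP[x1 xe]; rewrite !inE in x1.
  rewrite fr4; last by rewrite !inE; lia.
  have x30 : x != 30 by lia.
  by rewrite /= !ifN; try lia; exact: r3E.
split.
- by rewrite fr4.
- by rewrite fr4.
by split.
Qed.

Definition nonlev m m' :=
  [/\ forall h q f, other_field f -> (forall j, h != lev j) -> word m' (trie h q + f) = word m (trie h q + f),
      forall y, y < 16 -> word m' y = word m y & item m' = item m].

Lemma nonlev_trans m m' m'' : nonlev m m' -> nonlev m' m'' -> nonlev m m''.
Proof.
move=> [a b c] [a' b' c']; split=> [h q f of_ hl|y y16|].
- by rewrite a' ?a. - by rewrite b' ?b. - by rewrite c' c.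
Qed.
Lemma off_nonlev k m m' : off k m m' -> nonlev m m'.
Proof. by move=> [a _ b c]; split=> // h q f of_ hl; apply: a. Qed.

Definition stops a t k := bk k (a t) = 0 \/
  exists s, [/\ s < t, bk k (a s) = bk k (a t) & s %/ epo k = t %/ epo k].

(** A stamp is at most one more than the current epoch, so a stamp that differs from this is smaller
    and excludes an access to the block in this epoch. *)
Lemma test_go a t n k m : level a t n k m -> 0 < bk k (a t) ->
  stamp m (lev k) (bk k (a t)) != (t %/ epo k).+1 -> fresh_access a t k.
Proof.
move=> [T [_ [_ _ st _ _]]] b0 /eqP ne; split=> // s st' be se; apply: ne.
have h := st _ b0; have [h1 _] := h; have ub := lastep_bound h.
have := h1 s st' (introT eqP be); rewrite se => lb.
by apply/eqP; rewrite eqn_leq ub lb.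
Qed.

Lemma test_stop a t n k m : level a t n k m ->
  (0 < bk k (a t)) && (stamp m (lev k) (bk k (a t)) != (t %/ epo k).+1) = false -> stops a t k.
Proof.
move=> [T [_ [_ _ st _ _]]]; case: (posnP (bk k (a t))) => [b0 _|b0 /negbFE/eqP se]; [by left|right].
have [_ h2] := st _ b0; have [|s [st' /eqP be e]] := h2; first by rewrite se.
by exists s; split=> //; move: e; rewrite se => -[->].
Qed.

(** The fuel [d] suffices because every leaf [x] lies in block 0 at level [x]. All levels from [k]
    up to [K] are left halfway; the others are not touched. *)
Lemma up_loop_spec a t W V n d r m k : a t <= k + d -> wfm W n m -> layout (fun=> n) m -> room W V ->
  (forall j, k <= j -> level a t n j m) -> (forall s, s <= t -> a s <= n) ->
  100 * (n + 2) * (n + 2) <= V -> t + 20 <= W ->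
  r 0 = a t -> r 1 = 0 -> r 17 = lev k -> r 18 = 2 ^ lev k -> r 20 = n -> r 25 = t ->
  r 26 = epo k -> r 27 = (t %/ epo k).+1 -> r 36 = bk k (a t) ->
  r 28 = ((0 < bk k (a t)) && (stamp m (lev k) (bk k (a t)) != (t %/ epo k).+1) : nat) ->
  hwp W (while_pos 33 (Var 28) up_body) (fun c r' m' => exists K, k <= K /\
    [/\ c + \sum_(k <= j < K) load m' j <= \sum_(k <= j < K) (load m j + 410) + 10,
        frame up_vars r r' /\ r' 17 = lev K, wfm W n m' /\ layout (fun=> n) m',
        (forall j, k <= j < K -> halfway a t n j m' /\ fresh_access a t j) /\ stops a t K &
        nonlev m m' /\ forall j, (j < k) || (K <= j) -> same_level j m m']) r m.
Proof.
move=> dk wm L rm lv an nV tW; have W100 := room_W rm.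
elim: d r m k dk wm L lv => [|d IH] r m k dk wm L lv r0 r1 r17 r18 r20 r25 r26 r27 r36 r28;
  (apply: hwp_while => //; [lia|rewrite /= r28; case: (_ && _); lia|rewrite /= r28]).
  rewrite (_ : bk k (a t) = 0) /=; last first.
    by apply: (bk_le (k := a t)); [lia|exact: bk0].
  exists k; split=> //; split=> //; first by rewrite !big_geq.
    by split=> //; apply: frame_upd.
  split=> [j|]; first by lia.
  by left; apply: (bk_le (k := a t)); [lia|exact: bk0].
case E : (_ && _); last first.
  exists k; split=> //; split=> //; first by rewrite !big_geq.
    by split=> //; apply: frame_upd.
  split=> [j|]; first by lia.
  exact: test_stop (lv k (leqnn k)) E.
have fa : fresh_access a t k.
  by case/andP: E => b0 ne; apply: test_go (lv k (leqnn k)) b0 ne.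
rewrite /=; apply: hwp_conseq (@up_body_spec a t W V n _ m k wm L rm (lv k (leqnn k)) (lv _ (leqnSn k)) an fa nV tW _ _ _ _ _ _ _ _ _) _ => //.
move=> c1 r2 m2 [c1b fr2 [wm2 L2] [of2 hw2] [e17 e26 [e18 e36 e27 e28]]].
have lv2 j : k < j -> level a t n j m2.
  move=> kj; apply: level_frame (lv j (ltnW kj)); apply: (off_level of2).
  by rewrite neq_ltn kj orbT.
apply: hwp_conseq (IH r2 m2 k.+1 _ wm2 L2 lv2 _ _ e17 e18 _ _ e26 e27 e36 e28) _; try by rewrite ?fr2 //; lia.
move=> c2 r3 m3 [K [kK [c2b [fr3 r317] wl3 [hw3 st3] [nl3 sl3]]]]; exists K; split; first lia.
have slk : same_level k m2 m3 by apply: sl3; rewrite ltnSn.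
have ldk : load m3 k = load m2 k.
  by have [_ _ _ [cE _ _]] := same_level_fields slk; rewrite /load !cE.
have lds : \sum_(k.+1 <= j < K) (load m2 j + 410) = \sum_(k.+1 <= j < K) (load m j + 410).
  apply: eq_big_nat => j /andP[kj _]; congr (_ + _).
  have jk : j != k by rewrite neq_ltn kj orbT.
  by have [_ _ _ [cE _ _]] := same_level_fields (off_level of2 jk); rewrite /load !cE.
split=> //.
- rewrite !(big_ltn kK) ldk; move: c1b c2b; rewrite lds /acost; lia.
- by split=> //; apply: frame_comp (frame_updl _ fr2) fr3.
- split=> // j /andP[kj jK]; case: (ltngtP k j) => [kj'|jk|<-].
  + by apply: hw3; rewrite kj'.
  + by lia.
  + by split=> //; apply: halfway_frame slk hw2.
split; first exact: nonlev_trans (off_nonlev of2) nl3.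
move=> j hj; have jk : j != k by case/orP: hj; lia.
apply: same_level_trans (off_level of2 jk) (sl3 j _).
by case/orP: hj; lia.
Qed.
End Up.

Arguments weight : simpl never.
Arguments load {disp U} m k : simpl never.

(** * Hanging the blocks around an access *)

Definition hoist :=
  assign 21 (trie_expr (Var 17) (Var 19)) ;; assign 9 (Var 21) ;; detach ;;
  store (Var 21 +! 7) (Lit 1) ;; store (Var 21 +! 10) (Var 19) ;;
  assign 31 (Get (Bin Plus (Var 30 +! 11) (Var 29))) ;;
  assign 16 (Bin Plus (Bin Plus (Bin Times (Lit 8) (Var 18) +! 2)
     (Bin Times (Var 29) (Bin Times (Lit 3) (Var 26)))) (Var 31)) ;;
  store (Bin Plus (Var 30 +! 11) (Var 29)) (Var 31 +! 1) ;; attach_slot.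

Definition down_body :=
  assign 17 (Bin Defs.Quotient (Var 17) (Lit 2)) ;;
  assign 30 (trie_expr (Var 17) (Lit 0)) ;;
  assign 26 (fld (Var 30) 15) ;;
  assign 18 (Bin Times (Var 26) (Var 26)) ;;
  assign 36 (Bin Defs.Quotient (Var 0) (Var 18)) ;;
  assign 27 (Bin Defs.Quotient (Var 25) (Var 26) +! 1) ;;
  assign 29 (Bin Minus (Var 27) (Bin Times (Lit 2) (Bin Defs.Quotient (Var 27) (Lit 2)))) ;;
  assign 19 (Bin Minus (Var 36) (Lit 1)) ;; hoist ;;
  assign 19 (Var 19 +! 1) ;; hoist ;;
  assign 19 (Var 19 +! 1) ;; hoist.

(* Registers: 0 the index, 17 [lev k], 18 [2 ^ lev k], 20 the number of leaves, 25 the clock,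
   26 [epo k], 27 the epoch plus one, 29 its parity, 30 the block 0 of the level, 36 the block of
   the index. The first loop goes up through the levels where the block is new and empties expired
   lists, the second comes down and hangs the blocks. *)
Definition access :=
  assign 25 (Get (Lit 3)) ;; assign 20 (Get (Lit 1)) ;; assign 17 (Lit 4) ;; assign 26 (Lit 4) ;;
  up_test ;; while_pos 33 (Var 28) up_body ;;
  while_pos 34 (Bin Minus (Var 17) (Lit 4)) down_body ;;
  store (Lit 3) (Var 25 +! 1).

Arguments hoist : simpl never.
Arguments down_body : simpl never.

Section Down.
Context {disp : Order.disp_t} {U : orderType disp}.
Implicit Types (m : memory U) (r : env) (a : nat -> nat).

(* The blocks in [D], [d] of them, have already been hoisted at time [t]. *)
Definition hoisting a t n k (D : pred nat) d m :=
  let e := t %/ epo k in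
  [/\ blocks a (fun q => if D q then t.+1 else t) (cnt m k) k m,
      revs a (fun q => if D q then t.+1 else t) e k m, stamps a t.+1 k m,
      forall s, s < 2 -> [/\
        cnt m k s <= 3 * minn (epo k) (t - (le_ m k s).-1 * epo k) + (if s == e.+1 %% 2 then d else 0),
        le_ m k s <= e.+1, 0 < le_ m k s -> le_ m k s %% 2 = s &
        0 < cnt m k s -> 0 < le_ m k s /\ 2 ^ lev k <= n] &
      tops e k m] /\ le_ m k (e.+1 %% 2) = e.+1.

Lemma halfway_hoisting a t n k m : halfway a t n k m -> hoisting a t n k pred0 0 m.
Proof.
move=> [[bl rv st ls tps] [leE tE]]; split=> //; split=> // s s2.
have [l1 l2 l3 l4] := ls s s2; split=> //.
by rewrite (_ : (if _ then 0 else 0) = 0) ?addn0 //; case: ifP.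
Qed.

Lemma hoisting_level a t n k m : fresh_access a t k -> a t <= n ->
  hoisting a t n k (fun q => touched a k q t) 3 m -> level a t.+1 n k m.
Proof.
move=> [b0 _] an [[bl rv st ls tps] leE]; set e := t %/ epo k in rv ls tps leE *.
have e4 := epo_ge4 k.
have tq q e' : lastep t.+1 (epo k) (touched a k q) e' <->
    lastep (if touched a k q t then t.+1 else t) (epo k) (touched a k q) e'.
  case: ifP => // tc.
  have H e2 : lastep t (epo k) (touched a k q) e2 -> lastep t.+1 (epo k) (touched a k q) e2.
    by move=> le; apply: lastep_step le _; rewrite tc.
  split; last exact: H.
  move=> h; have [e2 h2] := lastep_ex t (epo k) (touched a k q).
  by rewrite (lastep_uniq h (H _ h2)).
exists e; split; first split.
- by move=> s st' _; apply: leq_div2r; rewrite -ltnS.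
- by move=> _; exists t.
split.
- by move=> q /bl[qe [s [i [s2 ic pq le]]]]; split=> //; exists s, i; split=> //; apply/tq.
- by move=> q e' /tq; apply: rv.
- exact: st.
- move=> s s2; have [l1 l2 l3 l4] := ls s s2; split=> //.
  (* In the current epoch the minimum at time [t] is [t %% epo k], less than [epo k], so it grows by
     one with the clock and allows for the three new entries. *)
  + apply: leq_trans l1 _; case: eqP => [es|_]; last by rewrite addn0 leq_mul2l /=; lia.
    rewrite es leE /=; have := ltn_mod t (epo k); have := divn_eq t (epo k); rewrite -/e; lia.
  + by apply: leq_trans l2 _; rewrite ltnS; apply: leq_div2r.
- exact: tps.
Qed.

Lemma touched_flag a t n k m q : level a t.+1 n k m -> touched a k q t -> flag m (lev k) q != 0.
Proof.
move=> [T [tp [_ rv _ _ _]]] tc; apply: (rv q _ (lastep_now _ tc)) => //.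
have := top_epoch_le tp; case: tp => _ tp2.
by case: (posnP T) => [->//|/tp2[s [st _ <-]]] _; rewrite ltnW // ltnS; apply: leq_div2r; rewrite -ltnS.
Qed.

Definition hoist_vars := [:: 21; 31; 2; 3; 4; 5; 6; 7; 8; 9; 10; 11; 12; 13; 14; 15; 16].

Lemma hoist_spec a t W V n r m k q D d : wfm W n m -> layout (fun=> n) m -> room W V ->
  hoisting a t n k D d m -> d < 3 -> touched a k q t -> 2 ^ lev k <= n ->
  q %/ 2 ^ lev k <= 1 \/ flag m (lev k.+1) (q %/ 2 ^ lev k) != 0 ->
  r 1 = 0 -> r 17 = lev k -> r 18 = 2 ^ lev k -> r 19 = q -> r 26 = epo k ->
  r 29 = (t %/ epo k).+1 %% 2 -> r 30 = trie (lev k) 0 ->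
  32 * 2 ^ lev k + 32 <= V -> q <= V ->
  hwp W hoist (fun c r' m' => [/\ c <= weight k, frame hoist_vars r r',
    wfm W n m' /\ layout (fun=> n) m', off k m m' /\ tab m' k = tab m k &
    hoisting a t n k (fun q' => (q' == q) || D q') d.+1 m' /\
      (cnt m' k 0 + cnt m' k 1 = (cnt m k 0 + cnt m k 1).+1)]) r m.
Proof.
move=> wm L rm [[bl rv st ls tps] leE] d3 tq Bn cov r1 r17 r18 r19 r26 r29 r30 b1 b2.
have W100 := room_W rm; have e4 := epo_ge4 k; have h4 := lev_gt0 k.
have hl : lev k < 2 ^ lev k by exact: ltn_expl.
have own := layout_own wm L.
set e := t %/ epo k in rv ls tps leE r29 *; set s := e.+1 %% 2 in leE r29 *.
have s2 : s < 2 by exact: ltn_mod.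
have cb s' : s' < 2 -> cnt m k s' <= 3 * epo k.
  move=> s'2; have [l1 _ _ _] := ls s' s'2; apply: leq_trans l1 _.
  case: eqP => [es|_]; last by lia.
  rewrite es leE /=; have := ltn_mod t (epo k); have := divn_eq t (epo k); rewrite -/e; lia.
have cs : cnt m k s < 3 * epo k.
  have [l1 _ _ _] := ls s s2; apply: leq_ltn_trans l1 _; rewrite eqxx leE /=.
  have := ltn_mod t (epo k); have := divn_eq t (epo k); rewrite -/e; lia.
have pB := pool_bound s2 cs; set x := 2 + s * (3 * epo k) + cnt m k s in pB.
have sE : s * (3 * epo k) <= x by rewrite /x; lia.
have eE : 3 * epo k <= 8 * 2 ^ lev k by rewrite exp_lev; nia.
have tb : trie (lev k) q + 200 <= W by apply: (trie_bound rm); lia.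
have tb0 : trie (lev k) 0 + 200 <= W by apply: (trie_bound rm); lia.
(* At most [lev k] links in the trie up to the stop at height [2 * lev k], then the heap. *)
have hd : iter (5 * lev k + 8) (par m) (trie (lev k) q) = 0.
  have := dep_stop wm own (stop_cover L cov).
  by rewrite (_ : lev k + 2 * (lev k + lev k) + 8 = 5 * lev k + 8) //; lia.
rewrite /hoist; apply: hwp_seq; apply: hwp_assign; [by []|lia| |].
  by apply: safe_trie => //=; rewrite r17 r19.
rewrite eval_trie /= r17 r19.
apply: hwp_seq; apply: hwp_assign; [by []|lia|rewrite /=; lia|rewrite /=].
apply: hwp_seq; apply: hwp_conseq (@detach_trie _ _ W n _ _ m (lev k) q wm _ _ _ _ hd) _ => //=; try lia.
move=> c1 r2 m1 [c1b fr1 wm1 [tp1 so1]].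
have r2E y : y \notin iota 2 7 -> y != 9 -> y != 21 -> r2 y = r y.
  by move=> yi y9 y21; rewrite fr1 //= (negbTE y9) (negbTE y21).
have r221 : r2 21 = trie (lev k) q by rewrite fr1.
have of7 : other_field 7 by []. have of10 : other_field 10 by [].
apply: hwp_seq; apply: hwp_store; [by []|rewrite /= r221; repeat split; lia|by rewrite /=; lia|rewrite /= r221].
set m2 := wr m1 _ 1.
apply: hwp_seq; apply: hwp_store; [by []|rewrite /= r221; repeat split; lia|by []|].
rewrite -[X in wr m2 X _]/(r2 21 + 10) -[X in wr m2 _ X]/(r2 19) r221 r2E // r19.
set m3 := wr m2 _ q.
have ofs : other_field (11 + s) by rewrite /other_field; lia.
have s11 : (11 + s == 10) = false by lia.
have s7 : (11 + s == 7) = false by lia.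
have cE : word m3 (trie (lev k) 0 + (11 + s)) = cnt m k s.
  rewrite /m3 /m2 !field_write //; try lia.
  by rewrite s11 s7 !andbF; case: so1 => h _ _; rewrite h ?al_trie.
have ev31 : eval r2 (word m3) (Get (Bin Plus (Var 30 +! 11) (Var 29))) = cnt m k s.
  by rewrite -cE addnA -[RHS]/(word m3 _); congr (word m3 _); rewrite /= !r2E // r30 r29.
apply: hwp_seq; apply: hwp_assign; [by []|lia|rewrite /= !r2E // r30 r29; repeat split; lia|rewrite ev31].
apply: hwp_seq; apply: hwp_assign; [by []|lia| |].
  rewrite /= !r2E // r18 r26 r29; repeat split; try lia.
have -> : eval (upd r2 31 (cnt m k s)) (word m3) (Bin Plus (Bin Plus (Bin Times (Lit 8) (Var 18) +! 2)
     (Bin Times (Var 29) (Bin Times (Lit 3) (Var 26)))) (Var 31)) = 8 * 2 ^ lev k + x.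
  by rewrite /= !r2E // r18 r26 r29 /x; lia.
apply: hwp_seq; apply: hwp_store; [by []|rewrite /= !r2E // r30 r29; repeat split; lia|rewrite /=; repeat split; lia|].
rewrite -[X in wr m3 X _]/(r2 30 + 11 + r2 29) -[X in wr m3 _ X]/(cnt m k s + 1) !r2E // r30 r29.
rewrite -[trie (lev k) 0 + 11 + s]addnA (addn1 (cnt m k s)).
set m4 := wr m3 _ (cnt m k s).+1.
have fw m0 h' q' f : other_field f -> f < 16 -> word m4 (trie h' q' + f) =
   if (h' == lev k) && (q' == 0) && (f == 11 + s) then (cnt m k s).+1
   else if (h' == lev k) && (q' == q) && (f == 10) then q
   else if (h' == lev k) && (q' == q) && (f == 7) then 1 else word m (trie h' q' + f).
  move=> of_ f16; rewrite /m4 /m3 /m2 !field_write //.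
  by case: so1 => h _ _; rewrite h ?al_trie.
have pw y : 16 %| y -> par m4 y = par m1 y.
  by move=> y16; rewrite /m4 par_write // /m3 par_write // /m2 par_write.
have wm4 : wfm W n m4 by do 3 (apply: wfm_field => //; try lia).
(* A hung block at this position would be an entry beyond the end of its list, and blocks at home
   use only the slots 0 and 1. *)
have free h' q' : par m4 (trie h' q') != pool k s (cnt m k s).
  rewrite pw ?al_trie // tp1; case: ifP => _; first by rewrite eq_sym slot_neq0.
  apply/eqP => ep; have xb : x < 8 * 2 ^ lev k by lia.
  have := L h' q'; case: (eqVneq (flag m h' q') 0) => fl.
    by rewrite ep => /esym/home_pool/(_ xb); lia.
  case=> x' /andP[_ xb']; rewrite ep => es; have [eh _] := slot_inj xb xb' es; subst h'.
  have [_ [s' [i [s'2 ic pq' _]]]] := bl q' fl.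
  have i3 : i < 3 * epo k by apply: leq_trans ic (cb s' s'2).
  have [es' ei] := pool_inj s2 s'2 cs i3 (etrans (esym ep) pq').
  by move: ic; rewrite -es' -ei ltnn.
have v0 : 0 < 8 * 2 ^ lev k + x < 2 ^ (lev k + 3).+1 by apply: slot_range; lia.
apply: hwp_conseq (@attach_slot_spec _ _ W V n (lev k + 3) _ m4 (lev k) q (8 * 2 ^ lev k + x) wm4 rm _ _ _ v0 _ tb _ _) _ => //=; try lia.
- by rewrite r2E.
- by rewrite pw ?al_trie // tp1 !eqxx.
move=> c2 r3 m5 [c2b fr3 wm5 [tp5 so5]].
have fw5 h' q' f : other_field f -> f < 16 -> word m5 (trie h' q' + f) =
   if (h' == lev k) && (q' == 0) && (f == 11 + s) then (cnt m k s).+1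
   else if (h' == lev k) && (q' == q) && (f == 10) then q
   else if (h' == lev k) && (q' == q) && (f == 7) then 1 else word m (trie h' q' + f).
  by move=> of_ f16; case: so5 => h _ _; rewrite h ?al_trie // fw.
have par5 h' q' : par m5 (trie h' q') =
    if (h' == lev k) && (q' == q) then pool k s (cnt m k s) else par m (trie h' q').
  by rewrite tp5 pw ?al_trie // tp1; case: (_ && _).
have flag5 h' q' : flag m5 h' q' = if (h' == lev k) && (q' == q) then 1 else flag m h' q'.
  by rewrite /flag fw5 // andbT [7 == _]eq_sym s7 andbF andbF.
have cnt5 s' : s' < 2 -> cnt m5 k s' = if s' == s then (cnt m k s).+1 else cnt m k s'.
  move=> s'2; rewrite /cnt fw5 ?eqxx ?eqn_add2l; try (rewrite /other_field; lia).
  rewrite (_ : (11 + s' == 10) = false); last by lia.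
  by rewrite (_ : (11 + s' == 7) = false) ?andbF //; lia.
have le5 s' : s' < 2 -> le_ m5 k s' = le_ m k s'.
  move=> s'2; rewrite /le_ fw5; try (rewrite /other_field; lia).
  rewrite (_ : (13 + s' == 11 + s) = false); last by lia.
  rewrite (_ : (13 + s' == 10) = false); last by lia.
  by rewrite (_ : (13 + s' == 7) = false) ?andbF //; lia.
split.
- by move: c1b c2b; rewrite /weight /acost /=; lia.
- move=> y yh; rewrite fr3; last by apply: contraNN yh; rewrite !inE; lia.
  have y16 : y != 16 by apply: contraNneq yh => ->.
  have y31 : y != 31 by apply: contraNneq yh => ->.
  rewrite /= (negbTE y16) (negbTE y31) r2E //; try by apply: contraNneq yh => ->.
  by apply: contraNN yh; rewrite !inE; lia.
- split=> // h' q'; rewrite flag5 par5; case: andP => [[/eqP -> _]|_] /=; last exact: L.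
  by exists x.
- split; last by rewrite /tab fw5 // (_ : (15 == 11 + s) = false) ?andbF //; lia.
  split.
  + move=> h' q' f of_ hk; rewrite fw5 //; first by rewrite (negbTE hk).
    by move: of_; rewrite /other_field; lia.
  + by move=> h' q' hk; rewrite par5 (negbTE hk).
  + move=> y y16; case: so5 => _ h5 _; rewrite h5 //; case: so1 => _ h1 _; rewrite -h1 //.
    have E f q' : (y == trie (lev k) q' + f) = false by have /andP[? ?] := node_trie (lev k) q'; lia.
    by rewrite /m4 /m3 /m2 /= !E.
  + by case: so5 => _ _ ->; case: so1 => _ _ <-.
split; last first.
  rewrite !cnt5 //; have : s = 0 \/ s = 1 by lia.
  by case=> es; rewrite es /=; lia.
split; last by rewrite le5.
split.
- move=> q'; rewrite flag5 eqxx /= par5 eqxx /=; case: (eqVneq q' q) => [->|qq] /=.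
    split; first by rewrite /qname fw5 // [10 == _]eq_sym s11 andbF !eqxx.
    exists s, (cnt m k s); rewrite cnt5 // eqxx ltnSn le5 // leE; split=> //.
    exact: lastep_now.
  move=> /bl[qe [s' [i [s'2 ic pq le]]]]; split.
    by rewrite /qname fw5 // [10 == _]eq_sym s11 andbF (negbTE qq) andbF.
  exists s', i; rewrite cnt5 // le5 //; split=> //.
  by case: eqP => // es; rewrite -es; lia.
- move=> q' e' le e'0 ee'; rewrite flag5 eqxx /=; case: (eqVneq q' q) le => [//|qq] /= le.
  exact: (rv q' e').
- move=> q' q'0; rewrite /stamp fw5 // [8 == _]eq_sym (_ : (11 + s == 8) = false) ?andbF; last by lia.
  exact: st.
- move=> s' s'2; have [l1 l2 l3 l4] := ls s' s'2; rewrite cnt5 // le5 //; split=> //.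
  + by move: l1; rewrite -/e -/s; case: (eqVneq s' s) => [->|_] //; lia.
  + by case: eqP => // es _; split=> //; rewrite es leE.
- move=> s' s'2; rewrite cnt5 // le5 //; case: eqP => [-> _|_]; last exact: tps.
  by rewrite leE.
Qed.
End Down.

Section Access.
Context {disp : Order.disp_t} {U : orderType disp}.
Implicit Types (m : memory U) (r : env) (a : nat -> nat).

Lemma hoisting_ext a t n k (D D' : pred nat) d m : D =1 D' -> hoisting a t n k D d m ->
  hoisting a t n k D' d m.
Proof.
move=> DD [[bl rv st ls tps] leE]; split=> //; split=> //.
- by move=> q /bl[qe [s [i [s2 ic pq le]]]]; split=> //; exists s, i; rewrite -DD.
- by move=> q e; rewrite -DD; apply: rv.
Qed.

Definition down_vars := [:: 17; 18; 19; 26; 27; 29; 30; 34; 36] ++ hoist_vars.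

(** Of the six weights, three pay for hanging three blocks and three are stored as potential for
    their eviction. *)
Lemma down_body_spec a t W V n r m k : wfm W n m -> layout (fun=> n) m -> room W V ->
  halfway a t n k m -> level a t.+1 n k.+1 m -> a t <= n ->
  fresh_access a t k -> 100 * n + 200 <= V -> t + 20 <= W ->
  r 0 = a t -> r 1 = 0 -> r 17 = lev k.+1 -> r 25 = t ->
  hwp W down_body (fun c r' m' => [/\ c + load m' k <= load m k + (6 * weight k + 200),
    frame down_vars r r' /\ r' 17 = lev k,
    wfm W n m' /\ layout (fun=> n) m', off k m m' /\ tab m' k = tab m k & level a t.+1 n k m']) r m.
Proof.
move=> wm L rm hw lv an fa nV tW r0 r1 r17 r25; have W100 := room_W rm.
have hl : lev k < 2 ^ lev k by exact: ltn_expl.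
have ek := exp_lev k; have e4 := epo_ge4 k.
case: (fa) => b0 _; set b := bk k (a t) in b0.
have Bn : 2 ^ lev k <= n.
  by apply: leq_trans an; have := leq_divM (a t) (2 ^ lev k); rewrite -/(bk k (a t)) -/b; nia.
have bi : b <= a t by exact: leq_div.
have te : t %/ epo k <= t by exact: leq_div.
have eV : epo k <= 2 ^ lev k by rewrite ek leq_pmull //; lia.
have tb0 : trie (lev k) 0 + 200 <= W by apply: (trie_bound rm); lia.
have sE : (t %/ epo k).+1 - 2 * ((t %/ epo k).+1 %/ 2) = (t %/ epo k).+1 %% 2 by exact: mod2E.
have d2 : (t %/ epo k).+1 %/ 2 <= (t %/ epo k).+1 by exact: leq_div.
have d22 : 2 * ((t %/ epo k).+1 %/ 2) <= (t %/ epo k).+1 by lia.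
have s2 : (t %/ epo k).+1 %% 2 < 2 by exact: ltn_mod.
have tabE : tab m k = epo k by case: hw => _ [].
have H0 := halfway_hoisting hw.
have b1 : 32 * 2 ^ lev k + 32 <= V by lia.
rewrite /down_body; apply: hwp_seq; apply: hwp_assign; [by []|lia| |].
  by rewrite /= r17 levS mulKn //; split=> //; lia.
rewrite [eval _ _ _](_ : _ = lev k); last by rewrite /= r17 levS mulKn.
apply: hwp_seq; apply: hwp_assign; [by []|lia| |].
  by apply: safe_trie => //=; lia.
rewrite eval_trie /=.
apply: hwp_seq; apply: hwp_assign; [by []|lia|rewrite /=; repeat split; lia|rewrite /= -/(tab m k) tabE].
apply: hwp_seq; apply: hwp_assign; [by []|lia|rewrite /= -ek; split=> //; lia|rewrite /= -ek].
apply: hwp_seq; apply: hwp_assign; [by []|lia| |rewrite /= r0 -/(bk k (a t)) -/b].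
  by rewrite /= r0 -/(bk k (a t)) -/b; split=> //; lia.
apply: hwp_seq; apply: hwp_assign; [by []|lia| |rewrite /= r25 (addn1 (t %/ epo k))].
  by rewrite /= r25; repeat split => //; lia.
apply: hwp_seq; apply: hwp_assign; [by []|lia| |rewrite /= sE].
  by rewrite /= sE; repeat split; lia.
apply: hwp_seq; apply: hwp_assign; [by []|lia|rewrite /=; repeat split; lia|rewrite /= subn1].
set ra := upd _ 19 _.
have fra : frame down_vars r ra.
  by move=> x xd; rewrite /ra /= !ifN //; apply: contraNneq xd => ->.
have [a1 a17 a18 a19] : [/\ ra 1 = 0, ra 17 = lev k, ra 18 = 2 ^ lev k & ra 19 = b.-1] by [].
have [a26 a29 a30] : [/\ ra 26 = epo k, ra 29 = (t %/ epo k).+1 %% 2 & ra 30 = trie (lev k) 0] by [].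
move: ra fra a1 a17 a18 a19 a26 a29 a30 => ra fra a1 a17 a18 a19 a26 a29 a30.
have cov q m1 : off k m m1 -> touched a k q t ->
    q %/ 2 ^ lev k <= 1 \/ flag m1 (lev k.+1) (q %/ 2 ^ lev k) != 0.
  move=> of1 /touched_up/orP[|tc]; [by left|right].
  have kk : k.+1 != k by rewrite eqn_leq ltnn.
  exact: touched_flag (level_frame (off_level of1 kk) lv) tc.
have tq1 : touched a k b.-1 t by rewrite /touched -/b; lia.
have tq2 : touched a k b t by rewrite /touched -/b; lia.
have tq3 : touched a k b.+1 t by rewrite /touched -/b; lia.
apply: hwp_seq; apply: hwp_conseq (@hoist_spec _ _ a t W V n ra m k b.-1 _ _ wm L rm H0 isT tq1 Bn (cov _ _ (off_refl _ _) tq1) a1 a17 a18 a19 a26 a29 a30 b1 _) _; first by lia.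
move=> c1 r2 m1 [c1b fr1 [wm1 L1] [of1 tab1] [H1 ct1]].
apply: hwp_seq; apply: hwp_assign; [by []|lia|rewrite /= fr1 // a19; repeat split; lia|rewrite /= fr1 // a19].
rewrite (_ : b.-1 + 1 = b); last by lia.
apply: hwp_seq; apply: hwp_conseq (@hoist_spec _ _ a t W V n _ m1 k b _ _ wm1 L1 rm H1 isT tq2 Bn (cov _ _ of1 tq2) _ _ _ _ _ _ _ b1 _) _ => //=; try by rewrite fr1.
  by lia.
move=> c2 r3 m2 [c2b fr2 [wm2 L2] [of2 tab2] [H2 ct2]].
have r3E x : x \notin hoist_vars -> x != 19 -> r3 x = ra x.
  by move=> xh x19; rewrite fr2 //= (negbTE x19) fr1.
have r319 : r3 19 = b by rewrite fr2.
have of12 : off k m m2 by apply: off_trans of1 of2.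
apply: hwp_seq; apply: hwp_assign; [by []|lia|rewrite /= r319; repeat split; lia|rewrite /= r319 (addn1 b)].
apply: hwp_conseq (@hoist_spec _ _ a t W V n _ m2 k b.+1 _ _ wm2 L2 rm H2 isT tq3 Bn (cov _ _ of12 tq3) _ _ _ _ _ _ _ b1 _) _ => //=; try by rewrite r3E.
  by lia.
move=> c3 r4 m3 [c3b fr3 wl3 [of3 tab3] [H3 ct3]]; split=> //.
- rewrite /load ct3 ct2 ct1; move: c1b c2b c3b; rewrite /acost /= !mulnS; lia.
- have f4 x : x \notin hoist_vars -> x != 19 -> r4 x = ra x.
    by move=> xh x19; rewrite fr3 //= (negbTE x19) r3E.
  split; last by rewrite f4.
  move=> x xd; rewrite f4 ?fra //; first by move: xd; rewrite /down_vars mem_cat negb_or => /andP[].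
  by apply: contraNneq xd => ->.
- by split; [apply: off_trans of12 of3|rewrite tab3 tab2 tab1].
- apply: (hoisting_level fa an); apply: hoisting_ext H3 => q.
  by rewrite /touched -/b /= orbF; lia.
Qed.

Lemma down_loop_spec a t W V n K r m : wfm W n m -> layout (fun=> n) m -> room W V ->
  (forall j, j < K -> halfway a t n j m /\ fresh_access a t j) ->
  (forall j, K <= j -> level a t.+1 n j m) -> a t <= n -> 100 * n + 200 <= V -> t + 20 <= W ->
  lev K < W ->
  r 0 = a t -> r 1 = 0 -> r 17 = lev K -> r 25 = t ->
  hwp W (while_pos 34 (Bin Minus (Var 17) (Lit 4)) down_body) (fun c r' m' =>
    [/\ c + \sum_(0 <= j < K) load m' j <= \sum_(0 <= j < K) (load m j + (6 * weight j + 220)) + 10,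
      frame down_vars r r', wfm W n m' /\ layout (fun=> n) m', nonlev m m' /\
        (forall j, K <= j -> same_level j m m') & forall j, level a t.+1 n j m']) r m.
Proof.
move=> wm L rm; have W100 := room_W rm.
elim: K r m wm L => [|K IH] r m wm L hw lv an nV tW KW r0 r1 r17 r25.
  apply: hwp_while => //; [lia|rewrite /= r17; repeat split; lia|rewrite /= r17 /=].
  rewrite !big_geq //; split=> //; first exact: frame_upd.
  by move=> j; apply: lv.
apply: hwp_while => //; [lia|rewrite /= r17; repeat split; lia|rewrite /= r17].
have h4 := lev_gt0 K; rewrite (_ : (lev K.+1 - 4 == 0) = false); last by rewrite levS; lia.
have [hwK faK] := hw K (ltnSn K).
apply: hwp_conseq (@down_body_spec a t W V n _ m K wm L rm hwK (lv _ (leqnn _)) an faK nV tW _ _ _ _) _ => //.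
move=> c1 r2 m2 [c1b [fr2 e17] [wm2 L2] [of2 _] lvK].
apply: hwp_conseq (IH r2 m2 wm2 L2 _ _ an nV tW _ _ _ e17 _) _.
- move=> j jK; have [hj fj] := hw j (ltnW jK); split=> //.
  by apply: halfway_frame hj; apply: (off_level of2); rewrite neq_ltn jK.
- move=> j; rewrite leq_eqVlt => /orP[/eqP <-//|Kj].
  by apply: level_frame (lv j Kj); apply: (off_level of2); rewrite neq_ltn Kj orbT.
- by move: KW; rewrite levS; lia.
- by rewrite fr2.
- by rewrite fr2.
- by rewrite fr2.
move=> c2 r3 m3 [c2b fr3 wl3 [nl3 sl3] lv3].
have ld j : j < K -> load m2 j = load m j.
  move=> jK; have jk : j != K by rewrite neq_ltn jK.
  by have [_ _ _ [cE _ _]] := same_level_fields (off_level of2 jk); rewrite /load !cE.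
have ldK : load m3 K = load m2 K.
  by have [_ _ _ [cE _ _]] := same_level_fields (sl3 K (leqnn K)); rewrite /load !cE.
split=> //.
- rewrite !big_nat_recr //= ldK.
  have e : \sum_(0 <= j < K) (load m2 j + (6 * weight j + 220)) = \sum_(0 <= j < K) (load m j + (6 * weight j + 220)).
    by apply: eq_big_nat => j /andP[_ jK]; rewrite ld.
  by move: c1b c2b; rewrite e /acost /=; lia.
- exact: frame_comp (frame_updl _ fr2) fr3.
split; first exact: nonlev_trans (off_nonlev of2) nl3.
move=> j Kj; apply: same_level_trans (off_level of2 _) (sl3 j (ltnW Kj)).
by rewrite neq_ltn Kj orbT.
Qed.

Lemma access_spec a t W V n r m : wfm W n m -> layout (fun=> n) m -> room W V ->
  (forall j, level a t n j m) -> (forall s, s <= t -> a s <= n) ->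
  100 * (n + 2) * (n + 2) <= V -> t + 20 <= W ->
  word m 1 = n -> word m 3 = t -> r 0 = a t -> r 1 = 0 ->
  hwp W access (fun c r' m' => exists K,
    [/\ c + \sum_(0 <= j < K) load m' j <= \sum_(0 <= j < K) (load m j + (6 * weight j + 630)) + 200,
      (forall j, K <= j -> same_level j m m') /\ (forall j, j < K -> fresh_access a t j),
      wfm W n m' /\ layout (fun=> n) m', (forall j, level a t.+1 n j m') &
      [/\ word m' 3 = t.+1, forall y, y < 16 -> y != 3 -> word m' y = word m y, item m' = item m &
        forall h q f, other_field f -> (forall j, h != lev j) -> word m' (trie h q + f) = word m (trie h q + f)]]) r m.
Proof.
move=> wm L rm lv an nV tW w1 w3 r0 r1; have W100 := room_W rm.
have ant := an t (leqnn t).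
rewrite /access; apply: hwp_seq; apply: hwp_assign; [by []|lia|sd|rewrite /= w3].
apply: hwp_seq; apply: hwp_assign; [by []|lia|sd|rewrite /= w1].
asg; asg.
have b1 : 2 ^ lev 0 + a t <= V by rewrite (_ : 2 ^ lev 0 = 16) //; lia.
apply: hwp_seq; apply: hwp_conseq (@up_test_spec _ _ W V _ m 0 (a t) t (w_bounded wm) rm b1 tW _ _ _ _) _ => //.
move=> c1 r2 _ [c1b -> fr2 [e18 e36 e27 e28]].
apply: hwp_seq.
apply: hwp_conseq (@up_loop_spec _ _ a t W V n (a t) r2 m 0 _ wm L rm (fun j _ => lv j) an nV tW _ _ _ e18 _ _ _ e27 e36 e28) _ => //; try by rewrite fr2.
move=> c2 r3 m2 [K [_ [c2b [fr3 r317] [wm2 L2] [hw st] [nl2 sl2]]]].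
(* The access is new at level [K - 1], so [2 ^ lev (K - 1)] is at most [a t], and [lev K] is only
   twice the exponent. *)
have KW : lev K < W.
  have -> : lev K = 4 * 2 ^ K by [].
  have : K <= a t.
    case: (ltnP (a t) K) => // l; have [_ [b0 _]] := hw (a t) l.
    by rewrite bk0 in b0.
  case: K {c2b r317 hw st sl2 } (hw) => [|K] hw Ka; first by rewrite expn0; lia.
  have [_ [b0 _]] := hw K (ltnSn K).
  have : 2 ^ lev K <= a t.
    by have := leq_divM (a t) (2 ^ lev K); rewrite -/(bk K (a t)); nia.
  have := ltn_expl (lev K) (isT : 1 < 2); rewrite expnS -[lev K]/(4 * 2 ^ K); lia.
apply: hwp_seq.
apply: hwp_conseq (@down_loop_spec a t W V n K r3 m2 wm2 L2 rm hw _ ant _ tW KW _ _ r317 _) _.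
- move=> j Kj; apply: level_stop; last exact: stop_up Kj st.
  by apply: level_frame (lv j); apply: sl2; rewrite Kj orbT.
- by lia.
- by rewrite fr3 // fr2.
- by rewrite fr3 // fr2.
- by rewrite fr3 // fr2.
move=> c3 r4 m3 [c3b fr4 [wm3 L3] [nl3 sl3] lv3].
have r425 : r4 25 = t by rewrite fr4 // fr3 // fr2.
apply: hwp_store; [by []|rewrite /=; repeat split; lia|rewrite /= r425; repeat split; lia|rewrite /= r425 (addn1 t)].
have tE h q f : (trie h q + f == 3) = false by have /andP[? ?] := node_trie h q; lia.
have sl j : same_level j m3 (wr m3 3 t.+1).
  by split=> [q|q f _]; rewrite /par /= tE.
exists K; split.
- have e1 : \sum_(0 <= j < K) load (wr m3 3 t.+1) j = \sum_(0 <= j < K) load m3 j.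
    apply: eq_bigr => j _; have [_ _ _ [cE _ _]] := same_level_fields (sl j).
    by rewrite /load !cE.
  have sD (f g : nat -> nat) c : \sum_(0 <= j < K) (f j + (g j + c)) =
      \sum_(0 <= j < K) f j + \sum_(0 <= j < K) g j + K * c.
    by rewrite big_split /= big_split /= sum_nat_const_nat subn0 addnA.
  have sC (f : nat -> nat) c : \sum_(0 <= j < K) (f j + c) = \sum_(0 <= j < K) f j + K * c.
    by rewrite big_split /= sum_nat_const_nat subn0.
  move: c2b c3b; rewrite e1 (sD (load m)) (sD (load m2)) (sC (load m)) => c2b c3b.
  by move: c1b c2b c3b; rewrite /acost /=; lia.
- split=> j jK; last by case: (hw j).
  apply: same_level_trans (sl j); apply: same_level_trans (sl3 j jK); apply: sl2.
  by rewrite jK orbT.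
- split; first by apply: wfm_write => //; lia.
  by move=> h q; have := L3 h q; rewrite /flag /par /= !tE.
- by move=> j; apply: level_frame (sl j) (lv3 j).
case: nl2 => n21 n22 n23; case: nl3 => n31 n32 n33; split=> //=.
- by move=> y y16 y3; rewrite (negbTE y3) n32 // n22.
- by rewrite n33.
- by move=> h q f of_ hl; rewrite tE n31 // n21.
Qed.
End Access.

(** * Counting new blocks *)

Lemma sum_div_pow N M : \sum_(0 <= j < N) M %/ 2 ^ j <= 2 * M.
Proof.
elim: N M => [|N IH] M; first by rewrite big_geq.
rewrite big_nat_recl //= expn0 divn1.
under eq_bigr => j _ do rewrite expnS divnMA.
have := IH (M %/ 2); lia.
Qed.

(** The shift [c] serves the induction: splitting off the first term halves [M] and raises [c] by
    one. *)
Lemma sum_lin_div_pow N c M : \sum_(0 <= h < N) (h + c) * (M %/ 2 ^ h) <= 2 * (c + 1) * M.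
Proof.
elim: N c M => [|N IH] c M; first by rewrite big_geq.
rewrite big_nat_recl //= expn0 divn1 add0n.
under eq_bigr => j _ do rewrite expnS divnMA addSnnS.
apply: leq_trans (leq_add (leqnn _) (IH c.+1 (M %/ 2))) _.
have : M %/ 2 * 2 <= M by exact: leq_divM.
nia.
Qed.

Lemma sum_pow_le N M : \sum_(0 <= j < N | 2 ^ j <= M) 2 ^ j <= 2 * M.
Proof.
have full K : \sum_(0 <= j < K) 2 ^ j < 2 ^ K.
  elim: K => [|K IH]; first by rewrite big_geq.
  by rewrite big_nat_recr //= expnS; lia.
elim: N => [|N IH]; first by rewrite big_geq.
rewrite big_mkcond big_nat_recr //= -big_mkcond /=; case: ifP => h; last by rewrite addn0.
have : \sum_(0 <= j < N | 2 ^ j <= M) 2 ^ j <= \sum_(0 <= j < N) 2 ^ j.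
  by rewrite big_mkcond leq_sum // => j _; case: ifP.
by have := full N; lia.
Qed.

Lemma sum_dvdn d M : 0 < d -> \sum_(1 <= N < M.+1) (d %| N) = M %/ d.
Proof.
move=> d0; elim: M => [|M IH]; first by rewrite big_geq // div0n.
by rewrite big_nat_recr //= IH divnS // addnC.
Qed.

(** With the sums exchanged, height [h] is met once in [2 ^ h] increments, and the sum of [h.+1]
    over [2 ^ h] converges. *)
Lemma carry_total n : \sum_(0 <= i < n) carry_cost 0 i.+2 <= 4 * n.+1.
Proof.
have -> : \sum_(0 <= i < n) carry_cost 0 i.+2 = \sum_(2 <= N < n.+2) carry_cost 0 N.
  by rewrite [RHS]big_add1 [RHS]big_add1.
apply: (@leq_trans (\sum_(1 <= N < n.+2) \sum_(0 <= h < n.+2) h.+1 * (2 ^ h %| N))).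
  rewrite [leqRHS]big_ltn // -[leqLHS]add0n leq_add // big_nat [leqRHS]big_nat leq_sum // => N /andP[N2 Nn].
  rewrite /carry_cost big_mkcond [leqRHS](big_cat_nat (n := N)) //=; last by lia.
  rewrite -[leqLHS]addn0 leq_add // leq_sum // => h _; by case: ifP; rewrite ?muln1 // muln0.
rewrite exchange_big /= (leq_trans _ (_ : 2 * (1 + 1) * n.+1 <= _)) //.
apply: leq_trans (sum_lin_div_pow n.+2 1 n.+1); apply: leq_sum => h _.
by rewrite -big_distrr /= sum_dvdn ?expn_gt0 // addn1.
Qed.

Section Amortization.
Variable a : nat -> nat.

Definition gap x y := (x - y) + (y - x).

Definition isnew k t := (0 < bk k (a t)) &&
  all (fun s => ~~ ((bk k (a s) == bk k (a t)) && (s %/ epo k == t %/ epo k))) (iota 0 t).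

Definition far k t :=
  all (fun s => ~~ ((gap (a t) (a s) < radius k) && (t - s < radius k))) (iota 0 t).

Lemma fresh_new k t : fresh_access a t k -> isnew k t.
Proof.
move=> [b0 h]; rewrite /isnew b0; apply/allP => s; rewrite mem_iota => /andP[_ st].
by apply/negP => /andP[/eqP be /eqP se]; apply: (h s).
Qed.

(* Following an access back through close predecessors leads, within its epoch, to a far access,
   or across the start of the epoch. *)
Lemma chain_back k t : let tau := t %/ epo k * epo k in
  (exists y, [/\ tau <= y <= t, far k y & gap (a t) (a y) <= (t - y) * radius k]) \/
  (exists z, [/\ z < tau, tau < z + radius k & gap (a t) (a z) <= (t - z) * radius k]).
Proof.
elim/ltn_ind: t => t IH tau; have tt : tau <= t by exact: leq_divM.
case: (boolP (far k t)) => ft.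
  by left; exists t; split=> //; [rewrite tt leqnn|rewrite /gap; lia].
have [s] := allPn ft; rewrite mem_iota negbK => /andP[_ st] /andP[g1 g2].
have st' : s < t by exact: st.
have r2 := radius_ge2 k.
have step y : y <= s -> gap (a s) (a y) <= (s - y) * radius k -> gap (a t) (a y) <= (t - y) * radius k.
  move=> ys h; have -> : t - y = (s - y) + (t - s) by lia.
  rewrite mulnDl; have : radius k <= (t - s) * radius k by rewrite leq_pmull //; lia.
  by move: h g1; rewrite /gap; lia.
case: (ltnP s tau) => stau.
  right; exists s; split=> //; first by lia.
  by apply: step; rewrite // /gap; lia.
have e : s %/ epo k = t %/ epo k.
  apply/eqP; rewrite eqn_leq leq_div2r ?(ltnW st') //= -[X in X <= _](mulnK (t %/ epo k) (d := epo k)).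
    exact: leq_div2r.
  by have := epo_ge4 k; lia.
have := IH s st'; rewrite e -/tau => -[[y [/andP[y1 y2] fy gy]]|[z [z1 z2 gz]]].
  by left; exists y; split=> //; [rewrite y1 (leq_trans y2 (ltnW st'))|apply: step].
by right; exists z; split=> //; apply: step => //; lia.
Qed.

Lemma near_block k x y : gap x y <= 2 ^ lev k -> bk k x <= (bk k y).+1.
Proof.
by move=> h; apply: leq_divS; [rewrite expn_gt0|move: h; rewrite /gap; lia].
Qed.

Definition neighbours k (e z : nat) := [:: (e, (bk k (a z)).-1); (e, bk k (a z)); (e, (bk k (a z)).+1)].

Lemma neighbours_mem k e t z : gap (a t) (a z) <= 2 ^ lev k -> (e, bk k (a t)) \in neighbours k e z.
Proof.
move=> h; have h1 := near_block h.
have h2 : bk k (a z) <= (bk k (a t)).+1 by apply: near_block; move: h; rewrite /gap; lia.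
by rewrite /neighbours !inE !xpair_eqE eqxx /=; lia.
Qed.

(** The pair of epoch and block is injective on new accesses. By [chain_back] it lies in [L1], three
    blocks for each far access, or in [L2], three for each of the [radius k] times before each epoch
    after the first. *)
Lemma new_count k T :
  count (isnew k) (iota 0 T) <= 3 * count (far k) (iota 0 T) + 3 * (radius k * (T %/ epo k)).
Proof.
have e4 := epo_ge4 k; have r2 := radius_ge2 k.
have rr : radius k * radius k = epo k by rewrite /epo radiusS.
set L1 := flatten [seq neighbours k (y %/ epo k) y | y <- [seq y <- iota 0 T | far k y]].
set L2 := flatten [seq neighbours k e (e * epo k - i) | e <- iota 1 (T %/ epo k), i <- iota 1 (radius k)].
have size3 (A : Type) (f : A -> seq (nat * nat)) s : (forall x, size (f x) = 3) ->
    size (flatten [seq f x | x <- s]) = 3 * size s.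
  by move=> h; elim: s => //= x s IH; rewrite size_cat IH h; lia.
have s1 : size L1 = 3 * count (far k) (iota 0 T).
  by rewrite /L1 size3 // size_filter.
have s2 : size L2 = 3 * (radius k * (T %/ epo k)).
  rewrite /L2; set ps := [seq (e, i) | e <- iota 1 (T %/ epo k), i <- iota 1 (radius k)].
  have -> : [seq neighbours k e (e * epo k - i) | e <- iota 1 (T %/ epo k), i <- iota 1 (radius k)] =
      [seq neighbours k p.1 (p.1 * epo k - p.2) | p <- ps].
    by rewrite /ps map_allpairs.
  by rewrite size3 // size_allpairs !size_iota (mulnC (_ %/ _)).
rewrite -s1 -s2 -size_cat -size_filter -(size_map (fun t => (t %/ epo k, bk k (a t)))).
apply: uniq_leq_size.
  rewrite map_inj_in_uniq ?filter_uniq ?iota_uniq // => x y.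
  rewrite !mem_filter !mem_iota => /andP[/andP[_ nx] _] /andP[/andP[_ ny] _] [ex ey].
  case: (ltngtP x y) => // l.
    have := allP ny x; rewrite mem_iota => /(_ l); by rewrite ex ey !eqxx.
  have := allP nx y; rewrite mem_iota => /(_ l); by rewrite ex ey !eqxx.
move=> q /mapP[t]; rewrite mem_filter mem_iota => /andP[_ /andP[_ tT]] -> {q}.
have tT' : t < T by exact: tT.
(* With X for [radius k], a chain spans at most X^2 + X time steps with less than X travelled per
   step, and X^3 + X^2 is at most X^4. *)
have far_enough d : d <= epo k + radius k -> d * radius k <= 2 ^ lev k.
  move=> dl; rewrite exp_lev; apply: leq_trans (leq_mul dl (leqnn _)) _.
  rewrite mulnDl rr; have : 2 * (epo k * radius k) <= epo k * radius k * radius k by rewrite mulnC leq_mul2l r2 orbT.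
  have : epo k <= epo k * radius k by rewrite leq_pmulr //; lia.
  by rewrite -mulnA rr; lia.
have [td tm] : t = t %/ epo k * epo k + t %% epo k /\ t %% epo k < epo k.
  by rewrite -divn_eq ltn_mod; split=> //; lia.
rewrite mem_cat; have [[y [/andP[y1 y2] fy gy]]|[z [z1 z2 gz]]] := chain_back k t.
  apply/orP; left; apply/flattenP; exists (neighbours k (y %/ epo k) y).
    by apply/mapP; exists y => //; rewrite mem_filter fy mem_iota /= (leq_ltn_trans y2).
  have ey : y %/ epo k = t %/ epo k.
    apply/eqP; rewrite eqn_leq leq_div2r //= -[X in X <= _](mulnK (t %/ epo k) (d := epo k)) ?leq_div2r //; lia.
  rewrite ey; apply: neighbours_mem; apply: leq_trans gy _; apply: far_enough; lia.
apply/orP; right; apply/flattenP; exists (neighbours k (t %/ epo k) z).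
  apply/allpairsP; exists (t %/ epo k, t %/ epo k * epo k - z) => /=; rewrite !mem_iota; split.
  - case: (posnP (t %/ epo k)) z1 => [->//|e0 _]; rewrite add1n ltnS leq_div2r //; exact: ltnW.
  - by lia.
  - by congr neighbours; lia.
apply: neighbours_mem; apply: leq_trans gz _; apply: far_enough; lia.
Qed.

Lemma new_small k t n : isnew k t -> a t <= n -> 2 ^ k <= n.
Proof.
case/andP=> b0 _ an; apply: leq_trans an; apply: (@leq_trans (2 ^ lev k)).
  by rewrite leq_exp2l //; rewrite /lev; have := ltn_expl k (isT : 1 < 2); lia.
by have := leq_divM (a t) (2 ^ lev k); rewrite -/(bk k (a t)); nia.
Qed.

(** Levels from [a t] on may be left out, as the leaf lies in block 0 there. *)
Definition work t := \sum_(0 <= j < a t | isnew j t) 2 ^ j.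

(** Turns the term [2 ^ j * T / radius j], owed for the starts of epochs, into [4 * T / 2 ^ j],
    whose sum over [j] is O(T). *)
Lemma pow_radius j : 2 ^ j * 2 ^ j <= 4 * radius j.
Proof.
rewrite -expnD -[4]/(2 ^ 2) /radius -expnD leq_exp2l //.
elim: j => // [[|[|j]]] // IH; rewrite expnS; have := ltn_expl j.+2 (isT : 1 < 2); lia.
Qed.

Lemma work_total n T (delta : nat -> nat) : (forall s, s < T -> a s <= n) ->
  (forall s k, 0 < s < T -> far k s -> 2 ^ k <= delta s) ->
  \sum_(0 <= t < T) work t <= 6 * (n + \sum_(1 <= s < T) delta s) + 24 * T.
Proof.
move=> an hd.
have e1 : \sum_(0 <= t < T) work t <=
    \sum_(0 <= t < T) \sum_(0 <= j < n | 2 ^ j <= n) 2 ^ j * isnew j t.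
  rewrite big_nat [leqRHS]big_nat leq_sum // => t /andP[_ tT].
  have ant := an t tT; rewrite /work big_mkcond [in leqRHS]big_mkcond.
  rewrite [leqRHS](big_cat_nat (n := a t)) //= -[leqLHS]addn0 leq_add // leq_sum // => j _.
  case: ifP => // nj; by rewrite (new_small nj ant) muln1.
apply: leq_trans e1 _; rewrite exchange_big /=.
have cE (P : nat -> nat -> bool) j : \sum_(0 <= t < T) 2 ^ j * P j t = 2 ^ j * count (P j) (iota 0 T).
  rewrite -big_distrr /=; congr (_ * _).
  by rewrite -sum1_count /= /index_iota subn0 [RHS]big_mkcond; apply: eq_bigr => i _; case: (P j i).
under eq_bigr => j _ do rewrite cE.
apply: (@leq_trans (\sum_(0 <= j < n | 2 ^ j <= n)
   (3 * (2 ^ j * count (far j) (iota 0 T)) + 3 * ((4 * T) %/ 2 ^ j)))).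
  apply: leq_sum => j _; apply: leq_trans (leq_mul (leqnn _) (new_count j T)) _.
  rewrite mulnDr leq_add //; first by lia.
  rewrite mulnCA leq_mul2l /= leq_divRL ?expn_gt0 //.
  have := leq_divM T (epo j); rewrite {2}/epo radiusS => h.
  have := pow_radius j; move: h; set X := T %/ epo j; set R := radius j; set p := 2 ^ j => h1 h2.
  have : p * p * (R * X) <= 4 * R * (R * X) by rewrite leq_mul2r h2 orbT.
  by lia.
rewrite big_split /= -!big_distrr /=.
have a2 : \sum_(0 <= j < n | 2 ^ j <= n) (4 * T) %/ 2 ^ j <= 2 * (4 * T).
  apply: leq_trans (sum_div_pow n (4 * T)).
  by rewrite big_mkcond leq_sum // => j _; case: ifP.
have a1 : \sum_(0 <= j < n | 2 ^ j <= n) 2 ^ j * count (far j) (iota 0 T) <=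
    2 * (n + \sum_(1 <= s < T) delta s).
  under eq_bigr => j _ do rewrite -cE.
  rewrite exchange_big /=; case: T an hd cE a2 => [|T] an hd _ _; first by rewrite big_geq.
  (* The access at time 0 is far at every level although it may only cost 1; its share, at most
     [2 * n], is charged to the leaves. *)
  rewrite big_ltn // mulnDr leq_add //.
    apply: leq_trans (sum_pow_le n n); apply: leq_sum => j _; by case: (far j 0); rewrite ?muln1 ?muln0.
  rewrite big_distrr /= big_nat [leqRHS]big_nat leq_sum // => s hs.
  apply: leq_trans (sum_pow_le n (delta s)).
  rewrite big_mkcond [leqRHS]big_mkcond leq_sum // => j _.
  case: ifP => // _; case: (boolP (far j s)) => f; last by rewrite muln0; case: ifP.
  by rewrite muln1 (hd s j hs f).
lia.
Qed.

End Amortization.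

(** * The represented tree *)

Section Tree.
Context {disp : Order.disp_t} {U : orderType disp}.
Implicit Types (m : memory U) (T : tree).

(** All chains end in 0, so [y != 0] has to be required for nothing to hang from a missing child. *)
Definition hangs n m (y k : nat) (p : nat * nat) :=
  leaf n p.1 /\ exists2 e, y != 0 /\ iter e (par m) p.1 = y & p.2 = k + e.

(** [y] is a node or a missing child, and [w] the pointer by which it is reached in the represented
    tree, null when no leaf is below [y]. *)
Definition shows n m y w T :=
  [/\ tree_at m w T, forall k p, p \in leaves_from k T <-> hangs n m y k p,
      forall k, uniq [seq p.1 | p <- leaves_from k T] & min_pointers m T].

Lemma shows_empty n m y : (forall b, leaf n b -> y != 0 -> ~ under m y b) -> shows n m y 0 Empty.
Proof.
move=> h; split=> //=; last by move=> a l r [].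
move=> k p; split=> // -[lp [e [y0 ye] _]]; by case: (h p.1 lp y0); exists e.
Qed.

Lemma leaves_internal k a l r : ~~ ((if l is Empty then true else false) && (if r is Empty then true else false)) ->
  leaves_from k (Node a l r) = leaves_from k.+1 l ++ leaves_from k.+1 r.
Proof. by case: l; case: r. Qed.

Lemma mem_leaves T b : b \in leaves T <-> exists d, (b, d) \in leaves_from 0 T.
Proof.
split=> [/mapP[[b' d] h /= ->]|[d h]]; first by exists d.
by apply/mapP; exists (b, d).
Qed.

Lemma live_under W n m x b : wfm W n m -> node x -> leaf n b -> under m x b -> mn m x != 0.
Proof.
move=> wm nx lb ub; have [_ _] := w_good wm nx.
by case: eqP => // _ /(_ b lb).
Qed.

Lemma climb_uniq (Lv : nat -> Prop) m x b e e' : forest Lv m -> node x ->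
  iter e (par m) b = x -> iter e' (par m) b = x -> e = e'.
Proof.
move=> F nx; wlog le : e e' / e <= e' => [H h h'|h h'].
  by case: (leqP e e') => l; [apply: H|apply/esym; apply: H => //; exact: ltnW].
apply/eqP; rewrite eqn_leq le leqNgt; apply/negP => l.
apply: (no_cycle F nx (d := e' - e.+1)).
rewrite -{1}h -iterD (_ : (e' - e.+1).+1 + e = e') //; lia.
Qed.

Lemma shows_live W n m f x : wfm W n m -> node x -> mn m x != 0 ->
  (forall b e, leaf n b -> iter e (par m) b = x -> e < f) -> exists T, shows n m x x T.
Proof.
move=> wm; have F := w_forest wm; elim: f x => [|f IH] x nx live hf.
  by have [_ _] := w_good wm nx; rewrite (negbTE live) => -[lb [e he] _]; have := hf _ _ lb he.
have /andP[x16 x0] := nx; have [g0 g1 g2] := w_good wm nx.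
rewrite (negbTE live) in g2; have [lmin umin hmin] := g2.
have top T : (forall k p, p \in leaves_from k T <-> hangs n m x k p) ->
    mn m x \in leaves T /\ forall b, b \in leaves T -> item_le (item m (mn m x)) (item m b).
  move=> hT; split; first by case: umin => e he; apply/mem_leaves; exists e; apply/hT; split=> //; exists e.
  by move=> b /mem_leaves[d /hT[lb [e [_ he] _]]]; apply: hmin => //; exists e.
have side s w : s < 2 -> w = (if mn m (kid m x s) == 0 then 0 else kid m x s) ->
    exists T, shows n m (kid m x s) w T.
  move=> s2 ->; case: eqP => [m0|/eqP m0].
    exists Empty; apply: shows_empty => b lb k0 ub.
    have nk : node (kid m x s) by rewrite /node k0 (f_alkid F).
    by have := live_under wm nk lb ub; rewrite m0.
  have k0 : kid m x s != 0 by apply: contraNneq m0 => ->; rewrite (f_mn0 F).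
  have nk : node (kid m x s) by rewrite /node k0 (f_alkid F).
  apply: IH => // b e lb he; rewrite -ltnS; apply: (hf b) => //=.
  by rewrite he; have [] := f_dn F nx s2 k0.
have [l [tl ml ul pl]] := side 0 _ isT g0.
have [r [tr mr ur pr_]] := side 1 _ isT g1.
(* Decided by the minimum of [x]: it is [x] itself, or [x] has a child and is no leaf. *)
have [lx|lx] : leaf n x \/ ~ leaf n x.
  have [_ [d]] := g2; elim: d => [|d _] /= => [e|e]; first by left; rewrite -e.
  right=> lx; have [_ kz _] := f_lv F lx.
  have [nb _ _] := f_lv F lmin.
  have pn : par m (iter d (par m) (mn m x)) != 0 by rewrite e.
  have c16 : 16 %| iter d (par m) (mn m x) by apply: (iter_par_al _ F); case/andP: nb.
  have nc : node (iter d (par m) (mn m x)).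
    by rewrite /node c16; apply: contraNneq pn => ->; rewrite (f_par0 F).
  have [s [s2 ks _]] := f_up F nc pn; move: ks; rewrite e kz // => h.
  by move: nc; rewrite /node -h eqxx andbF.
- have [_ kz _] := f_lv F lx.
  have hE k p : p \in leaves_from k (Node x Empty Empty) <-> hangs n m x k p.
    rewrite inE; split=> [/eqP ->|[lp [e [_ he] ep]]]; first by split=> //; exists 0; rewrite ?addn0.
    case: p lp he ep => b d /= lb he ->.
    case: e he => [<-|e he]; first by rewrite addn0.
    have [nb _ _] := f_lv F lb.
    have [ex|[s s2 [k0 _]]] := (under_kid F nx nb).1 (ex_intro _ e.+1 he); last by rewrite kz in k0.
    by case: (no_cycle F nb (d := e)); rewrite he ex.
  exists (Node x Empty Empty); split=> //.
  + by split; rewrite ?g0 ?g1 ?kz ?(f_mn0 F).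
  + by move=> a l' r' [[-> -> ->]|[[]|[]]] //; apply: top => k p; apply: hE.
have ne : ~~ ((if l is Empty then true else false) && (if r is Empty then true else false)).
  have [nb _ _] := f_lv F lmin.
  have [e|[s s2 [k0 [d hd]]]] := (under_kid F nx nb).1 umin; first by case: lx; rewrite e.
  case: s s2 k0 hd => [|[|]] // _ k0 hd.
    have /ml : hangs n m (kid m x 0) 0 (mn m x, d) by split=> //; exists d.
    by case: l {tl ml ul pl}.
  have /mr : hangs n m (kid m x 1) 0 (mn m x, d) by split=> //; exists d.
  by case: r {tr mr ur pr_}; rewrite ?andbF.
have hE k p : p \in leaves_from k (Node x l r) <-> hangs n m x k p.
  rewrite leaves_internal // mem_cat; split=> [|[lp [e [_ he] ep]]].
    by case/orP=> [/ml|/mr] [lp [e [k0 he] ep]]; split=> //; exists e.+1; rewrite ?ep ?addSnnS //=;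
      split=> //; rewrite he; have [] := f_dn F nx _ k0.
  have [nb _ _] := f_lv F lp.
  have [ex|[s s2 [k0 [d hd]]]] := (under_kid F nx nb).1 (ex_intro _ e he); first by case: lx; rewrite ex.
  have ed : e = d.+1.
    have [pk _] := f_dn F nx s2 k0.
    have hd' : iter d.+1 (par m) p.1 = x by rewrite /= hd.
    exact: climb_uniq F nx he hd'.
  have hh : hangs n m (kid m x s) k.+1 p by split=> //; exists d => //; rewrite ep ed addSnnS.
  by apply/orP; case: s s2 hh {k0 hd} => [|[|]] // _ hh; [left; apply/ml|right; apply/mr].
exists (Node x l r); split=> //.
- move=> k; rewrite leaves_internal // map_cat cat_uniq ul ur andbT /=.
  apply/hasPn => b /mapP[p /mr[lp [e [k1 he] _]] ->]; apply/negP => /mapP[p' /ml[_ [e' [k0 he']] _]] ep.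
  rewrite -ep in he'; have [p0 _] := f_dn F nx (s := 0) isT k0; have [p1 _] := f_dn F nx (s := 1) isT k1.
  have [nb _ _] := f_lv F lp.
  (* A leaf below both children at equal distance would identify the two children, contrary to word
     9; different distances would give two distances to [x]. *)
  have [ee|ee] : e = e' \/ e <> e' by case: (eqVneq e e'); [left|right; apply/eqP].
    have kk : kid m x 0 = kid m x 1 by rewrite -he -he' ee.
    have [_ w0] := f_dn F nx (s := 0) isT k0; have [_ w1] := f_dn F nx (s := 1) isT k1.
    by move: w0; rewrite kk w1; lia.
  have h1 : iter e.+1 (par m) p.1 = x by rewrite /= he.
  have h0 : iter e'.+1 (par m) p.1 = x by rewrite /= he'.
  by have [] := climb_uniq F nx h1 h0.
- move=> a l' r' [[-> -> ->]|[|]]; [exact: top|exact: pl|exact: pr_].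
Qed.

End Tree.

(** * Lower bounds for the distance *)

Section Distance.
Import Order.TTheory GRing.Theory Num.Theory.
Context {disp : Order.disp_t} {U : orderType disp} {R : realType}.
Implicit Types A : @instance disp U.

Lemma ln2_gt0 : (0 < ln 2 :> R)%R.
Proof. by rewrite ln_gt0 // ltr1n. Qed.

Lemma log2_ge p (x : R) : (2 ^+ p <= x)%R -> (p%:R <= log2 x)%R.
Proof.
move=> h; have p0 : (0 < 2 ^+ p :> R)%R by rewrite exprn_gt0 // ltr0n.
rewrite /log2 ler_pdivlMr ?ln2_gt0 // mulr_natl -lnXn ?ltr0n //.
by rewrite ler_ln // posrE (lt_le_trans p0 h).
Qed.

Lemma log2_ge0 (x : R) : (1 <= x)%R -> (0 <= log2 x)%R.
Proof. by move=> h; apply: (@log2_ge 0); rewrite expr0. Qed.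

(** One of the two logarithms is at least [p] and the other is nonnegative. *)
Lemma dist_term_ge A i j s p : last_access A j = Some s -> s <= clock A ->
  (2 ^ p <= (i - j) + (j - i)) || (2 ^ p <= clock A - s) -> (p%:R%:E <= dist_term A i j :> \bar R)%E.
Proof.
move=> la sc close; rewrite /dist_term la lee_fin.
have gE : (((i - j) + (j - i))%:R = `|i%:R - j%:R| :> R)%R.
  case: (leqP i j) => ij.
    have -> : i - j = 0 by lia.
    by rewrite add0n natrB // distrC ger0_norm // subr_ge0 ler_nat.
  have -> : j - i = 0 by lia.
  by rewrite addn0 natrB ?(ltnW ij) // ger0_norm // subr_ge0 ler_nat ltnW.
have tE : ((clock A - s)%:R = (clock A)%:R - s%:R :> R)%R by rewrite natrB.
have aux q : (1 <= 1 + q%:R :> R)%R by rewrite lerDl ler0n.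
have big q : 2 ^ p <= q -> (p%:R <= log2 (1 + q%:R) :> R)%R.
  move=> h; apply: log2_ge; rewrite -natrX nat1r ler_nat; exact: leqW.
rewrite -addrA -tE -gE; case/orP: close => h.
  by rewrite -[p%:R%R]addr0 lerD ?log2_ge0 // big.
by rewrite -[p%:R%R]add0r lerD ?log2_ge0 // big.
Qed.

Lemma dist_ge A i p : (forall j s, last_access A j = Some s -> s <= clock A /\
    ((2 ^ p <= (i - j) + (j - i)) || (2 ^ p <= clock A - s))) ->
  (p.+1%:R%:E <= dist A i :> \bar R)%E.
Proof.
move=> h; rewrite /dist -[p.+1]add1n natrD EFinD leeD2l //.
rewrite big_seq; elim/big_ind: _ => [|x y hx hy|j _]; first by rewrite leey.
  by rewrite le_min hx hy.
case e : (last_access A j) => [s|]; last by rewrite /dist_term e leey.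
by have [? ?] := h j s e; apply: dist_term_ge e _ _.
Qed.

Lemma dist_ge1 A i : (forall j s, last_access A j = Some s -> s <= clock A) ->
  (1 <= dist A i :> \bar R)%E.
Proof.
move=> h; rewrite /dist -[X in (X <= _)%E]adde0 leeD2l //.
rewrite big_seq; elim/big_ind: _ => [|x y hx hy|j _]; first by rewrite leey.
  by rewrite le_min hx hy.
rewrite /dist_term; case e : (last_access A j) => [s|]; last by rewrite leey.
have sc := h j s e; rewrite lee_fin addr_ge0 // log2_ge0 // -?addrA lerDl ?normr_ge0 //.
by rewrite subr_ge0 ler_nat.
Qed.

End Distance.

(** * The operations preserve the invariant *)

(** With N for n + t + 2, [V] is of order N^2 and the pairing function squares it again. The excess
    over 4 absorbs the constants, since N may be as small as 2. *)
Definition exponent := 30.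
Definition structure := DataStructure add_leaf access change_key.

Lemma room_word N : 2 <= N -> room (N ^ exponent) (100 * (N * N)).
Proof.
move=> N2; have P256 : 256 <= N ^ 8 by rewrite (_ : 256 = 2 ^ 8) // leq_exp2r.
have -> : N ^ exponent = N ^ 8 * N ^ 8 * N ^ 8 * N ^ 6 by rewrite -!expnD.
have -> : N ^ 6 = N * N * (N * N) * (N * N) by rewrite !expnS expn0; lia.
have : 4 <= N * N by exact: (@leq_mul 2 2).
rewrite /room; set P := N ^ 8 in P256 *; set M := N * N => M4.
have b1 : 100 * M + 100 * M + 2 <= P * M.
  by apply: (@leq_trans (256 * M)); [lia|rewrite leq_mul2r P256 orbT].
have b2 : 100 * M <= P * M * (P * M) by nia.
apply: (@leq_trans (P * (P * M * (P * M)))); last first.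
  have M1 : 1 <= P * M by nia.
  have -> : P * P * P * (M * M * M) = P * (P * M * (P * M)) * M by lia.
  by rewrite leq_pmulr //; lia.
have b3 : (100 * M + 100 * M + 2) * (100 * M + 100 * M + 2) <= P * M * (P * M) by exact: leq_mul.
apply: (@leq_trans (256 * (P * M * (P * M)))); last by rewrite leq_mul2r P256 orbT.
have : 4 <= P * M by nia.
by move: b2 b3; set Q := P * M; move=> b2 b3 Q4; have : 16 <= Q * Q; nia.
Qed.

Section Structure.
Context {disp : Order.disp_t} {U : orderType disp}.
Implicit Types (A : @instance disp U) (m : memory U).

Lemma wfm_mono W W' n m : W <= W' -> wfm W n m -> wfm W' n m.
Proof.
by move=> WW [F B G L C]; split=> // x; apply: leq_trans WW.
Qed.

Lemma hwp_halts W c Q (s : state U) : hwp W c Q (reg s) (Defs.mem s) ->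
  exists k s', exec W c s k s'.
Proof.
by move=> /(_ s (conj (fun _ _ => erefl) erefl))[k [s' [_ [_ [E _ _]]]]]; exists k, s'.
Qed.

Lemma hwp_exec W c Q (s s' : state U) k : hwp W c Q (reg s) (Defs.mem s) ->
  exec W c s k s' -> exists r', Q k r' (Defs.mem s').
Proof.
move=> /(_ s (conj (fun _ _ => erefl) erefl))[k1 [s1 [r1 [m1 [E1 [_ <-] H]]]]] E.
by have [<- <-] := exec_det E E1; exists r1.
Qed.

Section Sound.
Variables (a : nat -> nat) (A : @instance disp U).
Let n := num_leaves A.
Let t := clock A.

(* The clock is word 3 and the number of leaves is word 1; the forest is rooted at [hp 2]. *)
Record sound m : Prop := Sound {
  s_wfm : wfm (word_bound exponent A) n m;
  s_layout : layout (fun=> n) m;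
  s_level : forall j, level a t n j m;
  s_n : word m 1 = n;
  s_t : word m 3 = t;
  s_root : word m 0 = if n == 0 then 0 else hp 2;
  s_index : forall i, 0 < i <= n -> word m (trie 0 i + 3) = i;
  s_key : forall i, 0 < i <= n -> item m (trie 0 i) = key A i;
  s_flag : forall h q, flag m h q != 0 -> exists j, h = lev j;
  s_acc : forall s, s < t -> 0 < a s <= n;
  s_last : forall j s, last_access A j = Some s -> s < t /\ a s = j
}.

Lemma room_bound : room (word_bound exponent A) (100 * ((n + t + 2) * (n + t + 2))).
Proof. by apply: room_word; lia. Qed.

Lemma sound_flag0 m q : sound m -> flag m 0 q = 0.
Proof.
move=> S; apply/eqP/negPn/negP => /(s_flag S)[j e].
by have := lev_gt0 j; rewrite -e.
Qed.

End Sound.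

Lemma sound_nil a : sound a (@empty_instance disp U) (Memory (fun=> 0) (fun=> None)).
Proof.
have leaf0 x : leaf 0 x -> False by case=> i; lia.
split=> //.
- split=> //.
  + split=> //.
    * by move=> x /andP[_]; exists 1.
    * by move=> x /leaf0.
  + by move=> x nx; split=> //; rewrite /mn /= => b /leaf0.
- move=> h q; rewrite /flag /=; case: (posnP q) => [->|q0]; first by rewrite home0.
  rewrite home_incomplete //; have := expn_gt0 2 h; nia.
- move=> j; exists 0; split; first by [].
  split=> //.
  + by move=> q e [_ h] /h[s []].
- by move=> i /=; lia.
Qed.

Lemma fields_load j m m' : same_fields j m m' -> load m' j = load m j.
Proof. by case/same_fields_views=> _ _ _ [h _ _]; rewrite /load !h. Qed.

Lemma add_step a A m x : sound a A m ->
  hwp (word_bound exponent A) add_leaf (fun k _ m' =>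
    [/\ k <= 100 * (100 * carry_cost 0 (num_leaves A).+2) + 100,
      sound a (apply_op A (AddLeaf x)) m' & forall j, load m' j = load m j])
    (fun=> 0) (Memory (word m) (upd (item m) 0 (Some x))).
Proof.
move=> S; have rm := room_bound A; case: (S) => wm L lv w1 w3 w0 ix ky fl ac la.
set n := num_leaves A in rm wm L lv w1 w0 ix ky ac *.
apply: hwp_conseq (@add_leaf_spec _ _ _ _ n _ _ x (wfm_item0 (v := Some x) wm _) L _ rm _ _ _ _) _ => //=.
- by move=> q; apply: (sound_flag0 q S).
- by nia.
move=> k r' m' [kb wm' L' [w0' [w1' w3'] pE iE fE]].
have same j : same_fields j m m'.
  move=> q f of_; rewrite fE ?al_trie ?trie_neq0 // trie_eqE.
  by have := lev_gt0 j; case: (lev j).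
split=> // [|j]; last exact: fields_load.
split=> //=.
- by apply: wfm_mono wm'; rewrite /word_bound leq_exp2r //=; lia.
- move=> j; apply: level_n (leqnSn n) _; apply: level_kept (same j) _ (lv j) => q; exact: pE.
- by rewrite w3'.
- move=> i ib; rewrite fE ?al_trie ?trie_neq0 // trie_eqE /= andbT.
  by case: eqP => [-> //|ne]; apply: ix; lia.
- move=> i ib; rewrite iE trie_eqE /=; case: eqP => // ne.
  by apply: ky; lia.
- move=> h q; rewrite {1}/flag fE ?al_trie ?trie_neq0 //= andbF; exact: fl.
- by move=> s /ac /andP[-> /= h]; apply: leqW.
- by move=> j s; case: eqP => // _; apply: la.
Qed.

Lemma key_step a A m i x D : sound a A m -> is_leaf A i -> iter D (par m) (trie 0 i) = 0 ->
  hwp (word_bound exponent A) change_key (fun k _ m' =>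
    [/\ k <= 70 * D + 100,
      sound a (apply_op A (ChangeKey i x)) m' & forall j, load m' j = load m j])
    (upd (fun=> 0) 0 i) (Memory (word m) (upd (item m) 0 (Some x))).
Proof.
move=> S ib hD; have rm := room_bound A; case: (S) => wm L lv w1 w3 w0 ix ky fl ac la.
set n := num_leaves A in rm wm L lv w1 w0 ix ky ac *.
apply: hwp_conseq (@change_key_spec _ _ _ _ n D _ _ x i (wfm_item0 (v := Some x) wm _) rm _ _ _ _ _ hD) _ => //=.
  by nia.
move=> k r' m' [kb wm' sh [_ iE]].
have [wE _] := sh; rewrite /= in wE.
have fE y f : 16 %| y -> 2 < f < 16 -> word m' (y + f) = word m (y + f) by move=> *; apply: wE; lia.
have pE h q : par m' (trie h q) = par m (trie h q) by apply: fE; rewrite ?al_trie.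
have same j : same_fields j m m'.
  by move=> q f of_; apply: fE; rewrite ?al_trie //; move: of_; rewrite /other_field; lia.
split=> // [|j]; last exact: fields_load.
have flE h q : flag m' h q = flag m h q by apply: fE; rewrite ?al_trie.
split=> //=.
- by move=> h q; rewrite flE pE; apply: L.
- by move=> j; apply: level_kept (same j) _ (lv j) => q _; apply: pE.
- by rewrite wE.
- by rewrite wE.
- by rewrite wE.
- by move=> j jb; rewrite fE ?al_trie //; apply: ix.
- move=> j jb; rewrite iE trie_eqE /=; case: eqP => // ne.
  by apply: ky.
- by move=> h q; rewrite flE; apply: fl.
Qed.

Lemma access_step a A m : sound a A m -> is_leaf A (a (clock A)) ->
  hwp (word_bound exponent A) access (fun k _ m' =>
    [/\ sound a (apply_op A (Access (a (clock A)))) m' &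
     k + \sum_(0 <= j < num_leaves A) load m' j <=
     \sum_(0 <= j < num_leaves A) load m j + 100 * (800 * work a (clock A)) + 200])
    (upd (fun=> 0) 0 (a (clock A))) m.
Proof.
move=> S ib; have rm := room_bound A; case: (S) => wm L lv w1 w3 w0 ix ky fl ac la.
set n := num_leaves A in rm wm L lv w1 w0 ix ky ac ib *; set t := clock A in rm lv w3 ac la ib *.
have an s : s <= t -> a s <= n.
  by rewrite leq_eqVlt => /orP[/eqP ->|/ac/andP[]//]; case/andP: ib.
apply: hwp_conseq (@access_spec _ _ a t _ _ n _ m wm L rm lv an _ _ w1 w3 _ _) _ => //=.
- by nia.
- have := room_W rm; nia.
move=> c r' m' [K [cost [sl fr] [wm' L'] lv' [w3' hE iE nl]]].
have flE h q : flag m' h q != 0 -> exists j, h = lev j.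
  case: (boolP [exists j : 'I_h.+1, h == lev j]) => [/existsP[j /eqP e] _|/existsPn nh]; first by exists j.
  rewrite /flag nl //; first exact: fl.
  move=> j; apply/eqP => e; have jh : j < h.+1.
    by rewrite e /lev; have := ltn_expl j (isT : 1 < 2); lia.
  by have := nh (Ordinal jh); rewrite -e eqxx.
split.
  split=> //=.
  - by apply: wfm_mono wm'; rewrite /word_bound leq_exp2r //=; lia.
  - by rewrite hE.
  - by rewrite hE.
  - move=> i ib'; rewrite nl //; first exact: ix.
    by move=> j; have := lev_gt0 j; lia.
  - by move=> i ib'; rewrite iE; apply: ky.
  - move=> s; rewrite ltnS leq_eqVlt => /orP[/eqP ->//|/ac//].
  - move=> j s; case: eqP => [-> [<-]|_ /la[st ->]]; first by [].
    by split=> //; apply: ltnW.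
have Ka : K <= a t.
  by case: (ltnP (a t) K) => // l; have [] := fr _ l; rewrite bk0.
have Kn : K <= n by apply: leq_trans Ka (an t (leqnn t)).
have rest : \sum_(K <= j < n) load m' j = \sum_(K <= j < n) load m j.
  by apply: eq_big_nat => j /andP[Kj _]; apply: fields_load; case: (sl j Kj).
(* Each summand is [48000 * 2 ^ j + 31230], which is below [80000 * 2 ^ j]. *)
have wk : \sum_(0 <= j < K) (6 * weight j + 630) <= 100 * (800 * work a t).
  rewrite /work [in leqRHS](big_cat_nat (n := K)) //= mulnA mulnDr; apply: leq_trans (leq_addr _ _).
  rewrite [in leqRHS]big_mkcond big_distrr /= big_nat [leqRHS]big_nat leq_sum // => j /andP[_ jK].
  rewrite fresh_new ?ifT //; last exact: fr.
  by rewrite /weight /lev; have := expn_gt0 2 j; lia.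
rewrite (big_cat_nat (n := K)) //= [X in _ <= X + _ + _](big_cat_nat (n := K)) //= rest.
by move: cost wk; rewrite big_split /=; lia.
Qed.

End Structure.

(** * Depth and distance *)

Section Depth.
Context {disp : Order.disp_t} {U : orderType disp}.
Implicit Types (A : @instance disp U) (m : memory U).

(** Above a complete block there is a slot or another complete block, so the chain of a leaf cannot
    end within the trie. *)
Lemma complete_par n m h q : layout (fun=> n) m -> 0 < q -> q.+1 * 2 ^ h <= n.+1 ->
  par m (trie h q) != 0 /\
  (par m (trie h q) = trie h.+1 (q %/ 2) -> (q %/ 2).+1 * 2 ^ h.+1 <= n.+1).
Proof.
move=> L q0 cq; have := L h q; case: ifP => _ => [->|[x _ ->]]; last first.
  by split; [exact: slot_neq0|move/slot_trie].
rewrite /home ifF; last by lia.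
case: ifP => _; first by split; [exact: slot_neq0|move/slot_trie].
case: ifP => [h1|_]; last by split; [exact: slot_neq0|move/slot_trie].
by split=> [|_]; [exact: trie_neq0|rewrite expnS].
Qed.

(** A heap node with a child has a parent by [closed_at], and the parent has a child in turn, so the
    chain can only end at the root; [hp 1] is ruled out because it is never a parent. *)
Lemma climb_heap W n m d y s : wfm W n m -> 0 < y -> s < 2 -> kid m (hp y) s != 0 ->
  iter d (par m) (hp y) = 0 -> exists e, iter e (par m) (hp y) = hp 2.
Proof.
move=> wm; have [F _ _ L C] := wm; elim: d y s => [|d IH] y s y0 s2 k0.
  by move=> /= e; have := hp_neq0 y0; rewrite e.
case: (ltngtP y 2) => [y1|y2|->]; last by exists 0.
  have ey : y = 1 by lia.
  move: k0; rewrite ey => k0; have e := L _ _ (node_hp (isT : 0 < 1)) s2 k0.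
  by have [[_ [_]]|[y' [/pr_lt + py _ _]]] := edge_of_hp e; rewrite // -py.
rewrite iterSr => hd.
have py : par m (hp y) != 0.
  by apply/eqP => p0; move: k0; rewrite (C y y2 p0 s s2).
have [_ ep] := par_hp F L y0 py; have [s' [s'2 ks _]] := f_up F (node_hp y0) py.
have p1 := pr_lt y2; rewrite ep in hd ks.
have [||e he] := IH (pr y) s' _ s'2 _ hd; [lia|by rewrite ks hp_neq0|].
by exists e.+1; rewrite iterSr ep.
Qed.

Lemma climb_root W n m d h q : wfm W n m -> layout (fun=> n) m -> 0 < q -> q.+1 * 2 ^ h <= n.+1 ->
  iter d (par m) (trie h q) = 0 -> exists e, iter e (par m) (trie h q) = hp 2.
Proof.
move=> wm La; have [F _ _ L C] := wm; elim: d h q => [|d IH] h q q0 cq.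
  by move=> /= e; have := trie_neq0 h q; rewrite e.
rewrite iterSr => hd; have [p0 pc] := complete_par La q0 cq.
suff [e he] : exists e, iter e (par m) (par m (trie h q)) = hp 2 by exists e.+1; rewrite iterSr.
have [[v v0 ep]|[q1 ep]] := par_trie F L p0.
  have [s [s2 ks _]] := f_up F (node_trie h q) p0; rewrite ep in ks hd *.
  by apply: climb_heap wm _ s2 _ hd; [lia|rewrite ks trie_neq0].
by have := pc ep; rewrite ep in hd * => cp; apply: IH => //; lia.
Qed.

Lemma leaf_climb W n m b : wfm W n m -> layout (fun=> n) m -> leaf n b ->
  exists e, iter e (par m) b = hp 2.
Proof.
move=> wm L lb; have F := w_forest wm; have [nb _ _] := f_lv F lb.
have [d hd] := f_end F nb; case: lb => i ib eb; rewrite eb in hd *.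
by apply: climb_root wm L _ _ hd; lia.
Qed.

Definition near (a : nat -> nat) t i k s := (gap i (a s) < radius k) && (t - s < radius k).

(** As [radius k <= epo k], a near access lies in the current or the preceding epoch, so it keeps
    the block of [i] hung. The alternative [num_leaves A <= k] provides a level even if no access is
    near; [i] is in block 0 there. *)
Lemma leaf_depth a A m i k : sound a A m -> is_leaf A i ->
  has (near a (clock A) i k) (iota 0 (clock A)) || (num_leaves A <= k) ->
  iter (3 * lev k + 8) (par m) (trie 0 i) = 0.
Proof.
move=> S ib hk; have wm := s_wfm S; have L := s_layout S.
suff st : stop m (0 + lev k) (i %/ 2 ^ lev k).
  have := dep_stop wm (layout_own wm L) st.
  by have -> : lev k + 2 * (0 + lev k) + 8 = 3 * lev k + 8 by lia.
rewrite add0n -/(bk k i); case: (leqP (bk k i) 1) => [b1|b1]; first exact: stop_small L b1.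
case/orP: hk => [/hasP[s]|nk]; last first.
  by move: b1; rewrite (bk_le (k := i)) ?bk0 //; case/andP: ib => _ ib; exact: leq_trans nk.
rewrite mem_iota add0n => /andP[_ st] /andP[g1 g2].
have re : radius k <= epo k by rewrite /epo radiusS leq_pmull //; have := radius_ge2 k; lia.
have rr : radius k <= 2 ^ lev k.
  by rewrite exp_lev; apply: leq_trans re _; rewrite leq_pmull //; have := epo_ge4 k; lia.
have tc : touched a k (bk k i) s.
  have h1 : gap i (a s) <= 2 ^ lev k by exact: leq_trans (ltnW g1) rr.
  have h2 : gap (a s) i <= 2 ^ lev k by move: h1; rewrite /gap; lia.
  by have := near_block h1; have := near_block h2; rewrite /touched; lia.
have [T [tp [_ rv _ _ _]]] := s_level S k.
have [e le] := lastep_ex (clock A) (epo k) (touched a k (bk k i)).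
have se : s %/ epo k < e by case: (le) => h _; apply: h.
apply: layout_stop_flag L (rv _ _ le _ _); first by exact: leq_ltn_trans se.
apply: leq_trans (top_epoch_le tp) _; apply: leq_trans se.
by apply: leq_divS; [have := epo_ge4 k; lia|lia].
Qed.

Context {R : realType}.
Local Notation "x <=d d" := (x%:R%:E <= d :> \bar R)%E (at level 70).

Lemma sound_dist1 a A m i : sound a A m -> 1 <=d dist A i.
Proof. by move=> S; apply: dist_ge1 => j s /(s_last S)[/ltnW]. Qed.

Lemma sound_dist a A m i k : sound a A m ->
  ~~ has (near a (clock A) i k) (iota 0 (clock A)) -> (2 ^ k).+1 <=d dist A i.
Proof.
move=> S /hasPn h; apply: dist_ge => j s /(s_last S)[st ej]; split; first exact: ltnW.
have := h s; rewrite mem_iota add0n /= => /(_ st); rewrite /near /gap ej /radius negb_and -!leqNgt.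
by rewrite addnC.
Qed.

(** For the least level [k.+1] the depth is at most [24 * 2 ^ k + 8], while the failure of level [k]
    makes the distance at least [2 ^ k + 1]. At level 0 the depth is at most 20. *)
Lemma dist_depth a A m i : sound a A m -> is_leaf A i ->
  exists D p, [/\ iter D (par m) (trie 0 i) = 0, 0 < p, D <= 32 * p & p <=d dist A i].
Proof.
move=> S ib; pose P k := has (near a (clock A) i k) (iota 0 (clock A)) || (num_leaves A <= k).
have exP : exists k, P k by exists (num_leaves A); rewrite /P leqnn orbT.
case: (ex_minnP exP) => k Pk mk; exists (3 * lev k + 8).
case: k Pk mk => [|k] Pk mk.
  by exists 1; split=> //; [exact: leaf_depth S ib Pk|exact: sound_dist1 S].
exists (2 ^ k).+1; split=> //; first exact: leaf_depth S ib Pk.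
  by rewrite /lev expnS; lia.
apply: sound_dist S _; apply/negP => h.
by have := mk k; rewrite /P h => /(_ isT); rewrite ltnn.
Qed.

(* A lower bound for the distance at the access at time [s]. The bound on [k] loses nothing when
   [0 < s], for then the access at time 0 is near at every larger [k]. *)
Definition delta (a : nat -> nat) s :=
  maxn 1 (\max_(k < (gap (a s) (a 0) + s).+1 | far a k s) 2 ^ k).

Lemma far_delta a s k : 0 < s -> far a k s -> 2 ^ k <= delta a s.
Proof.
move=> s0 fk; suff kb : k < (gap (a s) (a 0) + s).+1.
  rewrite /delta leq_max; apply/orP; right.
  exact: (@leq_bigmax_cond _ (fun k : 'I__ => far a k s) (fun k : 'I__ => 2 ^ k) (Ordinal kb)).
rewrite ltnS leqNgt; apply/negP => l.
have := allP fk 0; rewrite mem_iota add0n => /(_ s0) /negP; apply.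
have : k < radius k by rewrite /radius; apply: ltn_trans (ltn_expl k _) (ltn_expl _ _).
by move: l; rewrite subn0; lia.
Qed.

Lemma delta_dist a A m : sound a A m -> delta a (clock A) <=d dist A (a (clock A)).
Proof.
move=> S; have mx x y : x <=d dist A (a (clock A)) -> y <=d dist A (a (clock A)) ->
    maxn x y <=d dist A (a (clock A)) by rewrite /maxn; case: ifP.
have d1 := sound_dist1 (a (clock A)) S.
apply: (mx) => //; elim/big_ind: _ => [|x y|k fk] //.
- by apply: Order.POrderTheory.le_trans d1; rewrite lee_fin Num.Theory.ler_nat.
- exact: mx.
apply: (@Order.POrderTheory.le_trans _ _ (2 ^ k).+1%:R%:E); first by rewrite lee_fin Num.Theory.ler_nat.
apply: sound_dist S _; apply/hasPn => s sb; exact: (allP fk).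
Qed.

End Depth.

(** * Amortized accounting *)

Section Ledger.
Context {disp : Order.disp_t} {U : orderType disp} {R : realType}.
Implicit Types (A : @instance disp U) (m : memory U) (b d : \bar R).

Local Notation "x <=d d" := (x%:R%:E <= d :> \bar R)%E (at level 70).

Lemma scaled_le c p q d : p <=d d -> q <= c * p -> (q%:R%:E <= c%:R%:E * d)%E.
Proof.
move=> h qp; apply: (@Order.POrderTheory.le_trans _ _ (c%:R%:E * p%:R%:E)%E).
  by rewrite -EFinM -GRing.natrM lee_fin Num.Theory.ler_nat.
by rewrite lee_wpmul2l // lee_fin Num.Theory.ler0n.
Qed.

Lemma add_le p q b d : p <=d b -> q <=d d -> p + q <=d (b + d)%E.
Proof. by move=> h h'; rewrite GRing.natrD EFinD leeD. Qed.

(** Governed by [charge_income], where all coefficients stay below 2.5 million. *)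
Definition rate := 100 * (400 * 100).

Definition charge a A := 100 * (100 * \sum_(0 <= i < num_leaves A) carry_cost 0 i.+2) +
  100 * num_leaves A + \sum_(0 <= s < clock A) (100 * (800 * work a s) + 200).

(** A lower bound for the sum of the amortized costs; the summand [0 < clock A] is the unit paid by
    the very first access. *)
Definition income a A := num_leaves A + (0 < clock A) + \sum_(1 <= s < clock A) delta a s.

Lemma charge_income a A m : sound a A m -> charge a A <= rate * income a A.
Proof.
move=> S; rewrite /charge /income; set n := num_leaves A; set t := clock A.
have an s : s < t -> a s <= n by case/(s_acc S)/andP.
have wt := work_total an (fun s k h => @far_delta a s k (proj1 (andP h))).
have td : t <= (0 < t) + \sum_(1 <= s < t) delta a s.
  apply: (@leq_trans ((0 < t) + \sum_(1 <= s < t) 1)).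
    by rewrite sum_nat_const_nat muln1; case: (t) => // u; rewrite subn1 add1n.
  by rewrite leq_add2l leq_sum // => s _; rewrite /delta leq_maxl.
have ct : \sum_(0 <= i < n) carry_cost 0 i.+2 <= 8 * n.
  case: (n) => [|n']; first by rewrite big_geq.
  by apply: leq_trans (carry_total _) _; lia.
rewrite big_split /= -!big_distrr /= sum_nat_const_nat subn0.
move: wt td ct; rewrite /rate.
set X := \sum_(_ <= _ < _) carry_cost _ _; set Y := \sum_(0 <= _ < _) work _ _.
set Z := \sum_(_ <= _ < _) delta _ _; lia.
Qed.

(* The accesses are quantified as arbitrary extensions of the past ones, so that the invariant need
   not be transported between functions that agree on the past. *)
Lemma history_sound A m k b : history structure exponent A m k b ->
  exists acc, size acc = clock A /\ forall a, (forall s, s < clock A -> a s = nth 0 acc s) ->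
    [/\ sound a A m, k + \sum_(0 <= j < num_leaves A) load m j <= charge a A & income a A <=d b].
Proof.
elim=> [|{}A {}m {}k {}b o k' m' _ [acc [sz IH]] ao [s' E <-]].
  exists [::]; split=> // a _; split; first exact: sound_nil.
  - by rewrite /= big_geq.
  - by rewrite /income /= big_geq.
case: o ao E => [x|i|i x] ao E.
- exists acc; split=> // a ha; have [S cost inc] := IH a ha.
  have [_ [kb S' ld]] := hwp_exec (s := load_op (AddLeaf x) m) (add_step (x := x) S) E; split=> //.
  + rewrite /charge /= !big_nat_recr //=.
    (* The new leaf adds a level to the sum of potentials, one whose blocks are longer than the
       number of leaves. *)
    have l0 : load (Defs.mem s') (num_leaves A) = 0.
      have [T [_ [_ _ _ ls _]]] := s_level S (num_leaves A).
      rewrite ld /load; have c0 s : s < 2 -> cnt m (num_leaves A) s = 0.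
        move=> s2; have [_ _ _ h] := ls s s2; apply/eqP; rewrite -leqn0 leqNgt; apply/negP => /h[_].
        have := @bk0 (num_leaves A); rewrite /bk => /eqP; rewrite -leqn0 leqNgt divn_gt0 ?expn_gt0 //.
        by move/negP.
      by rewrite !c0 // muln0.
    rewrite l0; under eq_bigr => j _ do rewrite ld.
    by move: cost kb; rewrite /charge; lia.
  + rewrite (_ : income a _ = income a A + 1); first exact: add_le inc (Order.POrderTheory.lexx _).
    by rewrite /income /=; lia.
- exists (rcons acc i); rewrite size_rcons sz; split=> // a ha.
  have ha' s : s < clock A -> a s = nth 0 acc s.
    by move=> st; rewrite ha ?nth_rcons ?sz ?st //=; apply: leqW.
  have ei : i = a (clock A) by rewrite ha //= nth_rcons sz ltnn eqxx.
  have [S cost inc] := IH a ha'; rewrite ei in ao E *.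
  have [_ [S' kb]] := hwp_exec (s := load_op (Access (a (clock A))) m) (access_step S ao) E; split=> //.
  + by rewrite /charge /= big_nat_recr //=; move: cost kb; rewrite /charge; lia.
  + rewrite /amortized_cost; case: eqP => [t0|/eqP t0].
      rewrite (_ : income a _ = income a A + 1); first exact: add_le inc (Order.POrderTheory.lexx _).
      by rewrite /income /= t0 !big_geq //=; lia.
    rewrite /income /= big_nat_recr ?lt0n //= addnA.
    by move: inc; rewrite /income lt0n t0 => inc; apply: add_le inc (delta_dist S).
- exists acc; split=> // a ha; have [S cost inc] := IH a ha.
  have [D [_ [hD _ _ _]]] := dist_depth (R := R) S ao.
  have [_ [_ S' ld]] := hwp_exec (s := load_op (ChangeKey i x) m) (key_step (x := x) S ao hD) E; split=> //.
  + by rewrite addn0 /=; under eq_bigr => j _ do rewrite ld.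
  + by rewrite adde0.
Qed.

Lemma climb_lt a A m (D e : nat) c : sound a A m -> iter D (par m) c = 0 ->
  iter e (par m) c = hp 2 -> e < D.
Proof.
move=> S hD he; rewrite ltnNge; apply/negP => l.
by have := iter_par_ge (w_forest (s_wfm S)) hD l; rewrite he.
Qed.

Lemma sound_represents a A m : sound a A m -> represents R rate A m.
Proof.
move=> S; have wm := s_wfm S; have L := s_layout S.
case: (posnP (num_leaves A)) => [n0|n1].
  exists Empty; split=> //=; last by move=> c l r [].
    by rewrite (s_root S) n0.
  by rewrite /leaves /= n0.
set n := num_leaves A in wm L n1.
have nh : node (hp 2) by exact: node_hp.
have live : mn m (hp 2) != 0.
  have l1 : leaf n (trie 0 1) by exists 1.
  by apply: (live_under wm nh l1); apply: leaf_climb wm L l1.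
have [] := shows_live (f := 3 * lev n + 8) wm nh live.
  move=> b e [i ib ->] he; have ib' : is_leaf A i by [].
  by apply: (climb_lt S _ he); apply: (leaf_depth (k := n) S ib'); rewrite leqnn orbT.
move=> T [tT mT uT pT]; exists T.
have lfE c : c \in leaves T -> exists2 i, 0 < i <= n & c = trie 0 i.
  by case/mem_leaves=> d /mT[].
split=> //.
- by rewrite (s_root S) ifN // -lt0n.
- apply: uniq_perm; rewrite ?iota_uniq //.
    rewrite map_inj_in_uniq; first exact: uT.
    move=> c c' /lfE[i ib ->] /lfE[i' ib' ->].
    by rewrite /leaf_index !(s_index S) // => ->.
  move=> i; rewrite mem_iota add1n ltnS; apply/mapP/idP => [[c /lfE[j jb ->] ->]|ib].
    by rewrite /leaf_index (s_index S).
  have li : leaf n (trie 0 i) by exists i.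
  exists (trie 0 i); last by rewrite /leaf_index (s_index S).
  have [e he] := leaf_climb wm L li; apply/mem_leaves; exists e; apply/mT; split=> //.
  by exists e.
- by move=> c /lfE[i ib ->]; rewrite /leaf_index (s_index S) // (s_key S).
- move=> c d /mT[[i ib /= ->] [e [_ he] /= ->]]; rewrite /leaf_index (s_index S) //.
  have [D [p [hD p0 Dp pd]]] := dist_depth (R := R) S ib.
  apply: scaled_le pd _; rewrite add0n; apply: leq_trans (ltnW (climb_lt S hD he)) _.
  by rewrite /rate; lia.
Qed.

Lemma run_op a A m (o : operation U) : sound a A m -> admissible A o -> a (clock A) = (if o is Access i then i else 0) ->
  exists (k' : nat) (m' : memory U), exec_op structure exponent A o m k' m' /\
    forall i x, o = ChangeKey i x -> (k'%:R%:E <= rate%:R%:E * dist A i :> \bar R)%E.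
Proof.
move=> S; case: o => [x|i|i x] ao ei.
- by have [k' [s' E]] := hwp_halts (s := load_op (AddLeaf x) m) (add_step (x := x) S); exists k', (Defs.mem s'); split=> //; exists s'.
- have ao' : is_leaf A (a (clock A)) by rewrite ei.
  have [k' [s' E]] := hwp_halts (s := load_op (Access (a (clock A))) m) (access_step S ao').
  by exists k', (Defs.mem s'); split=> //; exists s' => //; rewrite -ei.
have [D [p [hD p0 Dp pd]]] := dist_depth (R := R) S ao.
have H := key_step (x := x) S ao hD; have [k' [s' E]] := hwp_halts (s := load_op (ChangeKey i x) m) H.
have [_ [kb _ _]] := hwp_exec (s := load_op (ChangeKey i x) m) H E.
exists k', (Defs.mem s'); split=> [|_ _ [<- _]]; first by exists s'.
by apply: scaled_le pd _; rewrite /rate; lia.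
Qed.

End Ledger.

Theorem theorem12 (R : realType) :
  exists (P : data_structure) (w C : nat),
    forall (disp : Order.disp_t) (U : orderType disp)
           (A : instance U) (m : memory U) (k : nat) (b : \bar R),
      history P w A m k b ->
      [/\ represents R C A m,
          (k%:R%:E <= C%:R%:E * b)%E
        & forall o : operation U, admissible A o ->
            exists (k' : nat) (m' : memory U),
              exec_op P w A o m k' m' /\
              (forall (i : nat) (x : U), o = ChangeKey i x ->
                 (k'%:R%:E <= C%:R%:E * dist A i :> \bar R)%E)].
Proof.
exists structure, exponent, rate => disp U A m k b /history_sound[acc [sz H]].
have [S cost inc] := H (nth 0 acc) (fun _ _ => erefl).
split; first exact: sound_represents S.
  apply: scaled_le inc _; apply: leq_trans (charge_income S).
  exact: leq_trans (leq_addr _ _) cost.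
move=> o ao; pose i := if o is Access i then i else 0.
(* [access_step] takes the index of the access to be [a (clock A)], so the past is extended by the
   coming operation; for other operations the entry 0 is arbitrary. *)
have [|S' _ _] := H (nth 0 (rcons acc i)).
  by move=> s st; rewrite nth_rcons sz st.
by apply: run_op S' ao _; rewrite nth_rcons sz ltnn eqxx.
Qed.
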